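(* In the multi-period market described in the context, for every $n=1,\dots,N$ the following hold. (Time consistent.) The time consistent equilibrium price at time $t_{N-n}$ is given by $$D_{t_{N-n}}=\mathbb{E}^{Q^*}_{t_{N-n}}\big[D_{t_{N-n+1}}+\varphi(t_{N-n},C_{t_{N-n}},S_{t_{N-n}})h\big],$$ where the probability measure $Q^*$ is defined by $\frac{dQ^*}{d\mathbb P}=\Lambda^*_{t_N}\Lambda^*_{t_{N-1}}\cdots\Lambda^*_{t_1}$. The optimal time consistent strategy in the primary asset is $\alpha^*=(\alpha^*_{t_0},\alpha^*_{t_1},\dots,\alpha^*_{t_{N-1}})$, with $$\alpha^*_{t_k}=\frac{1}{2\gamma_{t_k}\sigma^c_{t_k}\sqrt h}\log\left(\frac{1+r^c_{t_k}\sqrt h}{1-r^c_{t_k}\sqrt h}\right)+\frac{1}{2\gamma_{t_k}\sigma^c_{t_k}\sqrt h}\log\left(\frac{\mathbb E_{t_k}\big[e^{-\gamma_{t_k}[D_{t_{k+1}}+Y^*_{t_{k+1}}]}|A_{t_k}\big]}{\mathbb E_{t_k}\big[e^{-\gamma_{t_k}[D_{t_{k+1}}+Y^*_{t_{k+1}}]}|A^c_{t_k}\big]}\right).$$ (Time inconsistent.) The time inconsistent equilibrium price at time $t_{N-n}$ is given by $$D_{t_{N-n}}=\mathbb{E}^{\hat Q}_{t_{N-n}}\big[D_{t_{N-n+1}}+\varphi(t_{N-n},C_{t_{N-n}},S_{t_{N-n}})h\big],$$ where the probability measure $\hat Q$ is defined by $\frac{d\hat Q}{d\mathbb P}=\hat\Lambda_{t_N}\hat\Lambda_{t_{N-1}}\cdots\hat\Lambda_{t_1}$.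 The optimal time inconsistent strategy in the primary asset is $\hat\alpha=(\hat\alpha_{t_0},\hat\alpha_{t_1},\dots,\hat\alpha_{t_{N-1}})$, with $$\hat\alpha_{t_k}=\frac{1}{2\gamma_{t_0}\sigma^c_{t_k}\sqrt h}\log\left(\frac{1+r^c_{t_k}\sqrt h}{1-r^c_{t_k}\sqrt h}\right)+\frac{1}{2\gamma_{t_0}\sigma^c_{t_k}\sqrt h}\log\left(\frac{\mathbb E_{t_k}\big[e^{-\gamma_{t_0}[D_{t_{k+1}}+\hat Y_{t_{k+1}}]}|A_{t_k}\big]}{\mathbb E_{t_k}\big[e^{-\gamma_{t_0}[D_{t_{k+1}}+\hat Y_{t_{k+1}}]}|A^c_{t_k}\big]}\right).$$ Here the random variables $Y^*,\hat Y$ and the one-period kernels $\Lambda^*,\hat\Lambda$ are those defined recursively in the context, with $D$ denoting the time consistent equilibrium price in the first part and the time inconsistent equilibrium price in the second part.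
   Context: Time grid: $t_n=nh$, $n=0,\dots,N$, $h=T/N$, $T>0$ fixed. For a process $Z$, $\Delta Z_{t_n}=Z_{t_{n+1}}-Z_{t_n}$. Noise: $(b^1,\dots,b^d)$ is a $d$-dimensional symmetric binomial random walk on a complete filtered probability space $(\Omega,\mathcal F,\{\mathcal F_{t_n}\},\mathbb P)$, adapted to the filtration, with $\mathbb P(\Delta b^i_{t_n}=\pm1)=1/2$ for each $i$ and with increments $\Delta b_{t_n}$ independent of $\mathcal F_{t_n}$. Assets: the riskless bond is the numeraire (zero interest rate). The primary traded asset satisfies $\Delta C_{t_n}=C_{t_n}(\mu^c_{t_n}h+\sigma^c_{t_n}\sqrt h\,\Delta b^1_{t_n})$, $C_0=c>0$, and the non-traded asset satisfies $\Delta S_{t_n}=S_{t_n}(\mu^s_{t_n}h+\sigma^s_{t_n}\sqrt h(\rho\Delta b^1_{t_n}+\sqrt{1-\rho^2}\,\Delta b^2_{t_n}))$, $S_0=s>0$, $|\rho|<1$, where the drifts and volatilities are adapted processes, chosen so that $C$ stays positive. A derivative security $D$, written on $C$ and $S$ and with adapted price process, has a given $\mathcal F_{t_N}$-measurable terminal payoff $D_{t_N}$ and pays dividend $\varphi(t_n,C_{t_n},S_{t_n})h$ for holding it on $[t_n,t_{n+1}]$. The market price of risk is $r^c_{t_n}=\mu^c_{t_n}/\sigma^c_{t_n}$, assumed positive, and $h$ is small enough that $r^c_{t_n}\sqrt h<1$. Agent: a strategy is $\pi_{t_n}=(\alpha_{t_n},\beta_{t_n})$, $\mathcal F_{t_n}$-measurable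 ($\alpha$ = wealth in the primary asset, $\beta$ = number of shares of derivative). Self-financing wealth satisfies $$\Delta X^\pi_{t_n}=\alpha_{t_n}(\mu^c_{t_n}h+\sigma^c_{t_n}\sqrt h\,\Delta b^1_{t_n})+\beta_{t_n}(\Delta D_{t_n}+\varphi(t_n,C_{t_n},S_{t_n})h).$$ At $t_N=T$ the agent receives an $\mathcal F_T$-measurable random income $I_{t_N}$; final wealth is $W^\pi_{t_N}=X^\pi_{t_N}+I_{t_N}$. The risk aversion $\gamma_{t_n}>0$ is an adapted process. $\Pi_{t_n}$ is the set of strategies $(\pi_{t_n},\dots,\pi_{t_{N-1}})$ with $\pi_{t_k}$ $\mathcal F_{t_k}$-measurable and $\mathbb E|X^\pi_{t_k}|<\infty$, $k=n,\dots,N-1$. All expectations written are assumed finite. Optimal time inconsistent strategy: $\hat\pi=(\hat\alpha,\hat\beta)\in\Pi_{t_0}$ attaining $\sup_{\pi\in\Pi_{t_0}}\mathbb E[-\exp(-\gamma_{t_0}W^\pi_{t_N})|\mathcal F_{t_0}]$. Optimal time consistent (subgame perfect) strategy: $\pi^*=(\alpha^*,\beta^* )$ defined backwards. $\pi^*_{t_{N-1}}$ attains $\sup_{\pi\in\Pi_{t_{N-1}}}\mathbb E[-\exp(-\gamma_{t_{N-1}}W^\pi_{t_N})|\mathcal F_{t_{N-1}}]$; given $\pi^*_{t_{N-n+1}},\dots,\pi^*_{t_{N-1}}$, $\pi^*_{t_{N-n}}$ maximizes $\mathbb E[-\exp(-\gamma_{t_{N-n}}W^\pi_{t_N})|\mathcal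 F_{t_{N-n}}]$ over strategies of the form $\pi=(\pi_{t_{N-n}},\pi^*_{t_{N-n+1}},\dots,\pi^*_{t_{N-1}})\in\Pi_{t_{N-n}}$ with $\pi_{t_{N-n}}$ an arbitrary $\mathcal F_{t_{N-n}}$-measurable control. Equilibrium: given $D_{t_N}$ and the dividend stream, $D_{t_n}$ is a time consistent equilibrium price if and only if $\beta^*_{t_n}=1$ for every $n=0,\dots,N-1$, and a time inconsistent equilibrium price if and only if $\hat\beta_{t_n}=1$ for every $n=0,\dots,N-1$. Notation: $A_{t_k}=\{\Delta b^1_{t_k}=1\}$, $A^c_{t_k}=\{\Delta b^1_{t_k}=-1\}$; $\mathbb E_{t_k}[\cdot]=\mathbb E[\cdot|\mathcal F_{t_k}]$ (similarly under other measures); $\mathbb E_{t_k}[Z|A]$ denotes the conditional expectation given $\mathcal F_{t_k}$ and the occurrence of the event $A$, i.e. $\mathbb E[Z1_A|\mathcal F_{t_k}]/\mathbb P(A|\mathcal F_{t_k})$. Recursive definitions (backwards in time, for $k=N-1,\dots,0$; empty sums are $0$): $$e^{-\gamma_{t_k}Y^*_{t_{k+1}}}=\mathbb E_{t_{k+1}}\Big[e^{-\gamma_{t_k}[\sum_{j=k+1}^{N-1}\Delta X^*_{t_j}+I_{t_N}]}\Big],\qquad e^{-\gamma_{t_0}\hat Y_{t_{k+1}}}=\mathbb E_{t_{k+1}}\Big[e^{-\gamma_{t_0}[\sum_{j=k+1}^{N-1}\Delta\hat X_{t_j}+I_{t_N}]}\Big],$$ where $$\Delta X^*_{t_j}=\alpha^*_{t_j}(\mu^c_{t_j}h+\sqrt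 h\sigma^c_{t_j}\Delta b^1_{t_j})+\Delta D_{t_j}+\varphi(t_j,C_{t_j},S_{t_j})h,$$ $$\Delta\hat X_{t_j}=\hat\alpha_{t_j}(\mu^c_{t_j}h+\sqrt h\sigma^c_{t_j}\Delta b^1_{t_j})+\Delta D_{t_j}+\varphi(t_j,C_{t_j},S_{t_j})h,$$ with $\alpha^*_{t_j}$, $\hat\alpha_{t_j}$ given by the formulas displayed in the claim. The one-period pricing kernels are $$\Lambda^*_{t_{k+1}}=\lambda_{t_k}\frac{e^{-\gamma_{t_k}[D_{t_{k+1}}+Y^*_{t_{k+1}}]}}{\mathbb E_{t_k}[e^{-\gamma_{t_k}[D_{t_{k+1}}+Y^*_{t_{k+1}}]}|A_{t_k}]}\ \text{on }A_{t_k},\qquad \Lambda^*_{t_{k+1}}=\lambda_{t_k}\frac{e^{-\gamma_{t_k}[D_{t_{k+1}}+Y^*_{t_{k+1}}]}}{\mathbb E_{t_k}[e^{-\gamma_{t_k}[D_{t_{k+1}}+Y^*_{t_{k+1}}]}|A^c_{t_k}]}\ \text{on }A^c_{t_k},$$ $$\hat\Lambda_{t_{k+1}}=\lambda_{t_k}\frac{e^{-\gamma_{t_0}[D_{t_{k+1}}+\hat Y_{t_{k+1}}]}}{\mathbb E_{t_k}[e^{-\gamma_{t_0}[D_{t_{k+1}}+\hat Y_{t_{k+1}}]}|A_{t_k}]}\ \text{on }A_{t_k},\qquad \hat\Lambda_{t_{k+1}}=\lambda_{t_k}\frac{e^{-\gamma_{t_0}[D_{t_{k+1}}+\hat Y_{t_{k+1}}]}}{\mathbb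 E_{t_k}[e^{-\gamma_{t_0}[D_{t_{k+1}}+\hat Y_{t_{k+1}}]}|A^c_{t_k}]}\ \text{on }A^c_{t_k},$$ with $\lambda_{t_k}=1-r^c_{t_k}\sqrt h$ on $A_{t_k}$ and $\lambda_{t_k}=1+r^c_{t_k}\sqrt h$ on $A^c_{t_k}$. *)

(* Defs.v *)
From HB Require Import structures.
From mathcomp Require Import all_boot all_order all_algebra.
From mathcomp Require Import all_classical all_reals all_analysis.
From mathcomp Require Import measurable_realfun.
Set Implicit Arguments.
Unset Strict Implicit.
Unset Printing Implicit Defensive.
Import Order.TTheory GRing.Theory Num.Theory.
Import numFieldNormedType.Exports.
Local Open Scope classical_set_scope.
Local Open Scope ring_scope.

Section conditional_expectation.
Context {dsp : measure_display} {T : measurableType dsp} {R : realType}.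
Implicit Types (P Q : probability T R) (G H : set (set T)).

(* Measurability with respect to a sub-sigma-algebra G of the one of T; when
   G is a sigma-algebra, the measurable sets of g_sigma_algebraType G are
   exactly the elements of G. *)
Definition measurable_wrt {d' : measure_display} {U : measurableType d'}
    (G : set (set T)) (X : T -> U) : Prop :=
  measurable_fun (setT : set (g_sigma_algebraType G)) X.

Definition sub_sigma_algebra_of (G : set (set T)) : Prop :=
  sigma_algebra setT G /\ G `<=` measurable.

Definition indep_sigma P G H : Prop :=
  forall A B, G A -> H B -> P (A `&` B) = (P A * P B)%E.

(* Y is a version of E[X | G], for X with values in [0, +oo]. *)
Definition is_cexp_ge0 P G (X Y : T -> \bar R) : Prop :=
  [/\ measurable_wrt G Y,
      forall w, (0 <= Y w)%E &
      forall A, G A ->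
        (\int[P]_(w in A) Y w = \int[P]_(w in A) X w)%E].

(* A chosen version; versions exist for every nonnegative measurable X. *)
Definition cexp_ge0 P G (X : T -> \bar R) : T -> \bar R :=
  xget (cst 0%E : T -> \bar R) [set Y | is_cexp_ge0 P G X Y].

(* Generalized conditional expectation E[X^+ | G] - E[X^- | G]. It is
   meaningful without the unconditional integrability of X, and a real value
   at w means that both E[X^+ | G] and E[X^- | G] are finite at w. *)
Definition cexp P G (X : T -> \bar R) : T -> \bar R :=
  (cexp_ge0 P G X^\+ \- cexp_ge0 P G X^\-)%E.

Definition cexpr P G (X : T -> R) : T -> R :=
  fun w => fine (cexp P G (EFin \o X) w).

(* E[X | G, E] = E[X 1_E | G] / P(E | G) *)
Definition cexpr_on P G (X : T -> R) (E : set T) : T -> R :=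
  fun w => cexpr P G (fun v => X v * \1_E v) w / cexpr P G (\1_E) w.

(* dQ/dP = L *)
Definition has_density Q P (L : T -> R) : Prop :=
  forall A, measurable A -> Q A = (\int[P]_(w in A) (L w)%:E)%E.

End conditional_expectation.

Section market.
Context {dsp : measure_display} {T : measurableType dsp} {R : realType}.

(* A process is indexed by the date number n; only the dates 0..N matter. *)
Local Notation process := (nat -> T -> R).

Record market := Market {
  horizon : R ;                      (* T *)
  nsteps : nat ;                     (* N *)
  filt : nat -> set (set T) ;        (* F_{t_n} *)
  wdim : nat ;
  walk : 'I_wdim.+2 -> process ;     (* (b^1, ..., b^d) with d = wdim + 2 *)
  muC : process ;
  sigC : process ;
  muS : process ;
  sigS : process ;
  rho : R ;
  c0 : R ;
  s0 : R ;
  assetC : process ;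
  assetS : process ;
  priceD : process ;                 (* D, terminal payoff D_{t_N} included *)
  phi : R -> R -> R -> R ;           (* dividend rate phi(t, C, S) *)
  income : T -> R ;                  (* I_{t_N} *)
  gamma : process
}.

Arguments walk : clear implicits.

Definition incr (Z : process) (n : nat) : T -> R :=
  fun w => Z n.+1 w - Z n w.

Definition step (m : market) : R := horizon m / (nsteps m)%:R.

Definition tgrid (m : market) (n : nat) : R := n%:R * step m.

Definition db1 (m : market) (n : nat) : T -> R :=
  incr (walk m ord0) n.

Definition db2 (m : market) (n : nat) : T -> R :=
  incr (walk m (lift ord0 ord0)) n.

Definition price_of_risk (m : market) : process :=
  fun n w => muC m n w / sigC m n w.

Definition retC (m : market) (n : nat) : T -> R := fun w =>
  muC m n w * step m + sigC m n w * Num.sqrt (step m) * db1 m n w.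

Definition retS (m : market) (n : nat) : T -> R := fun w =>
  muS m n w * step m + sigS m n w * Num.sqrt (step m) *
    (rho m * db1 m n w + Num.sqrt (1 - rho m ^+ 2) * db2 m n w).

(* the dividend phi(t_n, C_{t_n}, S_{t_n}) h *)
Definition dividend (m : market) (n : nat) : T -> R := fun w =>
  phi m (tgrid m n) (assetC m n w) (assetS m n w) * step m.

Definition adapted (m : market) (Z : process) : Prop :=
  forall n, (n <= nsteps m)%N -> measurable_wrt (filt m n) (Z n).

(* the sigma-algebra generated by the vector of increments at t_n *)
Definition sigma_db (m : market) (n : nat) : set (set T) :=
  <<s [set E | exists i : 'I_(wdim m).+2, exists2 U : set R,
        measurable U & E = incr (walk m i) n @^-1` U] >>.

Record filtration_spec (P : probability T R) (m : market) : Prop := {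
  filt_sub : forall n, (n <= nsteps m)%N -> sub_sigma_algebra_of (filt m n) ;
  filt_mono : forall k n, (k <= n)%N -> (n <= nsteps m)%N ->
    filt m k `<=` filt m n ;
  filt_complete : P.-negligible `<=` filt m 0%N
}.

Record walk_spec (P : probability T R) (m : market) : Prop := {
  walk_adapted : forall i, adapted m (walk m i) ;
  walk_up : forall i n, (n < nsteps m)%N ->
    P [set w | incr (walk m i) n w = 1] = (2^-1)%:E ;
  walk_down : forall i n, (n < nsteps m)%N ->
    P [set w | incr (walk m i) n w = -1] = (2^-1)%:E ;
  walk_indep : forall n, (n < nsteps m)%N ->
    indep_sigma P (sigma_db m n) (filt m n)
}.

(* Positivity of the market price of risk forces sigC to be nonzero, division
   by 0 being 0. *)
Record assets_spec (P : probability T R) (m : market) : Prop := {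
  muC_adapted : adapted m (muC m) ;
  sigC_adapted : adapted m (sigC m) ;
  muS_adapted : adapted m (muS m) ;
  sigS_adapted : adapted m (sigS m) ;
  rho_lt1 : `|rho m| < 1 ;
  c0_gt0 : 0 < c0 m ;
  s0_gt0 : 0 < s0 m ;
  assetC_init : forall w, assetC m 0%N w = c0 m ;
  assetS_init : forall w, assetS m 0%N w = s0 m ;
  assetC_dyn : forall n w, (n < nsteps m)%N ->
    incr (assetC m) n w = assetC m n w * retC m n w ;
  assetS_dyn : forall n w, (n < nsteps m)%N ->
    incr (assetS m) n w = assetS m n w * retS m n w ;
  assetC_gt0 : forall n, (n <= nsteps m)%N ->
    {ae P, forall w, 0 < assetC m n w} ;
  priceD_adapted : adapted m (priceD m) ;
  phi_measurable : forall t,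
    measurable_fun setT (fun z : R * R => phi m t z.1 z.2) ;
  price_of_risk_gt0 : forall n, (n < nsteps m)%N ->
    {ae P, forall w, 0 < price_of_risk m n w} ;
  price_of_risk_small : forall n, (n < nsteps m)%N ->
    {ae P, forall w, price_of_risk m n w * Num.sqrt (step m) < 1}
}.

Record agent_spec (P : probability T R) (m : market) : Prop := {
  income_measurable : measurable_wrt (filt m (nsteps m)) (income m) ;
  gamma_adapted : adapted m (gamma m) ;
  gamma_gt0 : forall n, (n <= nsteps m)%N ->
    {ae P, forall w, 0 < gamma m n w}
}.

Record market_spec (P : probability T R) (m : market) : Prop := {
  horizon_gt0 : 0 < horizon m ;
  nsteps_gt0 : (0 < nsteps m)%N ;
  market_filtration : filtration_spec P m ;
  market_walk : walk_spec P m ;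
  market_assets : assets_spec P m ;
  market_agent : agent_spec P m
}.

Record strategy := Strategy { alpha : process ; beta : process }.

Definition gain (m : market) (pi : strategy) (n : nat) : T -> R := fun w =>
  alpha pi n w * retC m n w +
  beta pi n w * (incr (priceD m) n w + dividend m n w).

(* X^pi_{t_k} for k >= n, when the wealth held at t_n is x n. *)
Definition wealth (m : market) (x : process) (n : nat) (pi : strategy)
    (k : nat) : T -> R := fun w =>
  x n w + \sum_(n <= j < k) gain m pi j w.

Definition final_wealth (m : market) (x : process) (n : nat) (pi : strategy) :
    T -> R := fun w =>
  wealth m x n pi (nsteps m) w + income m w.

(* pi restricted to the dates t_n, ..., t_{N-1} is in Pi_{t_n} *)
Definition admissible (P : probability T R) (m : market) (x : process)
    (n : nat) (pi : strategy) : Prop :=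
  forall k, (n <= k < nsteps m)%N ->
    [/\ measurable_wrt (filt m k) (alpha pi k),
        measurable_wrt (filt m k) (beta pi k) &
        P.-integrable setT (EFin \o wealth m x n pi k)].

(* E[- exp(- g W^pi_{t_N}) | F_{t_l}], the wealth at t_n being x n; its values
   are in [-oo, 0]. *)
Definition expected_utility (P : probability T R) (m : market) (x : process)
    (n : nat) (g : T -> R) (pi : strategy) (l : nat) : T -> \bar R :=
  cexp P (filt m l)
    (fun w => (- expR (- g w * final_wealth m x n pi w))%:E).

Definition same_control (pi pi' : strategy) (k : nat) : Prop :=
  alpha pi k = alpha pi' k /\ beta pi k = beta pi' k.

(* the competitors of pi0 at t_n: (pi_{t_n}, pi0_{t_{n+1}}, ...) in Pi_{t_n} *)
Definition tc_competitor (P : probability T R) (m : market) (x : process)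
    (pi0 : strategy) (n : nat) (pi : strategy) : Prop :=
  admissible P m x n pi /\
  forall k, (n < k < nsteps m)%N -> same_control pi pi0 k.

(* The wealth x n held at t_n is taken as given in the problem posed at t_n;
   in particular x need not be generated by a self-financing strategy.
   A conditional supremum is attained by pi0 when pi0 almost surely dominates
   every competitor. *)
Definition tc_optimal (P : probability T R) (m : market) (x : process)
    (pi0 : strategy) : Prop :=
  forall n, (n < nsteps m)%N ->
    admissible P m x n pi0 /\
    forall pi, tc_competitor P m x pi0 n pi ->
      {ae P, forall w, (expected_utility P m x n (gamma m n) pi n w <=
                        expected_utility P m x n (gamma m n) pi0 n w)%E}.

Definition ti_optimal (P : probability T R) (m : market) (x : process)
    (pi0 : strategy) : Prop :=
  admissible P m x 0 pi0 /\
  forall pi, admissible P m x 0 pi ->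
    {ae P, forall w, (expected_utility P m x 0 (gamma m 0%N) pi 0 w <=
                      expected_utility P m x 0 (gamma m 0%N) pi0 0 w)%E}.

Definition market_clears (P : probability T R) (m : market) (pi : strategy) :
    Prop :=
  forall n, (n < nsteps m)%N -> {ae P, forall w, beta pi n w = 1}.

(* priceD m is a time consistent (resp. time inconsistent) equilibrium price,
   pi being the corresponding optimal strategy. *)
Definition tc_equilibrium (P : probability T R) (m : market) (x : process)
    (pi : strategy) : Prop :=
  tc_optimal P m x pi /\ market_clears P m pi.

Definition ti_equilibrium (P : probability T R) (m : market) (x : process)
    (pi : strategy) : Prop :=
  ti_optimal P m x pi /\ market_clears P m pi.

(* Finiteness of the expectations that are maximized. *)
Definition tc_finite (P : probability T R) (m : market) (x : process)
    (pi0 : strategy) : Prop :=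
  forall n, (n < nsteps m)%N ->
    forall pi, tc_competitor P m x pi0 n pi ->
      {ae P, forall w,
        expected_utility P m x n (gamma m n) pi n w \is a fin_num}.

(* In the time inconsistent problem, finiteness is only required for the
   strategies that differ from pi0 at one date t_n, conditionally on F_{t_n}.
   This is implied by the finiteness of E[- exp(- gamma_{t_0} W^pi) | F_{t_0}]
   for every pi in Pi_{t_0}, a condition that can fail for unbounded pi when
   the filtration is not finite. *)
Definition ti_finite (P : probability T R) (m : market) (x : process)
    (pi0 : strategy) : Prop :=
  forall n, (n < nsteps m)%N ->
    forall pi, admissible P m x 0 pi ->
      (forall k, (k < nsteps m)%N -> k <> n -> same_control pi pi0 k) ->
      {ae P, forall w,
        expected_utility P m x 0 (gamma m 0%N) pi n w \is a fin_num}.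

(* From here on g k is the risk aversion applied to the date t_k: it is
   gamma_{t_k} in the time consistent case and gamma_{t_0} for every k in the
   time inconsistent one; all the other formulas are common to both cases. *)

Definition evA (m : market) (k : nat) : set T := [set w | db1 m k w = 1].
Definition evAc (m : market) (k : nat) : set T := [set w | db1 m k w = -1].

(* gain of the strategy that holds one share of derivative *)
Definition gain1 (m : market) (a : process) (j : nat) : T -> R := fun w =>
  a j w * retC m j w + incr (priceD m) j w + dividend m j w.

(* certainty m g a k is Y_{t_{k+1}}, solved for from
   exp(- g k Y_{t_{k+1}}) = E_{t_{k+1}}[exp(- g k [...])]. *)
Definition certainty (P : probability T R) (m : market) (g a : process)
    (k : nat) : T -> R := fun w =>
  - (g k w)^-1 * ln (cexpr P (filt m k.+1) (fun v =>
      expR (- g k v *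
        (\sum_(k.+1 <= j < nsteps m) gain1 m a j v + income m v))) w).

(* exp(- g k [D_{t_{k+1}} + Y_{t_{k+1}}]) *)
Definition weight (P : probability T R) (m : market) (g a : process)
    (k : nat) : T -> R := fun w =>
  expR (- g k w * (priceD m k.+1 w + certainty P m g a k w)).

Definition weightA (P : probability T R) (m : market) (g a : process)
    (k : nat) : T -> R :=
  cexpr_on P (filt m k) (weight P m g a k) (evA m k).

Definition weightAc (P : probability T R) (m : market) (g a : process)
    (k : nat) : T -> R :=
  cexpr_on P (filt m k) (weight P m g a k) (evAc m k).

Definition alpha_formula (P : probability T R) (m : market) (g a : process)
    (k : nat) : T -> R := fun w =>
  let rh := price_of_risk m k w * Num.sqrt (step m) in
  let den := 2 * g k w * sigC m k w * Num.sqrt (step m) in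
  den^-1 * ln ((1 + rh) / (1 - rh)) +
  den^-1 * ln (weightA P m g a k w / weightAc P m g a k w).

(* Backward recursion: alpha_formula at t_k only involves the values of a at
   the later dates, so that alpha_rec i is right at t_{N-i}, ..., t_{N-1}. *)
Fixpoint alpha_rec (P : probability T R) (m : market) (g : process)
    (i : nat) : process :=
  if i is i'.+1 then
    let a := alpha_rec P m g i' in
    fun k => if (k == nsteps m - i)%N then alpha_formula P m g a k else a k
  else fun _ _ => 0.

Definition alpha_sol (P : probability T R) (m : market) (g : process) :
    process :=
  alpha_rec P m g (nsteps m).

(* the one-period kernel Lambda_{t_{k+1}}; evAc m k is almost surely the
   complement of evA m k *)
Definition pricing_kernel1 (P : probability T R) (m : market) (g : process)
    (k : nat) : T -> R := fun w =>
  let a := alpha_sol P m g in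
  let rh := price_of_risk m k w * Num.sqrt (step m) in
  if db1 m k w == 1
  then (1 - rh) * (weight P m g a k w / weightA P m g a k w)
  else (1 + rh) * (weight P m g a k w / weightAc P m g a k w).

Definition pricing_kernel (P : probability T R) (m : market) (g : process) :
    T -> R :=
  fun w => \prod_(k < nsteps m) pricing_kernel1 P m g k w.

Lemma eq_alpha_formula (P : probability T R) (m : market) (g a a' : process)
    (k : nat) :
  (forall j, (k < j < nsteps m)%N -> a j = a' j) ->
  alpha_formula P m g a k = alpha_formula P m g a' k.
Proof.
move=> aa'.
have sumE v : \sum_(k.+1 <= j < nsteps m) gain1 m a j v =
              \sum_(k.+1 <= j < nsteps m) gain1 m a' j v.
  by apply: eq_big_nat => j kj; rewrite /gain1 aa'.
have certE : certainty P m g a k = certainty P m g a' k.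
  have expE : (fun v => expR (- g k v *
        (\sum_(k.+1 <= j < nsteps m) gain1 m a j v + income m v))) =
      (fun v => expR (- g k v *
        (\sum_(k.+1 <= j < nsteps m) gain1 m a' j v + income m v))).
    by apply/funext => v; rewrite sumE.
  by rewrite /certainty expE.
by rewrite /alpha_formula /weightA /weightAc /weight certE.
Qed.

Lemma alpha_solE (P : probability T R) (m : market) (g : process) (k : nat) :
  (k < nsteps m)%N ->
  alpha_sol P m g k = alpha_formula P m g (alpha_sol P m g) k.
Proof.
pose N := nsteps m; rewrite /alpha_sol -/N => kN.
have stable i j : (N - i <= k)%N -> (i + j <= N)%N ->
    forall l, (k <= l)%N -> alpha_rec P m g (i + j) l = alpha_rec P m g i l.
  move=> ik; elim: j => [|j IH] ijN l kl; first by rewrite addn0.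
  rewrite addnS /= -/N ifF ?IH ?(leq_trans _ ijN) ?addnS//.
  apply/negbTE; rewrite neq_ltn; apply/orP; right.
  rewrite (leq_trans _ (leq_trans ik kl))// ltn_sub2l ?ltnS ?leq_addr//.
  by rewrite (leq_trans _ ijN)// addnS ltnS leq_addr.
have NkN : ((N - k) + k)%N = N by rewrite subnK // ltnW.
have NkE : (N - k)%N = (N - k.+1).+1 by rewrite subnSK.
have topE l : (k <= l)%N -> alpha_rec P m g N l = alpha_rec P m g (N - k) l.
  by move=> kl; rewrite -{1}NkN stable // ?subKn ?NkN // ltnW.
rewrite topE // NkE /= -/N -NkE subKn ?(ltnW kN) // eqxx.
apply: eq_alpha_formula => j /andP[kj _].
rewrite topE ?(ltnW kj) // NkE /= -/N -NkE subKn ?(ltnW kN) // ifF //.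
by apply/negbTE; rewrite gtn_eqF.
Qed.

End market.
Arguments market {dsp} T R.

(* Main.v *)
Require Import Defs.
From HB Require Import structures.
From mathcomp Require Import all_boot all_order all_algebra.
From mathcomp Require Import all_classical all_reals all_analysis.
From mathcomp Require Import measurable_realfun.
From mathcomp Require Import ring lra.
Import Order.TTheory GRing.Theory Num.Theory.
Import numFieldNormedType.Exports.
Local Open Scope classical_set_scope.
Local Open Scope ring_scope.
Set Implicit Arguments.
Unset Strict Implicit.
Unset Printing Implicit Defensive.

(** Fix a date t_k and change the optimal strategy at that date only, on an
    event of F_k, by a small position in one of the two assets. The conditional
    mean of the loss V = exp(- gamma W) is minimal at the optimal strategy, so
    its derivative in the size of the position vanishes (expR_first_order,
    first_order_condition): under the weight V, both the return of the primary
    asset and the payoff D_{k+1} - D_k + phi h of one share of the derivative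
    have conditional mean zero given F_k (foc_pert).

    One share is held in equilibrium, so V is a product of a factor known at
    t_k, of exp(- theta) on A_k and exp(theta) on its complement, where
    theta = gamma alpha sigma sqrt h, and of a factor whose conditional
    expectation given F_{k+1} is exp(- gamma (D_{k+1} + Y_{k+1})) (V_split,
    eqW). The first condition then reads
      exp(2 theta) = (1 + r sqrt h) / (1 - r sqrt h) * E_k[...|A] / E_k[...|A^c],
    which is the formula for alpha (balance_A, alpha_optimal); as Y_{k+1} only
    involves the later positions, these formulas are proved backwards in time.
    The same equation says that, given F_k, the marginal loss V is proportional
    to the kernel Lambda_{k+1} (kernel_V). The second condition therefore says
    that the payoff of the derivative has mean zero under the kernel
    (kernel_optimal). Since the kernels are positive with conditional mean 1,
    their product is the density of a probability Q, and the payoff has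
    conditional mean zero under Q: this is the pricing formula
    (kernel_density_exists, price_one_step).

    The time consistent and inconsistent problems only differ by the date s at
    which they are posed, s = k or s = 0, and both give the hypotheses of
    one_date_optimal. For s = 0 optimality is only known in conditional mean
    given F_0, but a perturbation supported by an event of F_k leaves the loss
    unchanged outside this event, which makes optimality local.

    Neither V nor the prices are assumed to be integrable: only conditional
    expectations given F_k are known to be finite. Conditional expectations of
    nonnegative variables are therefore compared through their integrals on the
    events of the sigma-algebra (eqint), and finiteness is used locally, along
    an increasing sequence of events (cfin, eqint_exhaustion). Signed payoffs
    are treated through their positive and negative parts. *)

(** * Events and variables of a sub-sigma-algebra *)

Section sub_sigma_algebra.
Context {dsp : measure_display} {T : measurableType dsp} {R : realType}.
Variable G : set (set T).
Hypothesis sG : sub_sigma_algebra_of G.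

Lemma subG_measurableE : G.-sigma.-measurable = G.
Proof. by apply: measurable_g_measurableTypeE; case: sG. Qed.

Lemma subG_measurable A : G A -> measurable A.
Proof. by case: sG => _; apply. Qed.

Lemma subGT : G setT.
Proof. by rewrite -subG_measurableE; exact: measurableT. Qed.

Lemma subGI A B : G A -> G B -> G (A `&` B).
Proof. by rewrite -subG_measurableE; exact: measurableI. Qed.

Lemma subG_preimage d' (U : measurableType d') (f : T -> U) (B : set U) :
  measurable_wrt G f -> measurable B -> G (f @^-1` B).
Proof.
move=> mf mB; rewrite -subG_measurableE -[X in measurable X]setTI.
exact: mf.
Qed.

Lemma measurable_wrtT d' (U : measurableType d') (f : T -> U) :
  measurable_wrt G f -> measurable_fun setT f.
Proof.
move=> mf _ B mB; rewrite setTI; apply: subG_measurable.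
exact: subG_preimage.
Qed.

Lemma measurable_wrt_indic A : G A -> measurable_wrt G (\1_A : T -> R).
Proof.
by move=> GA; apply: measurable_indic; rewrite subG_measurableE.
Qed.

Lemma subG_ler (f : T -> R) (c : R) :
  measurable_wrt G f -> G [set w | f w <= c].
Proof.
move=> mf; have -> : [set w | f w <= c] = f @^-1` `]-oo, c].
  by apply/seteqP; split => w /=; rewrite in_itv.
exact: subG_preimage.
Qed.

Lemma subG_ltr (f g : T -> R) :
  measurable_wrt G f -> measurable_wrt G g -> G [set w | f w < g w].
Proof.
move=> mf mg; have m1 : measurable [set true] by [].
by have := measurable_fun_ltr mf mg measurableT m1; rewrite setTI subG_measurableE.
Qed.

End sub_sigma_algebra.

Lemma measurable_sub_sigma d (T : measurableType d) :
  sub_sigma_algebra_of (@measurable _ T).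
Proof. by split => //; exact: sigma_algebra_measurable. Qed.

(** * Conditional expectation of nonnegative variables *)

Section eqint_mul.
Context {dsp : measure_display} {T : measurableType dsp} {R : realType}.
Local Open Scope ereal_scope.
Variables (mu nu : {measure set T -> \bar R}) (G : set (set T)) (X Y f : T -> R).
Hypothesis sG : sub_sigma_algebra_of G.
Hypotheses (mX : measurable_fun setT X) (mY : measurable_fun setT Y).
Hypotheses (X0 : forall w, (0 <= X w)%R) (Y0 : forall w, (0 <= Y w)%R).
Hypotheses (mf : measurable_wrt G f) (f0 : forall w, (0 <= f w)%R).
Hypothesis XY : forall A, G A ->
  \int[mu]_(w in A) (X w)%:E = \int[nu]_(w in A) (Y w)%:E.

Import HBNNSimple.

(* a simple function is constant on the pieces g = r, which belong to G *)
Let sint (m : {measure set T -> \bar R}) (Z : T -> R)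
    (g : {nnsfun (g_sigma_algebraType G) >-> R}) (A : set T) :
  measurable_fun setT Z -> (forall w, 0 <= Z w)%R -> G A ->
  \int[m]_(w in A) (g w * Z w)%:E = \sum_(r \in range g)
    r%:E * \int[m]_(w in A `&` g @^-1` [set r]) (Z w)%:E.
Proof.
move=> mZ Z0 GA; have mA := subG_measurable sG GA.
have Gg r : G (g @^-1` [set r]).
  by apply: (subG_preimage sG) => //; exact: measurable_funP.
have mg r := subG_measurable sG (Gg r).
transitivity (\int[m]_(w in A)
    (\sum_(r \in range g) (r * \1_(g @^-1` [set r]) w * Z w)%:E)).
  apply: eq_integral => w _; rewrite [in LHS](fimfunE g w) fsumEFin//.
  congr EFin; rewrite mulrC.
  by rewrite !fsbig_finite//= big_distrr/=; apply: eq_bigr => i _; rewrite mulrC.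
rewrite ge0_integral_fsum//; last 2 first.
- move=> r; apply/measurable_EFinP; apply: measurable_funTS.
  by apply: measurable_funM => //; apply: measurable_funM.
- move=> r w _; rewrite lee_fin mulr_ge0//; have [r0|r0] := leP 0%R r.
    by rewrite mulr_ge0.
  by rewrite preimage_nnfun0// indic0 mulr0.
apply: eq_fsbigr => r /set_mem[v _ <-].
under eq_integral do rewrite -mulrA EFinM.
rewrite ge0_integralZl_EFin//; last 2 first.
- by move=> w _; rewrite lee_fin mulr_ge0.
- by apply/measurable_EFinP; apply: measurable_funTS; exact: measurable_funM.
rewrite integral_mkcondr; congr (_ * _); apply: eq_integral => w _.
rewrite patchE indicE; case: ifPn => _; first by rewrite mul1r.
by rewrite mul0r.
Qed.

(** Simple functions and monotone convergence. Two measures and two integrands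
    occur, so that the same statement is the rule of taking out a G-measurable
    factor f when mu = nu, and the change of variables dmu = Y dnu when X = 1
    and G contains all the events. *)
Lemma eqint_mul_gen A : G A ->
  \int[mu]_(w in A) (f w * X w)%:E = \int[nu]_(w in A) (f w * Y w)%:E.
Proof.
move=> GA; have mA := subG_measurable sG GA.
have mfE : measurable_fun (setT : set (g_sigma_algebraType G)) (EFin \o f).
  exact/measurable_EFinP.
pose g := nnsfun_approx measurableT mfE.
pose h n : T -> R := g n.
have mh n : measurable_fun setT (h n).
  by apply: (measurable_wrtT sG); exact: measurable_funP.
have h0 n w : (0 <= h n w)%R by exact: fun_ge0.
have hf w : (h n w)%:E @[n --> \oo] --> (f w)%:E.
  by apply: (@cvg_nnsfun_approx _ _ _ setT measurableT _ mfE) => // v _; rewrite lee_fin.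
have hnd w : {homo (h^~ w) : n p / (n <= p)%N >-> (n <= p)%R}.
  by move=> n p /(nd_nnsfun_approx measurableT mfE)/lefP/(_ w).
have cvgg (m : {measure set T -> \bar R}) (Z : T -> R) :
    measurable_fun setT Z -> (forall w, 0 <= Z w)%R ->
    \int[m]_(w in A) (f w * Z w)%:E =
    limn (fun n => \int[m]_(w in A) (h n w * Z w)%:E).
  move=> mZ Z0; transitivity (\int[m]_(w in A)
      (limn (fun n => (h n w * Z w)%:E))).

  apply: eq_integral => w _; apply/esym/cvg_lim => //.
    rewrite EFinM; under eq_fun do rewrite EFinM.
    exact: cvgeZr.
  rewrite (@monotone_convergence _ _ _ m A mA (fun n w => (h n w * Z w)%:E))//.
  - move=> n; apply/measurable_EFinP; apply: measurable_funTS.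
    exact: measurable_funM.
  - by move=> n w _; rewrite lee_fin mulr_ge0.
  - by move=> w _ n p np; rewrite lee_fin ler_wpM2r// hnd.
rewrite !cvgg//; congr (limn _); apply/funext => n.
rewrite !sint//; apply: eq_fsbigr => r _; congr (_ * _); apply: XY.
apply: (subGI sG) => //; apply: (subG_preimage sG) => //.
exact: measurable_funP.
Qed.

End eqint_mul.

Section density_image.
Context {dsp dsp' : measure_display} {T : measurableType dsp}
  {S : measurableType dsp'} {R : realType}.
Local Open Scope ereal_scope.
Variables (mu : {measure set T -> \bar R}) (phi : T -> S) (L : T -> R).
Hypotheses (mphi : measurable_fun setT phi) (mL : measurable_fun setT L).
Hypothesis L0 : forall w, (0 <= L w)%R.

(** The image under phi of the measure with density L. Two cases are used:
    phi is the identity of T, or the identity seen as a map to T equipped with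
    a smaller sigma-algebra, where Radon-Nikodym derivatives are conditional
    expectations. The hypotheses are arguments because the measure structure
    depends on them. *)
Definition density_image (_ : measurable_fun setT phi)
  (_ : measurable_fun setT L) (_ : forall w, (0 <= L w)%R) : set S -> \bar R :=
  fun A => \int[mu]_(w in phi @^-1` A) (L w)%:E.

Let density0 : density_image mphi mL L0 set0 = 0.
Proof. by rewrite /density_image preimage_set0 integral_set0. Qed.

Let density_ge0 A : 0 <= density_image mphi mL L0 A.
Proof. by apply: integral_ge0 => w _; rewrite lee_fin. Qed.

Let density_sigma_additive : semi_sigma_additive (density_image mphi mL L0).
Proof.
move=> F mF tF mUF; rewrite /density_image preimage_bigcup.
have mpre A : measurable A -> measurable (phi @^-1` A).
  by move=> mA; rewrite -[X in measurable X]setTI; exact: mphi.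
apply: (@semi_sigma_additive_nng_induced _ _ _ mu (EFin \o L)).
- exact/measurable_EFinP.
- by move=> w; rewrite lee_fin.
- by move=> i; exact: mpre.
- apply/trivIsetP => /= i j _ _ ij; rewrite -preimage_setI.
  by move/trivIsetP : tF => /(_ _ _ _ _ ij) ->//; rewrite preimage_set0.
- by rewrite -preimage_bigcup; exact: mpre.
Qed.

HB.instance Definition _ := isMeasure.Build dsp' S R (density_image mphi mL L0)
  density0 density_ge0 density_sigma_additive.

Lemma density_image_finite : \int[mu]_w (L w)%:E < +oo ->
  fin_num_fun (density_image mphi mL L0).
Proof.
move=> intL A mA; rewrite ge0_fin_numE ?density_ge0//.
apply: le_lt_trans intL; apply: ge0_subset_integral => //.
- by rewrite -[X in measurable X]setTI; exact: mphi.
- exact/measurable_EFinP.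
- by move=> w _; rewrite lee_fin.
Qed.

End density_image.

Section cexp_existence.
Context {dsp : measure_display} {T : measurableType dsp} {R : realType}.
Local Open Scope ereal_scope.
Variables (P : probability T R) (G : set (set T)).
Hypothesis sG : sub_sigma_algebra_of G.
Implicit Types X : T -> R.

Let toG : T -> g_sigma_algebraType G := idfun.

Let mtoG : measurable_fun setT toG.
Proof.
move=> _ B mB; rewrite setTI; apply: (subG_measurable sG).
by rewrite -(subG_measurableE sG).
Qed.

Let cexp_integrable X : measurable_fun setT X -> (forall w, 0 <= X w)%R ->
  \int[P]_w (X w)%:E < +oo ->
  exists Y, is_cexp_ge0 P G (EFin \o X) Y.
Proof.
move=> mX X0 intX.
have m1 : measurable_fun setT (cst 1%R : T -> R) by [].
have l01 (w : T) : (0 <= (cst 1 : T -> R) w)%R by rewrite /= ler01.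
pose nu := density_image P mtoG mX X0.
pose PG := density_image P mtoG m1 l01.
have int1 A : measurable A ->
    \int[P]_(w in A) ((cst 1%R : T -> R) w)%:E = P A.
  by move=> mA; rewrite -[RHS]mul1e -integral_cst.
have PGE A : G A -> PG A = P A by move=> /(subG_measurable sG)/int1.
have finnu : fin_num_fun nu by exact: density_image_finite.
have finPG : fin_num_fun PG.
  apply: density_image_finite; rewrite int1//.
  by rewrite (le_lt_trans (probability_le1 _ _))// ltry.
pose nuF := Measure_isFinite.Build _ _ _ nu finnu.
pose nu' : {finite_measure set (g_sigma_algebraType G) -> \bar R} :=
  HB.pack nu nuF.
pose PGF := Measure_isFinite.Build _ _ _ PG finPG.
pose PG' : {finite_measure set (g_sigma_algebraType G) -> \bar R} :=
  HB.pack PG PGF.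
have nuP : nu' `<< PG'.
  apply/null_content_dominatesP => A mA PA0.
  have GA : G A by rewrite -(subG_measurableE sG).
  rewrite /nu'/= /nu /density_image null_set_integral//.
  - exact: (subG_measurable sG).
  - by apply: measurable_funTS; exact/measurable_EFinP.
  - by rewrite -[LHS](PGE _ GA).
have [Y [Y0 Yfin iY YE]] := radon_nikodym_sigma_finite nuP.
have mY : measurable_wrt G Y by move/measurable_int : iY.
exists Y; split => // A GA.
have mA : G.-sigma.-measurable A by rewrite subG_measurableE.
transitivity (\int[PG]_(w in A) Y w); last exact/esym/(YE A mA).
rewrite -[LHS](@ge0_integral_pushforward _ _ _ _ _ _ mtoG)//.
- apply: eq_measure_integral => B mB _; apply/esym/PGE.
  by rewrite -(subG_measurableE sG).
- exact: (@measurable_funTS _ _ (g_sigma_algebraType G)).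
Qed.

(* X may have infinite mean, but each slice n <= X < n + 1 is bounded: the
   versions obtained for the slices are added up *)
Let cexp_exists X : measurable_fun setT X -> (forall w, 0 <= X w)%R ->
  exists Y, is_cexp_ge0 P G (EFin \o X) Y.
Proof.
move=> mX X0.
pose E n : set T := [set w | Num.truncn (X w) = n].
have EE n : E n = X @^-1` `[n%:R, n.+1%:R[.
  apply/seteqP; split => w; rewrite /E/= in_itv/=.
    by move=> <-; exact: truncn_itv.
  exact: truncn_def.
have mE n : measurable (E n).
  by rewrite EE -[X in measurable X]setTI; apply: mX.
pose Xn n w := (X w * \1_(E n) w)%R.
have mXn n : measurable_fun setT (Xn n) by exact: measurable_funM.
have Xn0 n w : (0 <= Xn n w)%R by rewrite mulr_ge0.
have intXn n A : \int[P]_(w in A) (Xn n w)%:E =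
    \int[P]_(w in A `&` E n) (X w)%:E.
  rewrite integral_mkcondr; apply: eq_integral => w _.
  by rewrite patchE /Xn indicE; case: ifPn => _; rewrite ?mulr1 ?mulr0.
have /choice[Y hY] : forall n, exists Y, is_cexp_ge0 P G (EFin \o Xn n) Y.
  move=> n; apply: cexp_integrable => //.
  apply: (@le_lt_trans _ _ (\int[P]_w (cst (n.+1%:R : R)%:E w))).
    apply: ge0_le_integral => //.
    - by move=> w _; rewrite lee_fin.
    - exact/measurable_EFinP.
    - move=> w _; rewrite /cst lee_fin /Xn indicE.
      case: (boolP (w \in E n)) => [|_]; last by rewrite mulr0.
      by rewrite inE EE/= in_itv/= mulr1 => /andP[_ /ltW].
  rewrite integral_cst// (le_lt_trans _ (ltry n.+1%:R))//.
  by rewrite -[leRHS]mule1 lee_wpmul2l// probability_le1.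
have Y0 n w : 0 <= Y n w by have [_ + _] := hY n.
have mY n : measurable_wrt G (Y n) by have [] := hY n.
exists (fun w => \sum_(n <oo) Y n w); split.
- apply: (@ge0_emeasurable_sum _ (g_sigma_algebraType G) R setT Y xpredT).
    by move=> n w _ _.
  by move=> n _; exact: mY.
- by move=> w; apply: nneseries_ge0.
- move=> A GA; have mA := subG_measurable sG GA.
  rewrite integral_nneseries//; last first.
    by move=> n; apply: measurable_funTS; exact: (measurable_wrtT sG).
  have AE : A = \bigcup_n (A `&` E n).
    rewrite -setI_bigcupr; apply/seteqP; split => [w Aw|w []//].
    by split => //; exists (Num.truncn (X w)).
  rewrite [in RHS]AE ge0_integral_bigcup//.
  + by apply: eq_eseriesr => n _; rewrite -intXn//; have [_ _ ->] := hY n.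
  + by move=> n; exact: measurableI.
  + by apply: measurable_funTS; exact/measurable_EFinP.
  + by move=> w _; rewrite lee_fin.
  + apply/trivIsetP => i j _ _ ij; rewrite setIACA setIid -subset0.
    by move=> w [_ [Ei Ej]]; move/eqP : ij; apply; rewrite -Ei -Ej.
Qed.

Lemma cexp_ge0P X : measurable_fun setT X -> (forall w, 0 <= X w)%R ->
  is_cexp_ge0 P G (EFin \o X) (cexp_ge0 P G (EFin \o X)).
Proof.
move=> mX X0; have [Y hY] := cexp_exists mX X0.
by rewrite /cexp_ge0; case: xgetP => [//|/(_ _ hY)].
Qed.

End cexp_existence.

Section nnrv.
Context {dsp : measure_display} {T : measurableType dsp} {R : realType}.
Implicit Types (G H : set (set T)) (X Y : T -> R).

Definition nnrv G X : Prop := measurable_wrt G X /\ forall w, 0 <= X w.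

Lemma nnrv_measurable X : measurable_fun setT X -> (forall w, 0 <= X w) ->
  nnrv measurable X.
Proof.
move=> mX X0; split => // _ B mB.
by rewrite subG_measurableE; [apply: mX|exact: measurable_sub_sigma].
Qed.

Lemma measurable_wrt_sub G H d' (U : measurableType d') (f : T -> U) :
  sub_sigma_algebra_of G -> sub_sigma_algebra_of H -> G `<=` H ->
  measurable_wrt G f -> measurable_wrt H f.
Proof.
move=> sG sH GH mf _ B mB; rewrite setTI subG_measurableE//.
by apply: GH; exact: (subG_preimage sG mf mB).
Qed.

Lemma nnrv_sub G H X : sub_sigma_algebra_of G -> sub_sigma_algebra_of H ->
  G `<=` H -> nnrv G X -> nnrv H X.
Proof. by move=> sG sH GH [mX X0]; split => //; exact: measurable_wrt_sub mX. Qed.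

Lemma nnrvW G X : sub_sigma_algebra_of G -> nnrv G X -> nnrv measurable X.
Proof.
by move=> sG [mX X0]; apply: nnrv_measurable => //; exact: (measurable_wrtT sG).
Qed.

Lemma nnrvT G X : sub_sigma_algebra_of G -> nnrv G X -> measurable_fun setT X.
Proof. by move=> sG [mX _]; exact: (measurable_wrtT sG). Qed.

Lemma nnrvT_ereal G X : sub_sigma_algebra_of G -> nnrv G X ->
  measurable_fun setT (EFin \o X).
Proof. by move=> sG /(nnrvT sG) mX; exact/measurable_EFinP. Qed.

Lemma nnrvM G X Y : nnrv G X -> nnrv G Y -> nnrv G (fun w => X w * Y w).
Proof.
move=> [mX X0] [mY Y0]; split; last by move=> w; rewrite mulr_ge0.
exact: measurable_funM.
Qed.

Lemma nnrvD G X Y : nnrv G X -> nnrv G Y -> nnrv G (fun w => X w + Y w).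
Proof.
move=> [mX X0] [mY Y0]; split; last by move=> w; rewrite addr_ge0.
exact: measurable_funD.
Qed.

Lemma nnrv_cst G (c : R) : 0 <= c -> nnrv G (fun=> c).
Proof. by move=> c0; split => //; exact: measurable_cst. Qed.

Lemma nnrv_indic G A : sub_sigma_algebra_of G -> G A -> nnrv G (\1_A : T -> R).
Proof.
by move=> sG GA; split; [exact: measurable_wrt_indic|move=> w; rewrite ?indic_ge0].
Qed.

Lemma nnrv_exp G (f : T -> R) : measurable_wrt G f -> nnrv G (expR \o f).
Proof.
move=> mf; split => [|w]; last exact: expR_ge0.
exact: (@measurableT_comp _ _ _ (g_sigma_algebraType G)).
Qed.

Lemma nnrv_norm G (f : T -> R) : measurable_wrt G f -> nnrv G (fun w => `|f w|).
Proof.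
move=> mf; split => [|w]; last exact: normr_ge0.
exact: (@measurableT_comp _ _ _ (g_sigma_algebraType G)).
Qed.

Lemma nnrv_max G (f : T -> R) :
  measurable_wrt G f -> nnrv G (fun w => Num.max (f w) 0).
Proof.
move=> mf; split => [|w]; last by rewrite le_max lexx orbT.
exact: measurable_maxr.
Qed.

End nnrv.

Section eqint.
Context {dsp : measure_display} {T : measurableType dsp} {R : realType}.
Variables (P : probability T R).
Implicit Types (G H : set (set T)) (X Y Z : T -> R).
Local Open Scope ereal_scope.

(** Equality of the conditional expectations given G, tested on the events of
    G: no version has to be chosen and the variables need not be
    integrable. *)
Definition eqint G X Y : Prop := forall A, G A ->
  \int[P]_(w in A) (X w)%:E = \int[P]_(w in A) (Y w)%:E.

Lemma eqint_sym G X Y : eqint G X Y -> eqint G Y X.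
Proof. by move=> XY A /XY. Qed.

Lemma eqint_trans G Y X Z : eqint G X Y -> eqint G Y Z -> eqint G X Z.
Proof. by move=> XY YZ A GA; rewrite XY// YZ. Qed.

Lemma eqint_sub G H X Y : G `<=` H -> eqint H X Y -> eqint G X Y.
Proof. by move=> GH XY A /GH/XY. Qed.

Lemma eqint_ae G X Y : sub_sigma_algebra_of G ->
  nnrv measurable X -> nnrv measurable Y ->
  {ae P, forall w, X w = Y w} -> eqint G X Y.
Proof.
have sT := @measurable_sub_sigma _ T.
move=> sG nX nY XY A GA; apply: ge0_ae_eq_integral.
- exact: (subG_measurable sG).
- by apply: measurable_funTS; exact: nnrvT_ereal nX.
- by apply: measurable_funTS; exact: nnrvT_ereal nY.
- by move=> w _; rewrite lee_fin; case: nX.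
- by move=> w _; rewrite lee_fin; case: nY.
- by apply: filterS XY => w -> _.
Qed.

Lemma eqint_mul G f X Y : sub_sigma_algebra_of G ->
  nnrv G f -> nnrv measurable X -> nnrv measurable Y ->
  eqint G X Y -> eqint G (fun w => f w * X w)%R (fun w => f w * Y w)%R.
Proof.
have sT := @measurable_sub_sigma _ T.
move=> sG [mf f0] nX nY XY A GA; apply: eqint_mul_gen XY _ GA => //;
  by [exact: nnrvT nX|exact: nnrvT nY|case: nX|case: nY].
Qed.

Lemma eqintD G X X' Y Y' : sub_sigma_algebra_of G ->
  nnrv measurable X -> nnrv measurable X' ->
  nnrv measurable Y -> nnrv measurable Y' ->
  eqint G X Y -> eqint G X' Y' ->
  eqint G (fun w => X w + X' w)%R (fun w => Y w + Y' w)%R.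
Proof.
have sT := @measurable_sub_sigma _ T.
move=> sG nX nX' nY nY' XY XY' A GA.
have addE Z Z' : nnrv measurable Z -> nnrv measurable Z' ->
    \int[P]_(w in A) (Z w + Z' w)%:E =
    \int[P]_(w in A) (Z w)%:E + \int[P]_(w in A) (Z' w)%:E.
  move=> nZ nZ'; rewrite -ge0_integralD//.
  - exact: (subG_measurable sG).
  - by move=> w _; rewrite lee_fin; case: nZ.
  - by apply: measurable_funTS; exact: nnrvT_ereal nZ.
  - by move=> w _; rewrite lee_fin; case: nZ'.
  - by apply: measurable_funTS; exact: nnrvT_ereal nZ'.
by rewrite !addE// XY// XY'.
Qed.

(** On the event Y < X <= n both integrals are finite, so X - Y, which is
    positive there, cannot have a nonpositive integral unless the event is
    negligible. *)
Lemma ae_le_int G X Y : sub_sigma_algebra_of G -> nnrv G X -> nnrv G Y ->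
  (forall A, G A -> \int[P]_(w in A) (X w)%:E <= \int[P]_(w in A) (Y w)%:E) ->
  {ae P, forall w, (X w <= Y w)%R}.
Proof.
move=> sG nX nY XY; have [mX X0] := nX; have [mY Y0] := nY.
pose E (n : nat) := [set w | (Y w < X w)%R] `&` [set w | (X w <= n%:R)%R].
have GE n : G (E n) by apply: (subGI sG); [exact: subG_ltr|exact: subG_ler].
have mE n : measurable (E n) by exact: (subG_measurable sG).
apply: (@negligibleS _ _ _ P (\bigcup_n E n)).
  move=> w /= /negP; rewrite -ltNge => YX.
  by exists (Num.bound (X w)) => //; split => //=; exact/ltW/archi_boundP.
apply: negligible_bigcup => n.
have bnd Z : nnrv G Z -> (forall w, E n w -> (Z w <= n%:R)%R) ->
    P.-integrable (E n) (EFin \o Z).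
  move=> nZ Zn; apply: measurable_bounded_integrable => //.
  - by rewrite (le_lt_trans (probability_le1 _ _))// ltry.
  - by apply: measurable_funTS; exact: nnrvT nZ.
  - exists n%:R; split => // M nM w Ew /=.
    rewrite ger0_norm; last by case: nZ.
    exact/ltW/(le_lt_trans (Zn _ Ew)).
have iX : P.-integrable (E n) (EFin \o X) by apply: bnd => // w [].
have iY : P.-integrable (E n) (EFin \o Y).
  by apply: bnd => // w [/= /ltW YX Xn]; exact: le_trans YX Xn.
have mXY : measurable_fun (E n) (fun w => (X w)%:E - (Y w)%:E).
  by apply: emeasurable_funB; [exact: measurable_int iX|exact: measurable_int iY].
have XY0 : \int[P]_(w in E n) ((X w)%:E - (Y w)%:E) = 0.
  apply/eqP; rewrite eq_le; apply/andP; split.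
    rewrite integralB_EFin//.
    by rewrite sube_le0 XY.
  by apply: integral_ge0 => w [/= /ltW YX _]; rewrite -EFinB lee_fin subr_ge0.
have : ae_eq P (E n) (fun w => (X w)%:E - (Y w)%:E) (cst 0).
  apply/ae_eq_integral_abs => //.
  transitivity (\int[P]_(w in E n) ((X w)%:E - (Y w)%:E)) => //.
  apply: eq_integral => w.
  rewrite inE => -[/= /ltW YX _]; by rewrite /= ger0_norm// subr_ge0.
apply: negligibleS => w Ew /= /(_ Ew) /eqP; rewrite -EFinB eqe subr_eq0.
by case: Ew => /= YX _; rewrite gt_eqF.
Qed.

Lemma eqint_uniq G X Y : sub_sigma_algebra_of G -> nnrv G X -> nnrv G Y ->
  eqint G X Y -> {ae P, forall w, X w = Y w}.
Proof.
move=> sG nX nY XY.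
have h1 : {ae P, forall w, (X w <= Y w)%R}.
  by apply: (ae_le_int sG nX nY) => A GA; rewrite XY.
have h2 : {ae P, forall w, (Y w <= X w)%R}.
  by apply: (ae_le_int sG nY nX) => A GA; rewrite XY.
by apply: filterS2 h1 h2 => w ? ?; apply/eqP; rewrite eq_le; apply/andP.
Qed.

End eqint.

(** * Finiteness of conditional expectations and localization *)

Section cfin.
Context {dsp : measure_display} {T : measurableType dsp} {R : realType}.
Variables (P : probability T R).
Implicit Types (G H : set (set T)) (X Y Z : T -> R).
Local Open Scope ereal_scope.

Let sT := @measurable_sub_sigma _ T.

Definition exhaustion G (C : nat -> set T) : Prop :=
  [/\ nondecreasing_seq C, forall n, G (C n) & P.-negligible (~` \bigcup_n C n)].

Lemma ae_exhaustion G C (Q : T -> Prop) : exhaustion G C ->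
  (forall n, {ae P, forall w, C n w -> Q w}) -> {ae P, forall w, Q w}.
Proof.
move=> [_ _ negC] CQ.
apply: (@negligibleS _ _ _ P (~` (\bigcup_n C n) `|`
    \bigcup_n (~` [set w | C n w -> Q w]))).
  move=> w /= nQ; have [[n _ Cn]|nC] := pselect ((\bigcup_n C n) w); last by left.
  by right; exists n => //= /(_ Cn).
by apply: negligibleU => //; apply: negligible_bigcup => n; exact: CQ.
Qed.

Lemma cvg_exhaustion G C A X : sub_sigma_algebra_of G -> exhaustion G C -> G A ->
  nnrv measurable X ->
  \int[P]_(w in A `&` C n) (X w)%:E @[n --> \oo] --> \int[P]_(w in A) (X w)%:E.
Proof.
move=> sG [ndC GC negC] GA nX.
have mA := subG_measurable sG GA; have mC n := subG_measurable sG (GC n).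
have mX := nnrvT_ereal sT nX; have X0 w : 0 <= (X w)%:E by rewrite lee_fin; case: nX.
have mU : measurable (\bigcup_n C n) by exact: bigcupT_measurable.
have -> : \int[P]_(w in A) (X w)%:E =
    \int[P]_(w in \bigcup_n (A `&` C n)) (X w)%:E.
  rewrite (@ge0_negligible_integral _ _ _ _ A (~` \bigcup_n C n))//.
  - by rewrite setDE setCK setI_bigcupr.
  - exact: measurableC.
  - exact: measurable_funTS.
  - by apply: measure_negligible => //; exact: measurableC.
apply: ge0_nondecreasing_set_cvg_integral => //.
- by move=> n m nm; apply/subsetPset; apply: setIS; apply/subsetPset/ndC.
- by move=> n; exact: measurableI.
- by move=> n; exact: measurable_funTS.
Qed.

(** By monotone convergence, conditional expectations may be compared locally;
    this is how variables of infinite mean are handled. *)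
Lemma eqint_exhaustion G C X Y : sub_sigma_algebra_of G -> exhaustion G C ->
  nnrv measurable X -> nnrv measurable Y ->
  (forall n A, G A -> A `<=` C n ->
    \int[P]_(w in A) (X w)%:E = \int[P]_(w in A) (Y w)%:E) ->
  eqint P G X Y.
Proof.
move=> sG exhC nX nY XY A GA; have [_ GC _] := exhC.
have h1 := cvg_exhaustion sG exhC GA nX; have h2 := cvg_exhaustion sG exhC GA nY.
rewrite -(cvg_lim _ h1)// -(cvg_lim _ h2)//; congr (limn _); apply/funext => n.
by apply: (XY n) => //; exact: (subGI sG).
Qed.

Lemma exhaustionI G C D : sub_sigma_algebra_of G -> exhaustion G C -> exhaustion G D ->
  exhaustion G (fun n => C n `&` D n).
Proof.
move=> sG [ndC GC negC] [ndD GD negD]; split.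
- move=> n m nm; apply/subsetPset; apply: setISS; apply/subsetPset.
    exact: ndC.
  exact: ndD.
- by move=> n; exact: (subGI sG).
- apply: negligibleS (negligibleU negC negD) => w /= nCD.
  have [[n _ Cn]|nC] := pselect ((\bigcup_n C n) w); last by left.
  have [[m _ Dm]|nD] := pselect ((\bigcup_n D n) w); last by right.
  exfalso; apply: nCD; exists (maxn n m) => //; split.
    by have /subsetPset := ndC _ _ (leq_maxl n m); apply.
  by have /subsetPset := ndD _ _ (leq_maxr n m); apply.
Qed.

Lemma exhaustion_ler G (f : T -> R) : sub_sigma_algebra_of G -> measurable_wrt G f ->
  exhaustion G (fun n => [set w | (`|f w| <= n%:R)%R]).
Proof.
move=> sG mf; split.
- by move=> n m nm; apply/subsetPset => w /= /le_trans; apply; rewrite ler_nat.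
- by move=> n; apply: (subG_ler sG); case: (nnrv_norm mf).
- apply: negligibleS (negligible_set0 P) => w /=; apply.
  by exists (Num.bound `|f w|) => //=; exact/ltW/archi_boundP.
Qed.

Lemma exhaustion_sub G H C : G `<=` H -> exhaustion G C -> exhaustion H C.
Proof. by move=> GH [? GC ?]; split => // n; exact/GH/GC. Qed.

(** For X >= 0 this says that E[X | G] is almost surely finite
    (cexp_ge0_fin, cfin_cexp_ge0). In this form it is clearly inherited by
    larger sigma-algebras and by smaller variables. *)
Definition cfin G X : Prop := exists2 C, exhaustion G C &
  forall n, \int[P]_(w in C n) (X w)%:E < +oo.

Lemma int_le A X Y : measurable A -> nnrv measurable X -> nnrv measurable Y ->
  {ae P, forall w, A w -> (X w <= Y w)%R} ->
  \int[P]_(w in A) (X w)%:E <= \int[P]_(w in A) (Y w)%:E.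
Proof.
move=> mA nX nY XY; apply: ae_ge0_le_integral => //.
- by move=> w _; rewrite lee_fin; case: nX.
- by apply: measurable_funTS; exact: nnrvT_ereal nX.
- by move=> w _; rewrite lee_fin; case: nY.
- by apply: measurable_funTS; exact: nnrvT_ereal nY.
Qed.

Lemma int_subset A B X : measurable A -> measurable B -> nnrv measurable X ->
  A `<=` B -> \int[P]_(w in A) (X w)%:E <= \int[P]_(w in B) (X w)%:E.
Proof.
move=> mA mB nX; apply: ge0_subset_integral => //.
  by apply: measurable_funTS; exact: nnrvT_ereal nX.
by move=> w _; rewrite lee_fin; case: nX.
Qed.

Lemma cfin_eqint G X Y : eqint P G X Y -> cfin G X -> cfin G Y.
Proof.
move=> XY [C cC finC]; exists C => // n; rewrite -XY//; by case: cC.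
Qed.

Lemma cfin_le G X Y : sub_sigma_algebra_of G ->
  nnrv measurable X -> nnrv measurable Y -> {ae P, forall w, (X w <= Y w)%R} ->
  cfin G Y -> cfin G X.
Proof.
move=> sG nX nY XY [C cC finC]; exists C => // n; apply: le_lt_trans (finC n).
apply: int_le => //; first by apply: (subG_measurable sG); case: cC.
by apply: filterS XY => w ? _.
Qed.

Lemma cfin_sub G H X : G `<=` H -> cfin G X -> cfin H X.
Proof. by move=> GH [C cC finC]; exists C => //; exact: exhaustion_sub cC. Qed.

Lemma intZ A X (c : R) : measurable A -> nnrv measurable X -> (0 <= c)%R ->
  \int[P]_(w in A) (c * X w)%:E = c%:E * \int[P]_(w in A) (X w)%:E.
Proof.
move=> mA nX c0; rewrite -ge0_integralZl_EFin//.
  by move=> w _; rewrite lee_fin; case: nX.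
by apply: measurable_funTS; exact: nnrvT_ereal nX.
Qed.

Lemma cfin_mul G f X : sub_sigma_algebra_of G -> nnrv G f ->
  nnrv measurable X -> cfin G X -> cfin G (fun w => f w * X w)%R.
Proof.
move=> sG nf nX [C cC finC]; have cf := exhaustion_ler sG nf.1.
have cCf := exhaustionI sG cC cf.
exists (fun n => C n `&` [set w | (`|f w| <= n%:R)%R]) => // n.
have mD := subG_measurable sG (let: And3 _ h _ := cCf in h n).
have mC := subG_measurable sG (let: And3 _ h _ := cC in h n).
apply: (@le_lt_trans _ _ (n%:R%:E * \int[P]_(w in C n) (X w)%:E)).
  rewrite -intZ//.
  have nZ : nnrv measurable (fun w => n%:R * X w)%R.
    by apply: nnrvM => //; exact: nnrv_cst.
  apply: le_trans (int_subset mD mC nZ (@subIsetl _ _ _)).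
  apply: int_le => //; first by apply: nnrvM => //; exact: nnrvW nf.
  apply: aeW => w [_ /=]; rewrite ger0_norm; last by case: nf.
  by move=> fn; rewrite ler_wpM2r//; case: nX.
by rewrite lte_mul_pinfty// ge0_fin_numE.
Qed.

Lemma intD A X Y : measurable A -> nnrv measurable X -> nnrv measurable Y ->
  \int[P]_(w in A) (X w + Y w)%:E =
  \int[P]_(w in A) (X w)%:E + \int[P]_(w in A) (Y w)%:E.
Proof.
move=> mA nX nY; rewrite -ge0_integralD//.
- by move=> w _; rewrite lee_fin; case: nX.
- by apply: measurable_funTS; exact: nnrvT_ereal nX.
- by move=> w _; rewrite lee_fin; case: nY.
- by apply: measurable_funTS; exact: nnrvT_ereal nY.
Qed.

Lemma cfinD G X Y : sub_sigma_algebra_of G ->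
  nnrv measurable X -> nnrv measurable Y ->
  cfin G X -> cfin G Y -> cfin G (fun w => X w + Y w)%R.
Proof.
move=> sG nX nY [C cC finC] [D cD finD]; have cCD := exhaustionI sG cC cD.
exists (fun n => C n `&` D n) => // n.
have mCD := subG_measurable sG (let: And3 _ h _ := cCD in h n).
have mC := subG_measurable sG (let: And3 _ h _ := cC in h n).
have mD := subG_measurable sG (let: And3 _ h _ := cD in h n).
rewrite intD// lte_add_pinfty//.
  by apply: le_lt_trans (finC n); apply: int_subset => //; exact: subIsetl.
by apply: le_lt_trans (finD n); apply: int_subset => //; exact: subIsetr.
Qed.

Lemma cfin_nnrv G X : sub_sigma_algebra_of G -> nnrv G X -> cfin G X.
Proof.
move=> sG nX; exists (fun n => [set w | (`|X w| <= n%:R)%R]).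
  exact: exhaustion_ler nX.1.
move=> n; have cX := exhaustion_ler sG nX.1.
have mC := subG_measurable sG (let: And3 _ h _ := cX in h n).
apply: (@le_lt_trans _ _ (\int[P]_(w in [set w | (`|X w| <= n%:R)%R]) (n%:R : R)%:E)).
  apply: int_le => //; [exact: nnrvW nX|exact: nnrv_cst|].
  by apply: aeW => w /= /(le_trans (ler_norm _)).
by rewrite integral_cst// lte_mul_pinfty// (le_lt_trans (probability_le1 _ _))// ltry.
Qed.

Lemma is_cexp_ge0_fin G (X Y : T -> \bar R) F : sub_sigma_algebra_of G ->
  is_cexp_ge0 P G X Y -> G F -> \int[P]_(w in F) X w < +oo ->
  {ae P, forall w, F w -> Y w \is a fin_num}.
Proof.
move=> sG [mY Y0 YX] GF finX; apply: integrable_ae.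
  exact: (subG_measurable sG).
apply/integrableP; split.
  by apply: measurable_funTS; exact: (measurable_wrtT sG).
by under eq_integral do rewrite gee0_abs//; rewrite YX.
Qed.

Lemma cexp_ge0_fin G X : sub_sigma_algebra_of G -> nnrv measurable X ->
  cfin G X -> {ae P, forall w, cexp_ge0 P G (EFin \o X) w \is a fin_num}.
Proof.
move=> sG nX [C cC finC]; apply: (ae_exhaustion cC) => n.
apply: (is_cexp_ge0_fin sG) (finC n); last by case: cC.
by apply: cexp_ge0P => //; [exact: nnrvT nX|case: nX].
Qed.

Lemma cfin_cexp_ge0 G X : sub_sigma_algebra_of G -> nnrv measurable X ->
  {ae P, forall w, cexp_ge0 P G (EFin \o X) w \is a fin_num} -> cfin G X.
Proof.
move=> sG nX finY.
have [mY Y0 YX] := cexp_ge0P P sG (nnrvT sT nX) nX.2.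
set Y := cexp_ge0 P G _ in finY mY Y0 YX.
exists (fun n => [set w | Y w <= n%:R%:E]); first split.
- by move=> n m nm; apply/subsetPset => w /= /le_trans; apply; rewrite lee_fin ler_nat.
- move=> n; have -> : [set w | Y w <= n%:R%:E] = Y @^-1` `]-oo, n%:R%:E].
    by apply/seteqP; split => w /=; rewrite in_itv.
  by apply: (subG_preimage sG mY); exact: emeasurable_itv.
- move: finY; apply: negligibleS => w /= nC finYw; apply: nC.
  exists (Num.bound (fine (Y w))) => //=; rewrite -(fineK finYw) lee_fin.
  by apply/ltW/archi_boundP; rewrite fine_ge0.
- move=> n; set C := [set w | _].
  have GC : G C.
    have -> : C = Y @^-1` `]-oo, n%:R%:E].
      by apply/seteqP; split => w /=; rewrite in_itv.
    by apply: (subG_preimage sG mY); exact: emeasurable_itv.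
  have mC := subG_measurable sG GC.
  rewrite -[X in X < _]/(\int[P]_(w in C) (EFin \o X) w) -YX//.
  apply: (@le_lt_trans _ _ (\int[P]_(w in C) (n%:R : R)%:E)).
    apply: ge0_le_integral => //.
    by apply: measurable_funTS; exact: (measurable_wrtT sG).
  by rewrite integral_cst// lte_mul_pinfty// (le_lt_trans (probability_le1 _ _))// ltry.
Qed.

Definition cexpv G X : T -> R := fun w => fine (cexp_ge0 P G (EFin \o X) w).

Lemma nnrv_cexpv G X : sub_sigma_algebra_of G -> nnrv measurable X ->
  nnrv G (cexpv G X).
Proof.
move=> sG nX; have [mE E0 _] := cexp_ge0P P sG (nnrvT sT nX) nX.2.
split; last by move=> w; rewrite fine_ge0.
exact: (@measurableT_comp _ _ _ (g_sigma_algebraType G)).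
Qed.

Lemma eqint_cexpv G X : sub_sigma_algebra_of G -> nnrv measurable X ->
  cfin G X -> eqint P G X (cexpv G X).
Proof.
move=> sG nX finX A GA; have finE := cexp_ge0_fin sG nX finX.
have [mE E0 EX] := cexp_ge0P P sG (nnrvT sT nX) nX.2.
rewrite -[LHS](EX A GA); apply: ae_eq_integral.
- exact: (subG_measurable sG).
- by apply: measurable_funTS; exact: (measurable_wrtT sG).
- by apply: measurable_funTS; exact: nnrvT_ereal (nnrv_cexpv sG nX).
- by apply: filterS finE => w fw _; rewrite /= fineK.
Qed.

Lemma cexp_ge0_ae G X Y : sub_sigma_algebra_of G -> nnrv measurable X ->
  nnrv G Y -> eqint P G X Y ->
  {ae P, forall w, cexp_ge0 P G (EFin \o X) w = (Y w)%:E}.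
Proof.
move=> sG nX nY XY.
have finX : cfin G X by apply: cfin_eqint (cfin_nnrv sG nY); exact: eqint_sym.
have EY : eqint P G (cexpv G X) Y.
  by apply: eqint_trans XY; apply: eqint_sym; exact: eqint_cexpv.
apply: filterS2 (cexp_ge0_fin sG nX finX)
  (eqint_uniq sG (nnrv_cexpv sG nX) nY EY) => w fw <-.
by rewrite fineK.
Qed.

(** On B n, E[X | G] coincides with E[X 1_(B n) | G], which is finite. *)
Lemma cfin_local G B X : sub_sigma_algebra_of G -> exhaustion G B ->
  nnrv measurable X -> (forall n, cfin G (fun w => X w * \1_(B n) w)%R) ->
  cfin G X.
Proof.
move=> sG cB nX finXB; apply: (cfin_cexp_ge0 sG) => //.
have YX := cexp_ge0P P sG (nnrvT sT nX) nX.2.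
set Y := cexp_ge0 P G _ in YX *; apply: (ae_exhaustion cB) => n.
have [C cC finC] := finXB n; have GB m : G (B m) by case: cB.
have GC m : G (C m) by case: cC.
apply: (ae_exhaustion (Q := fun w => B n w -> Y w \is a fin_num) cC) => m.
have GF : G (C m `&` B n) by exact: (subGI sG).
have : {ae P, forall w, (C m `&` B n) w -> Y w \is a fin_num}.
  apply: (is_cexp_ge0_fin sG YX GF); apply: le_lt_trans (finC m).
  have nXB : nnrv measurable (fun w => X w * \1_(B n) w)%R.
    by apply: nnrvM => //; apply: nnrv_indic => //; exact: (subG_measurable sG).
  rewrite integral_mkcondr; apply: ge0_le_integral => //.
  - exact: (subG_measurable sG).
  - by move=> w _; rewrite patchE; case: ifPn => //= _; rewrite lee_fin; case: nX.
  - apply: measurable_funTS; apply/(measurable_restrictT (EFin \o X)).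
      exact: (subG_measurable sG).
    by apply: measurable_funTS; exact: nnrvT_ereal nX.
  - by apply: measurable_funTS; exact: nnrvT_ereal nXB.
  - by move=> w _; rewrite patchE indicE /=; case: ifPn; rewrite ?mulr1 ?mulr0.
by apply: filterS => w h Cw Bw; apply: h.
Qed.

End cfin.

(** * Versions of conditional expectations *)

Section cexp_versions.
Context {dsp : measure_display} {T : measurableType dsp} {R : realType}.
Variables (P : probability T R).
Implicit Types (G H : set (set T)) (f X Y Z p q : T -> R).
Local Open Scope ereal_scope.

Let sT := @measurable_sub_sigma _ T.

Lemma cexp_ae G f p q : sub_sigma_algebra_of G -> measurable_fun setT f ->
  nnrv G p -> nnrv G q ->
  eqint P G (fun w => Num.max (f w) 0)%R p ->
  eqint P G (fun w => Num.max (- f w) 0)%R q ->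
  {ae P, forall w, cexp P G (EFin \o f) w = (p w - q w)%:E}.
Proof.
move=> sG mf np nq fp fq.
have posE : (EFin \o f)^\+ = EFin \o (fun w => Num.max (f w) 0)%R.
  by apply/funext => w; rewrite funeposE /= EFin_max.
have negE : (EFin \o f)^\- = EFin \o (fun w => Num.max (- f w) 0)%R.
  by apply/funext => w; rewrite funenegE /= EFin_max.
have mfT : measurable_wrt measurable f.
  move=> _ B mB; rewrite subG_measurableE; [exact: mf|exact: sT].
have mNfT : measurable_wrt measurable (fun w => - f w)%R.
  exact: measurable_funN.
have := cexp_ge0_ae sG (nnrv_max mNfT) nq fq.
apply: filterS2 (cexp_ge0_ae sG (nnrv_max mfT) np fp) => w Ep Eq.
by rewrite /cexp posE negE Ep Eq EFinB.
Qed.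

Lemma cexpr_ae G X Y : sub_sigma_algebra_of G -> nnrv measurable X ->
  nnrv G Y -> eqint P G X Y -> {ae P, forall w, cexpr P G X w = Y w}.
Proof.
move=> sG nX nY XY.
have X0 w : (0 <= X w)%R by case: nX.
have maxX : (fun w => Num.max (X w) 0)%R = X.
  by apply/funext => w; rewrite max_l.
have maxN : (fun w => Num.max (- X w) 0)%R = (fun=> 0%R).
  by apply/funext => w; rewrite max_r// oppr_le0.
have n0 : nnrv G (fun=> 0%R : R) by exact: nnrv_cst.
have := @cexp_ae G X Y (fun=> 0%R) sG (nnrvT sT nX) nY n0.
rewrite maxX maxN => /(_ XY (fun _ _ => erefl)); apply: filterS => w.
by rewrite /cexpr subr0 => ->.
Qed.

Lemma cexpN_ae G X : sub_sigma_algebra_of G -> nnrv measurable X ->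
  {ae P, forall w, cexp P G (fun w => (- X w)%:E) w =
    - cexp_ge0 P G (EFin \o X) w}.
Proof.
move=> sG nX; have X0 w : (0 <= X w)%R by case: nX.
have posE : (fun w => (- X w)%:E)^\+ = EFin \o (fun=> 0%R).
  by apply/funext => w; rewrite funeposE /= -EFin_max max_r// oppr_le0.
have negE : (fun w => (- X w)%:E)^\- = EFin \o X.
  by apply/funext => w; rewrite funenegE /= opprK -EFin_max max_l.
have n0 G' : nnrv G' (fun=> 0%R : R) by exact: nnrv_cst.
have := @cexp_ge0_ae _ _ _ P G (fun=> 0%R) (fun=> 0%R) sG (n0 _) (n0 _).
move=> /(_ (fun _ _ => erefl)); apply: filterS => w Ew.
by rewrite /cexp posE negE Ew sub0e.
Qed.

Lemma cexpN_cfin G X : sub_sigma_algebra_of G -> nnrv measurable X ->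
  {ae P, forall w, cexp P G (fun w => (- X w)%:E) w \is a fin_num} ->
  cfin P G X.
Proof.
move=> sG nX finE; apply: cfin_cexp_ge0 => //.
by apply: filterS2 finE (cexpN_ae sG nX) => w + Ew; rewrite Ew fin_numN.
Qed.

Lemma cexpN_le G X Y : sub_sigma_algebra_of G ->
  nnrv measurable X -> nnrv measurable Y ->
  {ae P, forall w, cexp P G (fun w => (- Y w)%:E) w <=
                   cexp P G (fun w => (- X w)%:E) w} ->
  forall A, G A -> \int[P]_(w in A) (X w)%:E <= \int[P]_(w in A) (Y w)%:E.
Proof.
move=> sG nX nY XY A GA.
have [mEX EX0 EX] := cexp_ge0P P sG (nnrvT sT nX) nX.2.
have [mEY EY0 EY] := cexp_ge0P P sG (nnrvT sT nY) nY.2.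
rewrite -[leLHS](EX A GA) -[leRHS](EY A GA); apply: ae_ge0_le_integral => //.
- exact: (subG_measurable sG).
- by apply: measurable_funTS; exact: (measurable_wrtT sG).
- by apply: measurable_funTS; exact: (measurable_wrtT sG).
- apply: filterS3 XY (cexpN_ae sG nX) (cexpN_ae sG nY) => w + EXw EYw _.
  by rewrite EXw EYw leeN2.
Qed.

Lemma int_eq0 A X : measurable A -> nnrv measurable X ->
  \int[P]_(w in A) (X w)%:E = 0 -> {ae P, forall w, A w -> X w = 0%R}.
Proof.
move=> mA nX intX0.
have : ae_eq P A (EFin \o X) (cst 0).
  apply/ae_eq_integral_abs => //.
    by apply: measurable_funTS; exact: nnrvT_ereal nX.
  rewrite -intX0; apply: eq_integral => w _.
  by rewrite /= ger0_norm//; case: nX.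
by apply: filterS => w + Aw => /(_ Aw)/= [].
Qed.

(** A conditional expectation Y vanishes only where the variable X itself does:
    the integral of X over the event Y = 0 is zero. The second pair X', Y'
    carries this information to where it is used: with X' = Y' = 1 it gives
    Y > 0 when X > 0; with X' the indicator of an event of conditional
    probability 1/2, it gives Y > 0 when X is only positive on that event. *)
Lemma eqint_eq0 G X Y X' Y' : sub_sigma_algebra_of G ->
  nnrv measurable X -> nnrv G Y -> nnrv measurable X' -> nnrv G Y' ->
  eqint P G X Y -> eqint P G X' Y' ->
  {ae P, forall w, X w = 0%R -> X' w = 0%R} ->
  {ae P, forall w, Y w = 0%R -> Y' w = 0%R}.
Proof.
move=> sG nX nY nX' nY' XY XY' XX'.
pose E := [set w | (Y w <= 0)%R].
have GE : G E by apply: (subG_ler sG); case: nY.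
have mE := subG_measurable sG GE.
have Y0 w : E w -> Y w = 0%R.
  by rewrite /E/= => Yle; apply/eqP; rewrite eq_le Yle/=; case: nY.
have intX : \int[P]_(w in E) (X w)%:E = 0.
  by rewrite XY// integral0_eq// => w /Y0 ->.
have XE := int_eq0 mE nX intX.
have intY' : \int[P]_(w in E) (Y' w)%:E = 0.
  rewrite -XY'// (@ae_eq_integral _ _ _ P E (cst 0))//.
  - by rewrite integral0.
  - by apply: measurable_funTS; exact: nnrvT_ereal nX'.
  - by apply: filterS2 XX' XE => w h1 h2 /h2/h1 /= ->.
apply: filterS (int_eq0 mE (nnrvW sG nY') intY') => w h Yw0.
by apply: h; rewrite /E/= Yw0.
Qed.

Lemma cexpr_measurable G f : sub_sigma_algebra_of G -> measurable_fun setT f ->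
  measurable_wrt G (cexpr P G f).
Proof.
move=> sG mf.
have mfT : measurable_wrt measurable f.
  by move=> _ B mB; rewrite subG_measurableE; [exact: mf|exact: sT].
have mNfT : measurable_wrt measurable (fun w => - f w)%R.
  exact: measurable_funN.
have posE : (EFin \o f)^\+ = EFin \o (fun w => Num.max (f w) 0)%R.
  by apply/funext => w; rewrite funeposE /= EFin_max.
have negE : (EFin \o f)^\- = EFin \o (fun w => Num.max (- f w) 0)%R.
  by apply/funext => w; rewrite funenegE /= EFin_max.
have [mp _ _] := cexp_ge0P P sG (nnrvT sT (nnrv_max mfT)) (nnrv_max mfT).2.
have [mn _ _] := cexp_ge0P P sG (nnrvT sT (nnrv_max mNfT)) (nnrv_max mNfT).2.
rewrite /cexpr /cexp posE negE.
apply: (@measurableT_comp _ _ _ (g_sigma_algebraType G)) => //.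
exact: emeasurable_funB.
Qed.

End cexp_versions.

(** * First-order condition for the exponential loss *)

Lemma maxr_posneg {R : realDomainType} (z : R) :
  z = Num.max z 0 - Num.max (- z) 0.
Proof.
case: (leP z 0) => z0; first by rewrite max_l ?oppr_ge0// sub0r opprK.
by rewrite max_r ?subr0// oppr_le0 ltW.
Qed.

Section first_order_condition.
Context {dsp : measure_display} {T : measurableType dsp} {R : realType}.
Variables (P : probability T R).
Implicit Types (G : set (set T)) (V Z : T -> R).
Local Open Scope ereal_scope.

Let sT := @measurable_sub_sigma _ T.

(* domination of |z| e^(eps z), uniform in the sizes eps = 1/(n+2) <= 1/2 of the
   perturbation *)
Let bound_exp (z : R) (n : nat) :
  (`|z| * expR (n.+2%:R^-1 * z) <= 2 * (expR z + expR (- z)))%R.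
Proof.
have h1 : (`|z| <= 2 * expR (`|z| / 2))%R.
  have := expR_ge1Dx (`|z| / 2); have := normr_ge0 z; lra.
have h2 : (expR (n.+2%:R^-1 * z) <= expR (`|z| / 2))%R.
  rewrite ler_expR; apply: le_trans (ler_norm _) _; rewrite normrM mulrC.
  rewrite ler_wpM2l// ger0_norm// lef_pV2 ?posrE// ler_nat//.
have h3 : (expR (`|z| / 2) * expR (`|z| / 2) = expR `|z|)%R.
  by rewrite -expRD; congr expR; field.
have h4 : (expR `|z| <= expR z + expR (- z))%R.
  have := expR_ge0 z; have := expR_ge0 (- z).
  by case: (ger0P z) => _; lra.
have := expR_ge0 (`|z| / 2); have := expR_ge0 (n.+2%:R^-1 * z); nra.
Qed.

(** Minimality at 0 along the direction Z, on the side of positive sizes. Since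
    e^y - 1 <= y e^y, minimality gives 0 <= E[V Z e^(eps Z)], and eps tends to
    0 by dominated convergence. *)
Lemma expR_first_order A V Z : measurable A -> nnrv measurable V ->
  measurable_fun setT Z ->
  \int[P]_(w in A) (V w * (expR (Z w) + expR (- Z w)))%:E < +oo ->
  (forall n, \int[P]_(w in A) (V w)%:E <=
     \int[P]_(w in A) (V w * expR (n.+2%:R^-1 * Z w))%:E) ->
  P.-integrable A (fun w => (V w * Z w)%:E) /\
  0 <= \int[P]_(w in A) (V w * Z w)%:E.
Proof.
move=> mA nV mZ finVZ opt.
have mV := nnrvT sT nV; have V0 w : (0 <= V w)%R by case: nV.
pose g w := (2 * (V w * (expR (Z w) + expR (- Z w))))%:E.
pose f (n : nat) w := (V w * (Z w * expR (n.+2%:R^-1 * Z w)))%:E.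
have mexp (c : R) : measurable_fun setT (fun w => expR (c * Z w)).
  by apply: measurableT_comp => //; apply: measurable_funM.
have mf n : measurable_fun A (f n).
  apply/measurable_EFinP/measurable_funTS.
  by apply: measurable_funM => //; apply: measurable_funM.
have mVZ : measurable_fun A (fun w => (V w * Z w)%:E).
  by apply/measurable_EFinP/measurable_funTS; apply: measurable_funM.
have nE : nnrv measurable (fun w => V w * (expR (Z w) + expR (- Z w)))%R.
  apply: nnrv_measurable => [|w]; last by rewrite mulr_ge0// addr_ge0 ?expR_ge0.
  apply: measurable_funM => //; apply: measurable_funD; apply: measurableT_comp => //.
  exact: measurable_funN.
have ig : P.-integrable A g.
  apply/integrableP; split.
    apply/measurable_EFinP/measurable_funTS.
    by apply: measurable_funM => //; exact: nnrvT nE.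
  under eq_integral => w _.
    rewrite /g /= ger0_norm; last by rewrite mulr_ge0//; case: nE.
    over.
  by rewrite intZ// lte_mul_pinfty// ge0_fin_numE.
have dom : {ae P, forall w n, A w -> `|f n w| <= g w}.
  apply: aeW => w n _; rewrite lee_fin normrM ger0_norm// mulrCA ler_wpM2l//.
  by rewrite normrM [`|expR _|%R]ger0_norm ?expR_ge0// bound_exp.
have lim : {ae P, forall w, A w -> f^~ w @ \oo --> (V w * Z w)%:E}.
  apply: aeW => w _; apply: cvg_EFin; first by near=> n.
  rewrite -[X in _ --> (V w * X)%R]mulr1 -(@expR0 R) -(mul0r (Z w)).
  apply: cvgMr; apply: cvgMr.
  apply: continuous_cvg; first exact: continuous_expR.
  apply: cvgMl.
  have := @cvg_harmonic R; rewrite -cvg_shiftS; exact.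
have [iVZ _ cvgf] := dominated_convergence mA mf mVZ lim ig dom.
split => //; rewrite -(cvg_lim _ cvgf)//; apply: lime_ge.
  exact: cvgP cvgf.
apply: nearW => n; have c0 : (0 < n.+2%:R^-1 :> R)%R by rewrite invr_gt0.
have nVexp : nnrv measurable (fun w => V w * expR (n.+2%:R^-1 * Z w))%R.
  apply: nnrv_measurable => [|w]; last by rewrite mulr_ge0// expR_ge0.
  exact: measurable_funM.
have fin_of (X : T -> R) : measurable_fun setT X ->
    (forall w, `|X w| <= 2 * (V w * (expR (Z w) + expR (- Z w))))%R ->
    P.-integrable A (EFin \o X).
  move=> mX Xg; apply: le_integrable ig => //.
    by apply/measurable_EFinP; exact: measurable_funTS.
  move=> w _; rewrite /= lee_fin (le_trans (Xg w))// ler_norm//.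
have iV : P.-integrable A (EFin \o V).
  apply: fin_of => // w; rewrite ger0_norm// mulrCA ler_peMr//.
  have := bound_exp 0 0; have := expR_ge1Dx (Z w); have := expR_ge1Dx (- Z w).
  lra.
have iF : P.-integrable A (EFin \o (fun w => V w * (Z w * expR (n.+2%:R^-1 * Z w)))%R).
  apply: fin_of => [|w]; first by apply: measurable_funM => //; exact: measurable_funM.
  rewrite normrM ger0_norm// mulrCA ler_wpM2l//.
  by rewrite normrM [`|expR _|%R]ger0_norm ?expR_ge0// bound_exp.
rewrite -(@pmule_rge0 _ (n.+2%:R^-1%:E))// -integralZl//.
rewrite -(@leeD2lE _ (\int[P]_(w in A) (V w)%:E)); last exact: integrable_fin_num.
rewrite adde0; apply: le_trans (opt n) _.
rewrite -integralD//; last exact: integrableZl.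
apply: ge0_le_integral => //.
- by move=> w _; rewrite lee_fin; case: nVexp.
- by apply: measurable_funTS; exact: nnrvT_ereal nVexp.
- by apply: emeasurable_funD; [exact: measurable_int iV|
    exact: measurable_int (integrableZl _ _ iF)].
- move=> w _; rewrite -EFinM -EFinD lee_fin.
  set y := (n.+2%:R^-1 * Z w)%R.
  have e1 : (expR (- y) * expR y = 1)%R by rewrite -expRD addNr expR0.
  have := expR_ge1Dx (- y); have := expR_gt0 y => y0 y1.
  have : ((1 + - y) * expR y <= 1)%R by rewrite -[leRHS]e1 ler_wpM2r// ltW.
  have -> : (n.+2%:R^-1 * (V w * (Z w * expR y)) = V w * (y * expR y))%R.
    by rewrite /y; ring.
  by move=> h; have := V0 w; nra.
Unshelve. all: by end_near.
Qed.

(** A minimal conditional loss V is orthogonal to every direction Z: the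
    positive and negative parts of V Z have the same conditional expectation
    given G. Minimality is tested on the smaller sigma-algebra G', but the
    perturbation is supported by an event A of G; the contributions of the
    complement of A are finite and equal on both sides, so they cancel and
    minimality holds on A itself. The exhaustion B localizes the perturbations
    that are allowed. *)
Lemma first_order_condition G' G V Z B :
  sub_sigma_algebra_of G' -> sub_sigma_algebra_of G -> G' `<=` G ->
  nnrv measurable V -> measurable_fun setT Z -> exhaustion P G B -> cfin P G' V ->
  (forall n A (e : R), G A -> A `<=` B n ->
    cfin P G (fun w => V w * expR (e * (\1_A w * Z w)))%R) ->
  (forall n A (e : R), G A -> A `<=` B n -> forall A', G' A' ->
    \int[P]_(w in A') (V w)%:E <=
    \int[P]_(w in A') (V w * expR (e * (\1_A w * Z w)))%:E) ->
  [/\ cfin P G (fun w => V w * Num.max (Z w) 0)%R,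
      cfin P G (fun w => V w * Num.max (- Z w) 0)%R &
      eqint P G (fun w => V w * Num.max (Z w) 0)%R
                (fun w => V w * Num.max (- Z w) 0)%R].
Proof.
move=> sG' sG G'G nV mZ cB finV finVe opt.
have V0 w : (0 <= V w)%R by case: nV.
have nVe (e : R) A : measurable A ->
    nnrv measurable (fun w => V w * expR (e * (\1_A w * Z w)))%R.
  move=> mA; apply: nnrvM => //; apply: nnrv_measurable => [|w]; last exact: expR_ge0.
  apply: measurableT_comp => //; apply: measurable_funM => //.
  by apply: measurable_funM => //; exact: measurable_indic.
have nVZ (e : R) : nnrv measurable (fun w => V w * expR (e * Z w))%R.
  apply: nnrvM => //; apply: nnrv_measurable => [|w]; last exact: expR_ge0.
  by apply: measurableT_comp => //; apply: measurable_funM.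
have finVZ (e : R) : cfin P G (fun w => V w * expR (e * Z w))%R.
  apply: (cfin_local sG cB) => // n; have GB : G (B n) by case: cB.
  apply: cfin_le (finVe n (B n) e GB (@subset_refl _ _)) => //.
  - by apply: nnrvM => //; apply: nnrv_indic => //; exact: (subG_measurable sG).
  - by apply: nVe; exact: (subG_measurable sG).
  apply: aeW => w; rewrite indicE; case: (w \in B n); rewrite ?mulr1 ?mul1r//.
  by rewrite mulr0 mulr_ge0// expR_ge0.
have nW : nnrv measurable (fun w => V w * (expR (Z w) + expR (- Z w)))%R.
  apply: nnrvM => //; apply: nnrv_measurable => [|w].
    by apply: measurable_funD; apply: measurableT_comp => //; exact: measurable_funN.
  by rewrite addr_ge0 ?expR_ge0.
have finW : cfin P G (fun w => V w * (expR (Z w) + expR (- Z w)))%R.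
  apply: cfin_le (cfinD sG (nVZ 1%R) (nVZ (-1)%R) (finVZ _) (finVZ _)) => //.
    exact: nnrvD.
  by apply: aeW => w; rewrite mul1r mulN1r mulrDr.
have npos : nnrv measurable (fun w => V w * Num.max (Z w) 0)%R.
  apply: nnrvM => //; apply: nnrv_measurable => [|w]; last by rewrite le_max lexx orbT.
  exact: measurable_maxr.
have mNZ : measurable_fun setT (fun w => - Z w)%R by exact: measurable_funN.
have nneg : nnrv measurable (fun w => V w * Num.max (- Z w) 0)%R.
  apply: nnrvM => //; apply: nnrv_measurable => [|w]; last by rewrite le_max lexx orbT.
  exact: measurable_maxr.
have maxW (z : R) : (Num.max z 0 <= expR z + expR (- z))%R.
  have := expR_ge1Dx z; have := expR_ge0 (- z); have := expR_ge0 z.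
  by case: (leP z 0%R) => _; lra.
have maxWN (z : R) : (Num.max (- z) 0 <= expR z + expR (- z))%R.
  by have := maxW (- z)%R; rewrite opprK addrC.
split.
- apply: cfin_le finW => //; apply: aeW => w; rewrite ler_wpM2l//.
- apply: cfin_le finW => //; apply: aeW => w; rewrite ler_wpM2l//.
have [C cC finC] := finW; have [C' cC' finC'] := finV.
have cD := exhaustionI sG (exhaustionI sG cC cB) (exhaustion_sub G'G cC').
apply: (eqint_exhaustion sG cD) => // n A GA AD.
have mA := subG_measurable sG GA.
have AB : A `<=` B n by move=> w /AD[[]].
have finWA : \int[P]_(w in A) (V w * (expR (Z w) + expR (- Z w)))%:E < +oo.
  apply: le_lt_trans (finC n); apply: int_subset => //; last by move=> w /AD[[]].
  by apply: (subG_measurable sG); case: cC.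
have optA (e : R) :
    \int[P]_(w in A) (V w)%:E <= \int[P]_(w in A) (V w * expR (e * Z w))%:E.
  have G'C : G' (C' n) by case: cC'.
  have mC := subG_measurable sG' G'C.
  have C'E : C' n = A `|` (C' n `\` A).
    by rewrite setDUK// => w /AD[].
  have splitC (X : T -> R) : nnrv measurable X -> \int[P]_(w in C' n) (X w)%:E =
      \int[P]_(w in A) (X w)%:E + \int[P]_(w in C' n `\` A) (X w)%:E.
    move=> nX; rewrite {1}C'E ge0_integral_setU//.
    - exact: measurableD.
    - by apply: measurable_funTS; exact: nnrvT_ereal nX.
    - by move=> w _; rewrite lee_fin; case: nX.
    - by apply/disj_setPS => w [Aw []].
  have := opt n A e GA AB _ G'C; rewrite !splitC//; last exact: nVe.
  have -> : \int[P]_(w in C' n `\` A) (V w * expR (e * (\1_A w * Z w)))%:E =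
      \int[P]_(w in C' n `\` A) (V w)%:E.
    apply: eq_integral => w; rewrite inE => -[_ nA].
    by rewrite indicE memNset// mul0r mulr0 expR0 mulr1.
  have -> : \int[P]_(w in A) (V w * expR (e * (\1_A w * Z w)))%:E =
      \int[P]_(w in A) (V w * expR (e * Z w))%:E.
    by apply: eq_integral => w wA; rewrite indicE wA mul1r.
  rewrite leeD2rE// ge0_fin_numE.
    apply: le_lt_trans (finC' n); apply: int_subset => //; exact: measurableD.
  by apply: integral_ge0 => w _; rewrite lee_fin.
have fin_le (X : T -> R) : nnrv measurable X ->
    (forall w, X w <= V w * (expR (Z w) + expR (- Z w)))%R ->
    P.-integrable A (EFin \o X).
  move=> nX XW; apply/integrableP; split.
    by apply: measurable_funTS; exact: nnrvT_ereal nX.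
  under eq_integral => w _ do rewrite /= ger0_norm ?(proj2 nX)//.
  by apply: le_lt_trans finWA; apply: int_le => //; exact: aeW.
have ipos := fin_le _ npos (fun w => ler_wpM2l (V0 w) (maxW (Z w))).
have ineg : P.-integrable A (EFin \o (fun w => V w * Num.max (- Z w) 0)%R).
  by apply: fin_le => // w; rewrite ler_wpM2l.
have [_ h1] := expR_first_order mA nV mZ finWA (fun n => optA n.+2%:R^-1%R).
have [_ h2] : P.-integrable A (fun w => (V w * - Z w)%:E) /\
    0 <= \int[P]_(w in A) (V w * - Z w)%:E.
  apply: (expR_first_order mA nV mNZ).
    by under eq_integral do rewrite opprK addrC.
  move=> k; have := optA (- k.+2%:R^-1)%R.
  by under [leRHS]eq_integral do rewrite mulNr -mulrN.
have VZE w : (V w * Z w)%:E =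
    (V w * Num.max (Z w) 0)%:E - (V w * Num.max (- Z w) 0)%:E.
  by rewrite -EFinB -mulrBr -maxr_posneg.
have VNZE w : (V w * - Z w)%:E =
    (V w * Num.max (- Z w) 0)%:E - (V w * Num.max (Z w) 0)%:E.
  by rewrite -EFinB -mulrBr -opprB -maxr_posneg.
move: h1; under eq_integral do rewrite VZE; rewrite integralB_EFin// => h1.
move: h2; under eq_integral do rewrite VNZE; rewrite integralB_EFin// => h2.
have f1 : \int[P]_(w in A) (V w * Num.max (Z w) 0)%:E \is a fin_num.
  exact: integrable_fin_num ipos.
have f2 : \int[P]_(w in A) (V w * Num.max (- Z w) 0)%:E \is a fin_num.
  exact: integrable_fin_num ineg.
by apply/eqP; rewrite eq_le; apply/andP; split; rewrite -sube_ge0 ?f1 ?f2.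
Qed.

End first_order_condition.

(** * Measurability and the binomial noise of the market *)

Section measurable_wrt_arith.
Context {dsp : measure_display} {T : measurableType dsp} {R : realType}.
Variable G : set (set T).
Implicit Types f g : T -> R.

Lemma measurable_invr : measurable_fun setT (@GRing.inv R).
Proof.
have -> : setT = [set 0] `|` [set~ 0] :> set R by rewrite setUv.
have m0 : measurable [set~ 0 : R] by apply: measurableC; exact: measurable_set1.
apply/measurable_funU => //; split; first exact: measurable_fun_set1.
apply: open_continuous_measurable_fun; first exact/closed_openC/closed_eq.
by move=> x; rewrite inE => /eqP x0; exact: inv_continuous.
Qed.

Lemma measurable_wrt_cst (c : R) : measurable_wrt G (fun=> c : R).
Proof. exact: measurable_cst. Qed.

Lemma measurable_wrtD f g : measurable_wrt G f -> measurable_wrt G g ->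
  measurable_wrt G (fun w => f w + g w).
Proof. exact: measurable_funD. Qed.

Lemma measurable_wrtB f g : measurable_wrt G f -> measurable_wrt G g ->
  measurable_wrt G (fun w => f w - g w).
Proof. exact: measurable_funB. Qed.

Lemma measurable_wrtN f : measurable_wrt G f -> measurable_wrt G (fun w => - f w).
Proof. exact: measurable_funN. Qed.

Lemma measurable_wrtM f g : measurable_wrt G f -> measurable_wrt G g ->
  measurable_wrt G (fun w => f w * g w).
Proof. exact: measurable_funM. Qed.

Lemma measurable_wrt_comp (p : R -> R) f : measurable_fun setT p ->
  measurable_wrt G f -> measurable_wrt G (fun w => p (f w)).
Proof. by move=> mp mf; exact: (@measurableT_comp _ _ _ (g_sigma_algebraType G)). Qed.

Lemma measurable_wrtV f : measurable_wrt G f -> measurable_wrt G (fun w => (f w)^-1).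
Proof. by apply: measurable_wrt_comp; exact: measurable_invr. Qed.

Lemma measurable_wrt_sum (r : seq nat) (f : nat -> T -> R) :
  (forall i, i \in r -> measurable_wrt G (f i)) ->
  measurable_wrt G (fun w => \sum_(i <- r) f i w).
Proof.
elim: r => [|i r IH] mf.
  by under eq_fun do rewrite big_nil; exact: measurable_wrt_cst.
under eq_fun do rewrite big_cons; apply: measurable_wrtD.
  by apply: mf; rewrite mem_head.
by apply: IH => j jr; apply: mf; rewrite inE jr orbT.
Qed.

End measurable_wrt_arith.

Section market_facts.
Context {dsp : measure_display} {T : measurableType dsp} {R : realType}.
Variables (P : probability T R) (m : market T R).
Hypothesis hm : market_spec P m.
Local Notation N := (nsteps m).
Local Notation F := (filt m).
Local Notation sqh := (Num.sqrt (step m)).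

Lemma filt_sigma n : (n <= N)%N -> sub_sigma_algebra_of (F n).
Proof. by move=> nN; exact: (filt_sub (market_filtration hm)). Qed.

Lemma filt_incr k n : (k <= n)%N -> (n <= N)%N -> F k `<=` F n.
Proof. by move=> kn nN; exact: (filt_mono (market_filtration hm)). Qed.

Lemma measurable_wrt_filt k n (f : T -> R) : (k <= n)%N -> (n <= N)%N ->
  measurable_wrt (F k) f -> measurable_wrt (F n) f.
Proof.
move=> kn nN; apply: measurable_wrt_sub; [|exact: filt_sigma|exact: filt_incr].
by apply: filt_sigma; exact: leq_trans nN.
Qed.

Lemma step_gt0 : 0 < step m.
Proof.
by rewrite divr_gt0// ?(horizon_gt0 hm)// ltr0n (nsteps_gt0 hm).
Qed.

Lemma sqh_gt0 : 0 < sqh.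
Proof. by rewrite sqrtr_gt0 step_gt0. Qed.

Lemma incr_measurable Z n : adapted m Z -> (n < N)%N ->
  measurable_wrt (F n.+1) (incr Z n).
Proof.
move=> aZ nN; apply: measurable_wrtB; first exact: aZ.
by apply: (@measurable_wrt_filt n) => //; apply: aZ; exact: ltnW.
Qed.

Lemma db1_measurable n : (n < N)%N -> measurable_wrt (F n.+1) (db1 m n).
Proof. by apply: incr_measurable; exact: (walk_adapted (market_walk hm)). Qed.

Lemma db2_measurable n : (n < N)%N -> measurable_wrt (F n.+1) (db2 m n).
Proof. by apply: incr_measurable; exact: (walk_adapted (market_walk hm)). Qed.

Lemma adapted_next Z n : adapted m Z -> (n < N)%N -> measurable_wrt (F n.+1) (Z n).
Proof.
by move=> aZ nN; apply: (@measurable_wrt_filt n) => //; apply: aZ; exact: ltnW.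
Qed.

Lemma retC_measurable n : (n < N)%N -> measurable_wrt (F n.+1) (retC m n).
Proof.
have hA := market_assets hm.
move=> nN; apply: measurable_wrtD; apply: measurable_wrtM.
- by apply: adapted_next => //; exact: (muC_adapted hA).
- exact: measurable_wrt_cst.
- apply: measurable_wrtM; last exact: measurable_wrt_cst.
  by apply: adapted_next => //; exact: (sigC_adapted hA).
- exact: db1_measurable.
Qed.

Lemma retS_measurable n : (n < N)%N -> measurable_wrt (F n.+1) (retS m n).
Proof.
have hA := market_assets hm.
move=> nN; apply: measurable_wrtD; apply: measurable_wrtM.
- by apply: adapted_next => //; exact: (muS_adapted hA).
- exact: measurable_wrt_cst.
- apply: measurable_wrtM; last exact: measurable_wrt_cst.
  by apply: adapted_next => //; exact: (sigS_adapted hA).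
- apply: measurable_wrtD; apply: measurable_wrtM; try exact: measurable_wrt_cst.
    exact: db1_measurable.
  exact: db2_measurable.
Qed.

Lemma asset_adapted (Z ret : nat -> T -> R) z0 : (forall w, Z 0%N w = z0) ->
  (forall n w, (n < N)%N -> incr Z n w = Z n w * ret n w) ->
  (forall n, (n < N)%N -> measurable_wrt (F n.+1) (ret n)) -> adapted m Z.
Proof.
move=> Z0 dZ mret; elim=> [|n IH] nN.
  have -> : Z 0%N = (fun=> z0) by apply/funext.
  exact: measurable_wrt_cst.
have -> : Z n.+1 = (fun w => Z n w + Z n w * ret n w).
  by apply/funext => w; rewrite -dZ// /incr addrC subrK.
have mZ : measurable_wrt (F n.+1) (Z n).
  by apply: (@measurable_wrt_filt n) => //; exact: IH (ltnW nN).
by apply: measurable_wrtD => //; apply: measurable_wrtM => //; exact: mret.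
Qed.

Lemma dividend_measurable n : (n <= N)%N -> measurable_wrt (F n) (dividend m n).
Proof.
have hA := market_assets hm.
move=> nN; apply: measurable_wrtM; last exact: measurable_wrt_cst.
have mC : measurable_wrt (F n) (assetC m n).
  by apply: (asset_adapted (assetC_init hA) (assetC_dyn hA) retC_measurable).
have mS : measurable_wrt (F n) (assetS m n).
  by apply: (asset_adapted (assetS_init hA) (assetS_dyn hA) retS_measurable).
have mphi := phi_measurable hA (tgrid m n).
have mCS : measurable_fun (setT : set (g_sigma_algebraType (F n)))
    (fun w => (assetC m n w, assetS m n w)).
  exact: measurable_fun_pair.
exact: (measurableT_comp mphi mCS).
Qed.

Lemma price_of_risk_measurable n : (n <= N)%N ->
  measurable_wrt (F n) (price_of_risk m n).
Proof.
have hA := market_assets hm => nN.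
apply: measurable_wrtM; first exact: (muC_adapted hA).
by apply: measurable_wrtV; exact: (sigC_adapted hA).
Qed.

Lemma evA_filt k : (k < N)%N -> F k.+1 (evA m k).
Proof.
move=> kN; have -> : evA m k = db1 m k @^-1` [set 1] by [].
by apply: subG_preimage (db1_measurable kN) _; [exact: filt_sigma|exact: measurable_set1].
Qed.

Lemma evAc_filt k : (k < N)%N -> F k.+1 (evAc m k).
Proof.
move=> kN; have -> : evAc m k = db1 m k @^-1` [set -1] by [].
by apply: subG_preimage (db1_measurable kN) _; [exact: filt_sigma|exact: measurable_set1].
Qed.

Lemma evA_evAc k w : evA m k w -> evAc m k w -> False.
Proof. by rewrite /evA /evAc /= => -> h; have : (1 : R) = -1 by []; lra. Qed.

Lemma indicAcA k w : evA m k w ->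
  (\1_(evA m k) w = 1 :> R) * (\1_(evAc m k) w = 0 :> R).
Proof.
move=> Aw; rewrite !indicE mem_set// memNset//.
by move=> Acw; exact: evA_evAc Aw Acw.
Qed.

Lemma indicAcAc k w : evAc m k w ->
  (\1_(evA m k) w = 0 :> R) * (\1_(evAc m k) w = 1 :> R).
Proof.
move=> Acw; rewrite !indicE (mem_set Acw) memNset//.
by move=> Aw; exact: evA_evAc Aw Acw.
Qed.

Lemma ae_up_down k : (k < N)%N ->
  {ae P, forall w, evA m k w \/ evAc m k w}.
Proof.
move=> kN; have sN := filt_sigma kN.
have mA := subG_measurable sN (evA_filt kN).
have mAc := subG_measurable sN (evAc_filt kN).
have PU : P (evA m k `|` evAc m k) = 1%E.
  transitivity (P (evA m k) + P (evAc m k))%E.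
    apply: measureU => //; apply/seteqP; split => // w [Aw Acw].
    exact: evA_evAc Aw Acw.
  have -> : P (evA m k) = (2^-1)%:E by exact: (walk_up (market_walk hm)).
  have -> : P (evAc m k) = (2^-1)%:E by exact: (walk_down (market_walk hm)).
  by rewrite -EFinD; congr EFin; lra.
exists (~` (evA m k `|` evAc m k)); split => //.
- by apply: measurableC; exact: measurableU.
- by rewrite probability_setC ?PU ?subee//; exact: measurableU.
Qed.

(** Independence of the increments: the conditional probability is the
    constant p. *)
Lemma eqint_indep k E (p : R) : (k < N)%N -> 0 <= p ->
  sigma_db m k E -> measurable E -> P E = p%:E ->
  eqint P (F k) (\1_E) (fun=> p).
Proof.
move=> kN p0 sE mE PE B FB.
have mB := subG_measurable (filt_sigma (ltnW kN)) FB.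
transitivity (P (E `&` B)); first exact: integral_indic.
transitivity (p%:E * P B)%E; last by rewrite -integral_cst.
by rewrite -PE; exact: (walk_indep (market_walk hm) kN sE FB).
Qed.

Lemma sigma_db_db1 k (u : R) : sigma_db m k [set w | db1 m k w = u].
Proof.
by apply: sub_sigma_algebra; exists ord0; exists [set u].
Qed.

Lemma eqint_evA k : (k < N)%N -> eqint P (F k) (\1_(evA m k)) (fun=> 2^-1).
Proof.
move=> kN; apply: eqint_indep => //.
- exact: sigma_db_db1.
- exact: (subG_measurable (filt_sigma kN) (evA_filt kN)).
- exact: (walk_up (market_walk hm)).
Qed.

Lemma eqint_evAc k : (k < N)%N -> eqint P (F k) (\1_(evAc m k)) (fun=> 2^-1).
Proof.
move=> kN; apply: eqint_indep => //.
- exact: sigma_db_db1.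
- exact: (subG_measurable (filt_sigma kN) (evAc_filt kN)).
- exact: (walk_down (market_walk hm)).
Qed.

End market_facts.

Lemma ae_le_integrable {d : measure_display} {T : measurableType d}
    {R : realType} (mu : {measure set T -> \bar R}) (f g : T -> R) :
  measurable_fun setT f -> mu.-integrable setT (EFin \o g) ->
  {ae mu, forall w, `|f w| <= `|g w|} -> mu.-integrable setT (EFin \o f).
Proof.
move=> mf /integrableP[mg finG] fg; apply/integrableP; split.
  exact/measurable_EFinP.
apply: le_lt_trans finG; apply: ae_ge0_le_integral => //.
- by apply: measurableT_comp => //; exact/measurable_EFinP.
- exact: measurableT_comp.
- by apply: filterS fg => w fgw _; rewrite /= lee_fin.
Qed.

(** * Perturbing the optimal strategy at one date *)

Section one_date_optimal.
Context {dsp : measure_display} {T : measurableType dsp} {R : realType}.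
Variables (P : probability T R) (m : market T R).
Variables (x : nat -> T -> R) (pi : @strategy _ T R) (s k : nat).

Definition only_at (pi' : @strategy _ T R) : Prop := forall j,
  (s <= j)%N -> (j < nsteps m)%N -> j <> k -> same_control pi' pi j.

(** The common content of the two optimization problems at the date k, where s
    is the date at which the problem is posed: s = k in the time consistent
    case and s = 0 in the time inconsistent one. Only competitors that deviate
    at the single date k are considered. *)
Record one_date_optimal : Prop := {
  date_le : (s <= k)%N ;
  date_lt : (k < nsteps m)%N ;
  date_admissible : admissible P m x s pi ;
  date_clears : market_clears P m pi ;
  date_fin : forall pi', admissible P m x s pi' -> only_at pi' ->
    {ae P, forall w, expected_utility P m x s (gamma m s) pi' k w \is a fin_num} ;
  start_fin :
    {ae P, forall w, expected_utility P m x s (gamma m s) pi s w \is a fin_num} ;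
  start_opt : forall pi', admissible P m x s pi' -> only_at pi' ->
    {ae P, forall w, (expected_utility P m x s (gamma m s) pi' s w <=
                      expected_utility P m x s (gamma m s) pi s w)%E}
}.

End one_date_optimal.

Section perturbation.
Context {dsp : measure_display} {T : measurableType dsp} {R : realType}.
Variables (P : probability T R) (m : market T R).
Hypothesis hm : market_spec P m.
Local Notation N := (nsteps m).
Local Notation F := (filt m).
Local Notation sqh := (Num.sqrt (step m)).
Variables (x : nat -> T -> R) (pi : @strategy _ T R) (s k : nat).
Hypotheses (hx : adapted m x) (optk : one_date_optimal P m x pi s k).
Local Notation g := (gamma m s).
Local Notation payoff := (fun w => incr (priceD m) k w + dividend m k w).

Let sk : (s <= k)%N := date_le optk.
Let kN : (k < N)%N := date_lt optk.
Let adm : admissible P m x s pi := date_admissible optk.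
Let clear : market_clears P m pi := date_clears optk.
Let fin_at_k := date_fin optk.
Let fin_at_s := start_fin optk.
Let opt_at_s := start_opt optk.
Let sT := @measurable_sub_sigma _ T.
Let sN : (s < N)%N := leq_ltn_trans sk kN.
Let sFk : sub_sigma_algebra_of (F k) := filt_sigma hm (ltnW kN).
Let sFk1 : sub_sigma_algebra_of (F k.+1) := filt_sigma hm kN.
Let sFs : sub_sigma_algebra_of (F s) := filt_sigma hm (ltnW sN).
Let sFN : sub_sigma_algebra_of (F N) := filt_sigma hm (leqnn _).

Lemma payoff_measurable : measurable_wrt (F k.+1) payoff.
Proof.
apply: measurable_wrtD.
  by apply: (incr_measurable hm) => //; exact: (priceD_adapted (market_assets hm)).
apply: (@measurable_wrt_filt _ _ _ _ _ hm k) => //.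
by apply: (dividend_measurable hm); exact: ltnW.
Qed.

(** The change of final wealth when u is added to the wealth in the primary
    asset and v to the number of shares, at the date k. *)
Definition pert (u v : T -> R) : T -> R := fun w =>
  u w * retC m k w + v w * payoff w.

Definition perturb (u v : T -> R) : @strategy _ T R := Strategy
  (fun j => if j == k then fun w => alpha pi k w + u w else alpha pi j)
  (fun j => if j == k then fun w => beta pi k w + v w else beta pi j).

Lemma gain_perturb u v j w : gain m (perturb u v) j w =
  gain m pi j w + (if j == k then pert u v w else 0).
Proof. by rewrite /gain /perturb/=; case: eqP => [->|_]; rewrite /pert; ring. Qed.

Lemma sum_split l (f : nat -> R) : (k < l)%N ->
  \sum_(s <= j < l) f j =
  \sum_(s <= j < k) f j + (f k + \sum_(k.+1 <= j < l) f j).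
Proof.
move=> kl; rewrite (@big_cat_nat _ _ _ k)//=; last exact: ltnW.
by rewrite (big_ltn kl).
Qed.

Lemma wealth_perturb_le u v l w : (l <= k)%N ->
  wealth m x s (perturb u v) l w = wealth m x s pi l w.
Proof.
move=> lk; congr (_ + _); apply: eq_big_nat => j /andP[_ jl].
by rewrite gain_perturb ltn_eqF ?addr0// (leq_trans jl).
Qed.

Lemma wealth_perturb u v l w : (k < l)%N ->
  wealth m x s (perturb u v) l w = wealth m x s pi l w + pert u v w.
Proof.
move=> kl; rewrite /wealth !(sum_split _ kl) gain_perturb eqxx.
rewrite [X in _ + (X + _)](_ : _ = \sum_(s <= j < k) gain m pi j w); last first.
  apply: eq_big_nat => j /andP[_ jl].
  by rewrite gain_perturb ltn_eqF ?addr0.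
rewrite [X in _ + (_ + (_ + X))](_ : _ = \sum_(k.+1 <= j < l) gain m pi j w).
  ring.
apply: eq_big_nat => j /andP[jk _].
by rewrite gain_perturb gtn_eqF ?addr0.
Qed.

Lemma perturb_only_at u v : only_at m pi s k (perturb u v).
Proof. by move=> j _ _ /eqP/negbTE jk; split; rewrite /= jk. Qed.

Lemma pert_measurable u v : measurable_wrt (F k) u -> measurable_wrt (F k) v ->
  measurable_wrt (F k.+1) (pert u v).
Proof.
move=> mu mv; apply: measurable_wrtD; apply: measurable_wrtM.
- exact: (measurable_wrt_filt hm _ _ mu).
- exact: (retC_measurable hm).
- exact: (measurable_wrt_filt hm _ _ mv).
- exact: payoff_measurable.
Qed.

Lemma perturb_admissible u v :
  measurable_wrt (F k) u -> measurable_wrt (F k) v ->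
  ((k.+1 < N)%N -> P.-integrable setT (EFin \o pert u v)) ->
  admissible P m x s (perturb u v).
Proof.
move=> mu mv iuv l slN; have [ma mb iw] := adm slN.
have [sl lN] := andP slN; split.
- rewrite /=; case: eqP ma => [->|_] // ma; exact: measurable_wrtD.
- rewrite /=; case: eqP mb => [->|_] // mb; exact: measurable_wrtD.
- have [lk|kl] := leqP l k.
    rewrite (_ : wealth m x s (perturb u v) l = wealth m x s pi l)//.
    by apply/funext => w; rewrite wealth_perturb_le.
  have -> : EFin \o wealth m x s (perturb u v) l =
      ((EFin \o wealth m x s pi l) \+ (EFin \o pert u v))%E.
    by apply/funext => w; rewrite /= wealth_perturb.
  by apply: integrableD => //; apply: iuv; exact: leq_ltn_trans lN.
Qed.

Lemma gain_measurable j : (s <= j)%N -> (j < N)%N ->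
  measurable_wrt (F j.+1) (gain m pi j).
Proof.
move=> sj jN; have [|ma mb _] := adm (k := j); first by rewrite sj jN.
apply: measurable_wrtD; apply: measurable_wrtM.
- exact: (measurable_wrt_filt hm _ _ ma).
- exact: (retC_measurable hm).
- exact: (measurable_wrt_filt hm _ _ mb).
- apply: measurable_wrtD.
    by apply: (incr_measurable hm) => //; exact: (priceD_adapted (market_assets hm)).
  apply: (@measurable_wrt_filt _ _ _ _ _ hm j) => //.
  by apply: (dividend_measurable hm); exact: ltnW.
Qed.

Lemma sum_gain_measurable a l : (s <= a)%N -> (l <= N)%N ->
  measurable_wrt (F l) (fun w => \sum_(a <= j < l) gain m pi j w).
Proof.
move=> sa lN; apply: measurable_wrt_sum => j; rewrite mem_index_iota => /andP[aj jl].
apply: (@measurable_wrt_filt _ _ _ _ _ hm j.+1) => //.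
by apply: gain_measurable; [exact: leq_trans aj|exact: leq_trans lN].
Qed.

(** A difference of two admissible wealths. *)
Lemma gain_k_integrable : (k.+1 < N)%N -> P.-integrable setT (EFin \o gain m pi k).
Proof.
move=> k1N; have [|_ _ i1] := adm (k := k.+1); first by rewrite (leq_trans sk).
have [|_ _ i0] := adm (k := k); first by rewrite sk.
have -> : EFin \o gain m pi k =
    ((EFin \o wealth m x s pi k.+1) \- (EFin \o wealth m x s pi k))%E.
  apply/funext => w /=; rewrite -EFinB; congr EFin.
  by rewrite /wealth big_nat_recr//=; ring.
exact: integrableB.
Qed.

Definition utility_loss : T -> R := fun w => expR (- g w * final_wealth m x s pi w).
Local Notation V := utility_loss.

Lemma gamma_k_measurable : measurable_wrt (F k) g.
Proof.
apply: (measurable_wrt_filt hm sk (ltnW kN)).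
by apply: (gamma_adapted (market_agent hm)); exact: ltnW.
Qed.

Lemma final_wealth_measurable : measurable_wrt (F N) (final_wealth m x s pi).
Proof.
apply: measurable_wrtD; last exact: (income_measurable (market_agent hm)).
apply: measurable_wrtD; last exact: sum_gain_measurable.
by apply: (measurable_wrt_filt hm (ltnW sN)) => //; apply: hx; exact: ltnW.
Qed.

Lemma nnrv_V : nnrv measurable V.
Proof.
apply: (nnrvW sFN); apply: nnrv_exp; apply: measurable_wrtM.
  apply: measurable_wrtN; apply: (measurable_wrt_filt hm (ltnW kN)) => //.
  exact: gamma_k_measurable.
exact: final_wealth_measurable.
Qed.

Lemma loss_perturb u v w :
  expR (- g w * final_wealth m x s (perturb u v) w) =
  V w * expR (- (g w * pert u v w)).
Proof.
rewrite /utility_loss /final_wealth (wealth_perturb _ _ _ kN) -expRD.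
by congr expR; ring.
Qed.

Lemma expected_utility_perturb u v l :
  expected_utility P m x s g (perturb u v) l =
  cexp P (F l) (fun w => (- (V w * expR (- (g w * pert u v w))))%:E).
Proof. by congr cexp; apply/funext => w; rewrite loss_perturb. Qed.

Lemma nnrv_Vexp Z : measurable_fun setT Z ->
  nnrv measurable (fun w => V w * expR (Z w)).
Proof.
move=> mZ; apply: nnrvM; first exact: nnrv_V.
apply: nnrv_measurable => [|w]; last exact: expR_ge0.
exact: measurableT_comp.
Qed.

Let gpert_measurable u v : measurable_wrt (F k) u -> measurable_wrt (F k) v ->
  measurable_fun setT (fun w => g w * pert u v w).
Proof.
move=> mu mv; apply: (measurable_wrtT sFk1); apply: measurable_wrtM.
  exact: (measurable_wrt_filt hm (leqnSn k) kN gamma_k_measurable).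
exact: pert_measurable.
Qed.

Lemma cfin_V : cfin P (F s) V.
Proof.
by apply: cexpN_cfin => //; exact: nnrv_V.
Qed.

Lemma cfin_perturb u v : measurable_wrt (F k) u -> measurable_wrt (F k) v ->
  ((k.+1 < N)%N -> P.-integrable setT (EFin \o pert u v)) ->
  cfin P (F k) (fun w => V w * expR (- (g w * pert u v w))).
Proof.
move=> mu mv iuv; apply: cexpN_cfin => //.
  apply: nnrv_Vexp; apply: measurable_funN; exact: gpert_measurable.
have := fin_at_k (perturb_admissible mu mv iuv) (perturb_only_at u v).
by rewrite expected_utility_perturb.
Qed.

Lemma opt_perturb u v : measurable_wrt (F k) u -> measurable_wrt (F k) v ->
  ((k.+1 < N)%N -> P.-integrable setT (EFin \o pert u v)) ->
  forall A, F s A -> (\int[P]_(w in A) (V w)%:E <=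
    \int[P]_(w in A) (V w * expR (- (g w * pert u v w)))%:E)%E.
Proof.
move=> mu mv iuv; apply: cexpN_le => //; first exact: nnrv_V.
  apply: nnrv_Vexp; apply: measurable_funN; exact: gpert_measurable.
have := opt_at_s (perturb_admissible mu mv iuv) (perturb_only_at u v).
by rewrite expected_utility_perturb.
Qed.

Let on (c : R) (A : set T) (u : T -> R) : T -> R := fun w => c * (\1_A w * u w).

Let on_measurable c A u : F k A -> measurable_wrt (F k) u ->
  measurable_wrt (F k) (on c A u).
Proof.
move=> FA mu; apply: measurable_wrtM; first exact: measurable_wrt_cst.
by apply: measurable_wrtM => //; exact: measurable_wrt_indic.
Qed.

Let pert_on c A u v w : pert (on c A u) (on c A v) w = c * (\1_A w * pert u v w).
Proof. by rewrite /pert /on; ring. Qed.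

(** The payoff of the derivative need not be integrable a priori. Since one
    share is held, it is the difference of the integrable gain of the optimal
    strategy and of its position in the primary asset; both are controlled on
    an event where the coefficients are bounded. *)
Lemma pert_integrable (c b : R) (u v : T -> R) A : 0 <= b ->
  measurable_wrt (F k) u -> measurable_wrt (F k) v -> F k A ->
  (forall w, A w -> [/\ `|alpha pi k w| <= b, `|muC m k w| <= b,
     `|sigC m k w| <= b, `|u w| <= b & `|v w| <= b]) ->
  (k.+1 < N)%N -> P.-integrable setT (EFin \o pert (on c A u) (on c A v)).
Proof.
move=> b0 mu mv FA bnd k1N.
have h0 := ltW (step_gt0 hm); have s0 := ltW (sqh_gt0 hm).
pose K := `|c| * ((b + b * b) * (b * step m + b * sqh)).
apply: (@ae_le_integrable _ _ _ P _ (fun w => K + (`|c| * b) * `|gain m pi k w|)).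
- by apply: (measurable_wrtT sFk1); apply: pert_measurable; exact: on_measurable.
- have -> : EFin \o (fun w => K + `|c| * b * `|gain m pi k w|) =
      ((EFin \o cst K) \+ (fun w => (`|c| * b)%:E * (EFin \o (Num.norm \o gain m pi k)) w))%E.
    by apply/funext => w; rewrite /= EFinD EFinM.
  apply: integrableD => //; first exact: finite_measure_integrable_cst.
  by apply: integrableZl => //; apply: integrable_norm => //; exact: gain_k_integrable.
apply: filterS2 (clear kN) (ae_up_down hm kN) => w b1 ud.
apply: le_trans (ler_norm _); rewrite pert_on normrM.
rewrite /K -mulrA -mulrDr ler_wpM2l// indicE.
have [/set_mem Aw|_] := boolP (w \in A); last first.
  by rewrite mul0r normr0 addr_ge0// mulr_ge0// ?addr_ge0// mulr_ge0.
rewrite mul1r; have [ba bm bs bu bv] := bnd _ Aw.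
have -> : pert u v w = (u w - v w * alpha pi k w) * retC m k w + v w * gain m pi k w.
  by rewrite /pert /gain b1; ring.
apply: le_trans (ler_normD _ _) _; rewrite !normrM lerD//.
  apply: ler_pM => //.
    by apply: le_trans (ler_normB _ _) _; rewrite lerD// normrM ler_pM.
  apply: le_trans (ler_normD _ _) _; rewrite lerD//.
    by rewrite normrM (ger0_norm h0) ler_wpM2r.
  have db : `|db1 m k w| = 1.
    by case: ud => ->; rewrite ?normrN normr1.
  by rewrite !normrM db mulr1 (ger0_norm s0) ler_wpM2r.
by rewrite ler_wpM2r.
Qed.

(** The first-order condition at the date k in the direction of an arbitrary
    position (u, v). The exhaustion by the events where all the coefficients
    are bounded makes the perturbations admissible. *)
Lemma foc_pert (u v : T -> R) (Z := fun w => g w * pert u v w) :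
  measurable_wrt (F k) u -> measurable_wrt (F k) v ->
  [/\ cfin P (F k) (fun w => V w * Num.max (Z w) 0),
      cfin P (F k) (fun w => V w * Num.max (- Z w) 0) &
      eqint P (F k) (fun w => V w * Num.max (Z w) 0)
                    (fun w => V w * Num.max (- Z w) 0)].
Proof.
move=> mu mv.
have [ma _ _] : [/\ measurable_wrt (F k) (alpha pi k), measurable_wrt (F k) (beta pi k) &
    P.-integrable setT (EFin \o wealth m x s pi k)] by apply: adm; rewrite sk.
have hA := market_assets hm.
have mmu : measurable_wrt (F k) (muC m k) by apply: (muC_adapted hA); exact: ltnW.
have msig : measurable_wrt (F k) (sigC m k) by apply: (sigC_adapted hA); exact: ltnW.
pose q w := `|alpha pi k w| + `|muC m k w| + `|sigC m k w| + `|u w| + `|v w|.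
have mnorm (f : T -> R) : measurable_wrt (F k) f -> measurable_wrt (F k) (fun w => `|f w|).
  by move=> mf; case: (nnrv_norm mf).
have mq : measurable_wrt (F k) q.
  by do 4 (apply: measurable_wrtD; last exact: mnorm); exact: mnorm.
have cB := exhaustion_ler P sFk mq.
have expE e A w : e * (\1_A w * Z w) = - (g w * pert (on (- e) A u) (on (- e) A v) w).
  by rewrite pert_on /Z; ring.
have int_on n A e : F k A -> A `<=` [set w | `|q w| <= n%:R] -> (k.+1 < N)%N ->
    P.-integrable setT (EFin \o pert (on e A u) (on e A v)).
  move=> FA AB; apply: (@pert_integrable _ n%:R) => // w /AB/=.
  move=> /(le_trans (ler_norm _)); rewrite /q.
  have := normr_ge0 (alpha pi k w); have := normr_ge0 (muC m k w).
  have := normr_ge0 (sigC m k w); have := normr_ge0 (u w); have := normr_ge0 (v w).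
  by move=> *; split; lra.
apply: (first_order_condition sFs sFk _ nnrv_V _ cB cfin_V).
- exact: (filt_incr hm sk (ltnW kN)).
- exact: gpert_measurable.
- move=> n A e FA AB; under eq_fun do rewrite expE.
  by apply: cfin_perturb; [exact: on_measurable|exact: on_measurable|exact: int_on AB].
- move=> n A e FA AB A' FA'; under [leRHS]eq_integral do rewrite expE.
  by apply: opt_perturb FA'; [exact: on_measurable|exact: on_measurable|exact: int_on AB].
Qed.

End perturbation.

(** * The recursive formulas *)

Section pricing_formulas_measurable.
Context {dsp : measure_display} {T : measurableType dsp} {R : realType}.
Variables (P : probability T R) (m : market T R).
Hypothesis hm : market_spec P m.
Local Notation N := (nsteps m).
Local Notation F := (filt m).
Implicit Types gp a : nat -> T -> R.

Lemma gain1_measurable a j : (j < N)%N -> measurable_wrt (F j) (a j) ->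
  measurable_wrt (F j.+1) (gain1 m a j).
Proof.
move=> jN ma; apply: measurable_wrtD.
  apply: measurable_wrtD.
    apply: measurable_wrtM; last exact: (retC_measurable hm).
    exact: (measurable_wrt_filt hm (leqnSn j) jN ma).
  by apply: (incr_measurable hm) => //; exact: (priceD_adapted (market_assets hm)).
apply: (measurable_wrt_filt hm (leqnSn j) jN).
by apply: (dividend_measurable hm); exact: ltnW.
Qed.

Variables (gp a : nat -> T -> R).
Hypothesis mgp : forall k, (k < N)%N -> measurable_wrt (F k) (gp k).
Hypothesis ma : forall k, (k < N)%N -> measurable_wrt (F k) (a k).

Lemma future1_measurable k : (k < N)%N -> measurable_wrt (F N)
  (fun w => \sum_(k.+1 <= j < N) gain1 m a j w + income m w).
Proof.
move=> kN; apply: measurable_wrtD; last exact: (income_measurable (market_agent hm)).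
apply: measurable_wrt_sum => j; rewrite mem_index_iota => /andP[_ jN].
apply: (measurable_wrt_filt hm (k := j.+1)) => //.
by apply: gain1_measurable => //; exact: ma.
Qed.

Lemma loss1_measurable k : (k < N)%N -> measurable_wrt (F N) (fun w =>
  expR (- gp k w * (\sum_(k.+1 <= j < N) gain1 m a j w + income m w))).
Proof.
move=> kN; apply: measurable_wrt_comp; first by [].
apply: measurable_wrtM; last exact: future1_measurable.
by apply: measurable_wrtN; apply: (measurable_wrt_filt hm (ltnW kN)) => //; exact: mgp.
Qed.

Lemma weight_measurable k : (k < N)%N -> nnrv (F k.+1) (weight P m gp a k).
Proof.
move=> kN; have mgk : measurable_wrt (F k.+1) (gp k).
  by apply: (measurable_wrt_filt hm (leqnSn k)) => //; exact: mgp.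
apply: nnrv_exp; apply: measurable_wrtM; first exact: measurable_wrtN.
apply: measurable_wrtD; first exact: (priceD_adapted (market_assets hm)).
apply: measurable_wrtM.
  by apply: measurable_wrtN; exact: measurable_wrtV.
apply: measurable_wrt_comp; first exact: measurable_ln.
apply: cexpr_measurable; first exact: (filt_sigma hm).
by apply: (measurable_wrtT (filt_sigma hm (leqnn N))); exact: loss1_measurable.
Qed.

Lemma cexpr_on_measurable k X E : (k < N)%N -> measurable E -> measurable_fun setT X ->
  measurable_wrt (F k) (cexpr_on P (F k) X E).
Proof.
move=> kN mE mX; have sk := filt_sigma hm (ltnW kN).
apply: measurable_wrtM; first by apply: cexpr_measurable => //; exact: measurable_funM.
by apply: measurable_wrtV; apply: cexpr_measurable.
Qed.

Lemma weightA_measurable k : (k < N)%N -> measurable_wrt (F k) (weightA P m gp a k).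
Proof.
move=> kN; have sk1 := filt_sigma hm kN; apply: cexpr_on_measurable => //.
  exact: (subG_measurable sk1 (evA_filt hm kN)).
exact: (nnrvT sk1 (weight_measurable kN)).
Qed.

Lemma weightAc_measurable k : (k < N)%N -> measurable_wrt (F k) (weightAc P m gp a k).
Proof.
move=> kN; have sk1 := filt_sigma hm kN; apply: cexpr_on_measurable => //.
  exact: (subG_measurable sk1 (evAc_filt hm kN)).
exact: (nnrvT sk1 (weight_measurable kN)).
Qed.

Lemma alpha_formula_measurable k : (k < N)%N ->
  measurable_wrt (F k) (alpha_formula P m gp a k).
Proof.
move=> kN; have mrh : measurable_wrt (F k)
    (fun w => price_of_risk m k w * Num.sqrt (step m)).
  apply: measurable_wrtM; last exact: measurable_wrt_cst.
  by apply: (price_of_risk_measurable hm); exact: ltnW.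
have mden : measurable_wrt (F k)
    (fun w => (2 * gp k w * sigC m k w * Num.sqrt (step m))^-1).
  apply: measurable_wrtV; apply: measurable_wrtM; last exact: measurable_wrt_cst.
  apply: measurable_wrtM; last by apply: (sigC_adapted (market_assets hm)); exact: ltnW.
  by apply: measurable_wrtM; [exact: measurable_wrt_cst|exact: mgp].
have m1 := @measurable_wrt_cst _ _ _ (F k) (1 : R).
apply: measurable_wrtD; apply: measurable_wrtM => //;
    apply: measurable_wrt_comp; try exact: measurable_ln.
  apply: measurable_wrtM; first exact: measurable_wrtD.
  by apply: measurable_wrtV; exact: measurable_wrtB.
apply: measurable_wrtM; first exact: weightA_measurable.
by apply: measurable_wrtV; exact: weightAc_measurable.
Qed.

End pricing_formulas_measurable.

Section alpha_sol_measurable.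
Context {dsp : measure_display} {T : measurableType dsp} {R : realType}.
Variables (P : probability T R) (m : market T R) (gp : nat -> T -> R).
Hypothesis hm : market_spec P m.
Hypothesis mgp : forall k, (k < nsteps m)%N -> measurable_wrt (filt m k) (gp k).

Lemma alpha_sol_measurable k : (k < nsteps m)%N ->
  measurable_wrt (filt m k) (alpha_sol P m gp k).
Proof.
rewrite /alpha_sol; move: {2}(nsteps m) => n.
elim: n k => [|i IH] k kN /=; first exact: measurable_wrt_cst.
by case: eqP => _; [apply: alpha_formula_measurable|exact: IH].
Qed.

End alpha_sol_measurable.

(** Solving the first-order condition in the primary asset for the position.
    The factors 1/2 are the conditional probabilities of the two moves, which
    cancel. *)
Lemma alpha_algebra {R : realType} (g al sig sh rh a c : R) :
  0 < g -> sig != 0 -> 0 < sh -> 0 < rh -> rh < 1 -> 0 < a -> 0 < c ->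
  expR (- (g * al * sig * sh)) * ((1 + rh) * a) =
  expR (g * al * sig * sh) * ((1 - rh) * c) ->
  al = (2 * g * sig * sh)^-1 * ln ((1 + rh) / (1 - rh)) +
       (2 * g * sig * sh)^-1 * ln (a / 2^-1 / (c / 2^-1)).
Proof.
move=> g0 sig0 sh0 rh0 rh1 a0 c0 E; set t := g * al * sig * sh in E.
have r1 : 0 < 1 - rh by lra.
have r2 : 0 < 1 + rh by lra.
have e0 := expR_gt0 t.
have e1 : expR (- t) = (expR t)^-1 by rewrite expRN.
rewrite -mulrDr -lnM ?posrE ?divr_gt0//.
have -> : (1 + rh) / (1 - rh) * (a / 2^-1 / (c / 2^-1)) = expR (t + t).
  rewrite expRD; move: E; rewrite e1 => E.
  have E' : (1 + rh) * a = expR t * expR t * ((1 - rh) * c).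
    rewrite -mulrA -E mulrA mulfV ?mul1r//; exact: lt0r_neq0.
  have -> : (1 + rh) / (1 - rh) * (a / 2^-1 / (c / 2^-1)) =
     ((1 + rh) * a) / ((1 - rh) * c).
    by field; rewrite !lt0r_neq0.
  by rewrite E' mulfK// mulf_neq0// lt0r_neq0.
by rewrite expRK /t; field; rewrite sig0 !lt0r_neq0.
Qed.

(** * First-order conditions and the one-period kernel *)

Section kernel_spec.
Context {dsp : measure_display} {T : measurableType dsp} {R : realType}.
Variables (P : probability T R) (m : market T R) (Lam : T -> R) (k : nat).
Local Notation payoff := (fun w => incr (priceD m) k w + dividend m k w).

(** The properties of a kernel on which the change of measure rests. That the
    payoff is fair is stated with its positive and negative parts because it
    need not be integrable. *)
Record kernel_spec : Prop := {
  kernel_nnrv : nnrv (filt m k.+1) Lam ;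
  kernel_gt0 : {ae P, forall w, 0 < Lam w} ;
  kernel_one : eqint P (filt m k) Lam (fun=> 1) ;
  kernel_cfinp : cfin P (filt m k) (fun w => Lam w * Num.max (payoff w) 0) ;
  kernel_cfinn : cfin P (filt m k) (fun w => Lam w * Num.max (- payoff w) 0) ;
  kernel_fair : eqint P (filt m k) (fun w => Lam w * Num.max (payoff w) 0)
                                   (fun w => Lam w * Num.max (- payoff w) 0)
}.

End kernel_spec.

Section one_date.
Context {dsp : measure_display} {T : measurableType dsp} {R : realType}.
Variables (P : probability T R) (m : market T R).
Hypothesis hm : market_spec P m.
Local Notation N := (nsteps m).
Local Notation F := (filt m).
Local Notation sqh := (Num.sqrt (step m)).
Variables (x : nat -> T -> R) (pi : @strategy _ T R) (s k : nat).
Hypotheses (hx : adapted m x) (optk : one_date_optimal P m x pi s k).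
Local Notation g := (gamma m s).
Local Notation payoff := (fun w => incr (priceD m) k w + dividend m k w).
Local Notation V := (utility_loss m x pi s).

(* the risk aversions entering the recursive formulas *)
Variable gp : nat -> T -> R.
Hypothesis gpk : gp k = g.
Hypothesis mgp : forall j, (j < N)%N -> measurable_wrt (F j) (gp j).
Local Notation a := (alpha_sol P m gp).
Hypothesis later : forall j, (k < j)%N -> (j < N)%N ->
  {ae P, forall w, alpha pi j w = a j w}.

Let sT := @measurable_sub_sigma _ T.
Let sk : (s <= k)%N := date_le optk.
Let kN : (k < N)%N := date_lt optk.
Let adm : admissible P m x s pi := date_admissible optk.
Let sN : (s < N)%N := leq_ltn_trans sk kN.
Let sFk : sub_sigma_algebra_of (F k) := filt_sigma hm (ltnW kN).
Let sFk1 : sub_sigma_algebra_of (F k.+1) := filt_sigma hm kN.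
Let sFN : sub_sigma_algebra_of (F N) := filt_sigma hm (leqnn _).
Let Fk_k1 : F k `<=` F k.+1 := filt_incr hm (leqnSn k) kN.
Let ma j (jN : (j < N)%N) : measurable_wrt (F j) (a j) :=
  alpha_sol_measurable hm mgp jN.

(* theta db1 is g times the random part of the gain on the primary asset; U and
   hW gather the part of the loss that is not yet known at t_k, without and with
   the price D at t_(k+1); f0 is the part already known at t_k *)
Let rh w := price_of_risk m k w * sqh.
Let theta w := g w * alpha pi k w * sigC m k w * sqh.
Let iA : T -> R := \1_(evA m k).
Let iAc : T -> R := \1_(evAc m k).
Let future w := \sum_(k.+1 <= j < N) gain m pi j w + income m w.
Let U w := expR (- g w * future w).
Let hW w := expR (- g w * priceD m k.+1 w) * U w.
Let W := weight P m gp a k.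
Let f0 w := expR (- g w * (wealth m x s pi k w - priceD m k w + dividend m k w)) *
  expR (- (theta w * rh w)).

Let mg : measurable_wrt (F k) g := gamma_k_measurable hm optk.

Let wealth_measurable : measurable_wrt (F k) (wealth m x s pi k).
Proof.
apply: measurable_wrtD; last by apply: (sum_gain_measurable hm optk) => //; exact: ltnW.
by apply: (measurable_wrt_filt hm sk (ltnW kN)); apply: hx; exact: ltnW.
Qed.

Let rh_measurable : measurable_wrt (F k) rh.
Proof.
apply: measurable_wrtM; last exact: measurable_wrt_cst.
by apply: (price_of_risk_measurable hm); exact: ltnW.
Qed.

Let alpha_measurable : measurable_wrt (F k) (alpha pi k).
Proof. by have [|] := adm (k := k); first by rewrite sk. Qed.

Let theta_measurable : measurable_wrt (F k) theta.
Proof.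
apply: measurable_wrtM; last exact: measurable_wrt_cst.
apply: measurable_wrtM; last by apply: (sigC_adapted (market_assets hm)); exact: ltnW.
exact: measurable_wrtM.
Qed.

Let nexp G (f : T -> R) : measurable_wrt G f -> nnrv G (fun w => expR (f w)) :=
  @nnrv_exp _ _ _ G f.

Let nf0 : nnrv (F k) f0.
Proof.
apply: nnrvM; apply: nexp; last by apply: measurable_wrtN; exact: measurable_wrtM.
apply: measurable_wrtM; first exact: measurable_wrtN.
apply: measurable_wrtD; last by apply: (dividend_measurable hm); exact: ltnW.
apply: measurable_wrtB => //.
by apply: (priceD_adapted (market_assets hm)); exact: ltnW.
Qed.

Let niA : nnrv (F k.+1) iA := nnrv_indic sFk1 (evA_filt hm kN).
Let niAc : nnrv (F k.+1) iAc := nnrv_indic sFk1 (evAc_filt hm kN).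
Let nV : nnrv measurable V := nnrv_V hm hx optk.
Let up (f : T -> R) (nf : nnrv (F k) f) : nnrv (F k.+1) f :=
  nnrv_sub sFk sFk1 Fk_k1 nf.

Let ae_rh : {ae P, forall w, [/\ 0 < rh w, rh w < 1 & sigC m k w != 0]}.
Proof.
have hA := market_assets hm.
apply: filterS2 (price_of_risk_gt0 hA kN) (price_of_risk_small hA kN) => w r0 r1.
split => //; first by rewrite mulr_gt0// (sqh_gt0 hm).
by apply: contraTneq r0 => s0; rewrite /price_of_risk s0 invr0 mulr0 ltxx.
Qed.

Let ae_g : {ae P, forall w, 0 < g w}.
Proof. exact: (gamma_gt0 (market_agent hm) (ltnW sN)). Qed.

Let final_wealthE w : final_wealth m x s pi w =
  wealth m x s pi k w + gain m pi k w + future w.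
Proof.
rewrite /final_wealth /wealth /future.
by rewrite (sum_split optk (fun j => gain m pi j w) kN); ring.
Qed.

(* one share is held and db1 only takes the values 1 and -1 *)
Let V_split : {ae P, forall w,
  V w = f0 w * (expR (- theta w) * iA w + expR (theta w) * iAc w) * hW w}.
Proof.
apply: filterS3 (date_clears optk kN) (ae_up_down hm kN) ae_rh.
move=> w b1 ud [r0 r1 s0].
have retE : theta w * rh w = g w * alpha pi k w * (muC m k w * step m).
  rewrite /theta /rh /price_of_risk.
  have hE : step m = sqh * sqh.
    by rewrite -expr2 sqr_sqrtr// ltW// (step_gt0 hm).
  by rewrite [X in _ = _ * (_ * X)]hE; field.
have VE : V w = f0 w * expR (- (theta w * db1 m k w)) * hW w.
  rewrite /utility_loss /f0 /hW /U -!expRD final_wealthE retE /theta /gain b1.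
  by congr expR; rewrite /incr /retC; ring.
rewrite VE; congr (_ * _ * _); rewrite /iA /iAc.
case: ud => [Aw|Acw].
  by rewrite !(indicAcA Aw) (_ : db1 m k w = 1)// !mulr1 mulr0 addr0.
by rewrite !(indicAcAc Acw) (_ : db1 m k w = -1)// mulrN1 opprK mulr1 mulr0 add0r.
Qed.

Let mfuture : measurable_wrt (F N) future.
Proof.
apply: measurable_wrtD; last exact: (income_measurable (market_agent hm)).
by apply: (sum_gain_measurable hm optk) => //; exact: leqW.
Qed.

Let nU : nnrv measurable U.
Proof.
apply: (nnrvW sFN); apply: nexp; apply: measurable_wrtM => //.
by apply: measurable_wrtN; exact: (measurable_wrt_filt hm (ltnW kN) (leqnn N) mg).
Qed.

Let nexpD : nnrv (F k.+1) (fun w => expR (- g w * priceD m k.+1 w)).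
Proof.
apply: nexp; apply: measurable_wrtM.
  by apply: measurable_wrtN; exact: (measurable_wrt_filt hm (leqnSn k) kN mg).
exact: (priceD_adapted (market_assets hm)).
Qed.

Let nhW : nnrv measurable hW.
Proof. by apply: nnrvM => //; exact: nnrvW nexpD. Qed.

Let nW : nnrv (F k.+1) W := weight_measurable hm mgp ma kN.

Let W_gt0 w : 0 < W w. Proof. exact: expR_gt0. Qed.

(* U is V divided by a variable known at t_(k+1) *)
Let cfin_U : cfin P (F k.+1) U.
Proof.
have nE : nnrv (F k.+1)
    (fun w => expR (g w * (wealth m x s pi k w + gain m pi k w))).
  apply: nexp; apply: measurable_wrtM.
    exact: (measurable_wrt_filt hm (leqnSn k) kN mg).
  apply: measurable_wrtD; last exact: (gain_measurable hm optk).
  exact: (measurable_wrt_filt hm (leqnSn k) kN wealth_measurable).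
have -> : U = (fun w => expR (g w * (wealth m x s pi k w + gain m pi k w)) * V w).
  apply/funext => w; rewrite /U /utility_loss -expRD final_wealthE.
  by congr expR; ring.
apply: (cfin_mul sFk1 nE nV).
apply: cfin_sub (cfin_V hm hx optk).
by apply: (filt_incr hm) => //; exact: leqW.
Qed.

Let Uv := cexpv P (F k.+1) U.

Let nUv : nnrv (F k.+1) Uv := nnrv_cexpv P sFk1 nU.

Let eqUv : eqint P (F k.+1) U Uv := eqint_cexpv sFk1 nU cfin_U.

Let n1 (G : set (set T)) : nnrv G (fun=> 1 : R) := nnrv_cst G ler01.

Let Uv_gt0 : {ae P, forall w, 0 < Uv w}.
Proof.
have UU : {ae P, forall w, U w = 0 -> (fun=> 1 : R) w = 0}.
  by apply: aeW => w U0; have := expR_gt0 (- g w * future w); rewrite -/(U w) U0 ltxx.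
have := eqint_eq0 sFk1 nU nUv (n1 _) (n1 _) eqUv (fun _ _ => erefl) UU.
apply: filterS => w h; rewrite lt0r; case: nUv => _ /(_ w) ->; rewrite andbT.
by apply/eqP => /h/eqP; rewrite oner_eq0.
Qed.

(* the certainty equivalent is defined so that exponentiating it gives back
   the conditional expectation of the loss; alpha has its formula at the later
   dates and one share is held, so this loss is U *)
Let WE : {ae P, forall w, W w = expR (- g w * priceD m k.+1 w) * Uv w}.
Proof.
pose U' w := expR (- gp k w * (\sum_(k.+1 <= j < N) gain1 m a j w + income m w)).
have nU' : nnrv measurable U'.
  apply: (nnrvW sFN); split; first exact: (loss1_measurable hm mgp ma kN).
  by move=> w; exact: expR_ge0.
have aeU : {ae P, forall w, U' w = U w}.
  have : {ae P, forall w j, (k < j < N)%N -> alpha pi j w = a j w /\ beta pi j w = 1}.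
    apply: ae_foralln => j; have [/andP[kj jN]|nkj] := boolP (k < j < N)%N.
      by apply: filterS2 (later kj jN) (date_clears optk jN) => w.
    exact: aeW.
  apply: filterS => w aw; rewrite /U' /U gpk /future.
  have -> // : \sum_(k.+1 <= j < N) gain1 m a j w =
               \sum_(k.+1 <= j < N) gain m pi j w.
  apply: eq_big_nat => j kj; have [aE bE] := aw _ kj.
  by rewrite /gain1 /gain aE bE; ring.
have eqU' : eqint P (F k.+1) U' Uv.
  by apply: eqint_trans eqUv; exact: eqint_ae.
apply: filterS3 (cexpr_ae sFk1 nU' nUv eqU') Uv_gt0 ae_g => w cE u0 g0.
rewrite /W /weight /certainty -/U' cE gpk mulrDr expRD; congr (_ * _).
by rewrite mulrA mulrNN mulfV ?lt0r_neq0// mul1r lnK// posrE.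
Qed.

Let eqW : eqint P (F k.+1) hW W.
Proof.
apply: (@eqint_trans _ _ _ _ _ (fun w => expR (- g w * priceD m k.+1 w) * Uv w)).
  by apply: eqint_mul => //; exact: nnrvW nUv.
apply: eqint_ae => //.
- by apply: (nnrvW sFk1); exact: nnrvM.
- exact: nnrvW nW.
- by apply: filterS WE => w ->.
Qed.

Let eqW_mul f : nnrv (F k.+1) f ->
  eqint P (F k) (fun w => f w * hW w) (fun w => f w * W w).
Proof.
move=> nf; apply: (eqint_sub Fk_k1); apply: eqint_mul => //; exact: nnrvW nW.
Qed.

(* V is at least f0 min(e^theta, e^-theta) hW, and f0, theta are known at t_k *)
Let cfin_hW : cfin P (F k) hW.
Proof.
pose C w := (expR (theta w) + expR (- theta w)) * (f0 w)^-1.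
have nC : nnrv (F k) C.
  apply: nnrvM; first by apply: nnrvD; apply: nexp => //; exact: measurable_wrtN.
  split; first by apply: measurable_wrtV; case: nf0.
  by move=> w; rewrite invr_ge0; case: nf0.
have finCV : cfin P (F k) (fun w => C w * V w).
  apply: (cfin_mul sFk nC nV); apply: cfin_sub (cfin_V hm hx optk).
  exact: (filt_incr hm sk (ltnW kN)).
apply: cfin_le finCV => //; first by apply: nnrvM => //; exact: nnrvW nC.
apply: filterS2 V_split (ae_up_down hm kN) => w -> ud.
have f0_gt0 : 0 < f0 w by rewrite mulr_gt0 ?expR_gt0.
have -> : C w * (f0 w * (expR (- theta w) * iA w + expR (theta w) * iAc w) * hW w) =
    ((expR (theta w) + expR (- theta w)) *
     (expR (- theta w) * iA w + expR (theta w) * iAc w)) * hW w.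
  by rewrite /C; field; rewrite lt0r_neq0.
rewrite ler_peMl//; first by case: nhW.
have e1 : expR (theta w) * expR (- theta w) = 1 by rewrite -expRD subrr expR0.
have := expR_gt0 (theta w); have := expR_gt0 (- theta w).
rewrite /iA /iAc; case: ud => [Aw|Acw].
  by rewrite !(indicAcA Aw); nra.
by rewrite !(indicAcAc Acw); nra.
Qed.

Let cfin_W : cfin P (F k) W.
Proof. by apply: cfin_eqint cfin_hW; exact: eqint_sub Fk_k1 eqW. Qed.

Let cfin_Wi i : nnrv (F k.+1) i -> (forall w, i w <= 1) ->
  cfin P (F k) (fun w => W w * i w).
Proof.
move=> ni i1; apply: cfin_le cfin_W => //.
- by apply: (nnrvW sFk1); exact: nnrvM.
- exact: nnrvW nW.
- by apply: aeW => w; rewrite ler_piMr// ltW.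
Qed.

(* twice pA and twice pAc are the two conditional expectations in the formula
   for alpha *)
Let pA := cexpv P (F k) (fun w => W w * iA w).
Let pAc := cexpv P (F k) (fun w => W w * iAc w).

Let nWA : nnrv measurable (fun w => W w * iA w) := nnrvW sFk1 (nnrvM nW niA).
Let nWAc : nnrv measurable (fun w => W w * iAc w) := nnrvW sFk1 (nnrvM nW niAc).
Let npA : nnrv (F k) pA := nnrv_cexpv P sFk nWA.
Let npAc : nnrv (F k) pAc := nnrv_cexpv P sFk nWAc.

Let indic_le1 (E : set T) w : \1_E w <= 1 :> R.
Proof. by rewrite indicE; case: (w \in E). Qed.

Let eq_pA : eqint P (F k) (fun w => W w * iA w) pA :=
  eqint_cexpv sFk nWA (cfin_Wi niA (indic_le1 _)).
Let eq_pAc : eqint P (F k) (fun w => W w * iAc w) pAc :=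
  eqint_cexpv sFk nWAc (cfin_Wi niAc (indic_le1 _)).

Let half_gt0 : 0 < 2^-1 :> R. Proof. by rewrite invr_gt0. Qed.
Let nhalf (G : set (set T)) : nnrv G (fun=> 2^-1 : R) := nnrv_cst G (ltW half_gt0).

Let p_gt0 (i : T -> R) : nnrv (F k.+1) i -> (forall w, i w <= 1) ->
  eqint P (F k) i (fun=> 2^-1) ->
  {ae P, forall w, 0 < cexpv P (F k) (fun w => W w * i w) w}.
Proof.
move=> ni i1 eqi; have nWi := nnrvW sFk1 (nnrvM nW ni).
have np := nnrv_cexpv P sFk nWi.
have Wi : {ae P, forall w, W w * i w = 0 -> i w = 0}.
  by apply: aeW => w /eqP; rewrite mulf_eq0 gt_eqF// => /eqP.
have := eqint_eq0 sFk nWi np (nnrvW sFk1 ni) (nhalf _)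
  (eqint_cexpv sFk nWi (cfin_Wi ni i1)) eqi Wi.
apply: filterS => w h; rewrite lt0r; case: np => _ /(_ w) ->; rewrite andbT.
by apply/eqP => /h/eqP; rewrite gt_eqF.
Qed.

Let pA_gt0 : {ae P, forall w, 0 < pA w} :=
  p_gt0 niA (indic_le1 _) (eqint_evA hm kN).
Let pAc_gt0 : {ae P, forall w, 0 < pAc w} :=
  p_gt0 niAc (indic_le1 _) (eqint_evAc hm kN).

Let weightAE : {ae P, forall w, weightA P m gp a k w = pA w / 2^-1}.
Proof.
apply: filterS2 (cexpr_ae sFk nWA npA eq_pA)
  (cexpr_ae sFk (nnrvW sFk1 niA) (nhalf _) (eqint_evA hm kN)) => w E1 E2.
by rewrite /weightA /cexpr_on [X in X / _]E1 [X in _ / X]E2.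
Qed.

Let weightAcE : {ae P, forall w, weightAc P m gp a k w = pAc w / 2^-1}.
Proof.
apply: filterS2 (cexpr_ae sFk nWAc npAc eq_pAc)
  (cexpr_ae sFk (nnrvW sFk1 niAc) (nhalf _) (eqint_evAc hm kN)) => w E1 E2.
by rewrite /weightAc /cexpr_on [X in X / _]E1 [X in _ / X]E2.
Qed.

Let norm_rh w : 0 < rh w -> rh w < 1 ->
  (`|1 + rh w| = 1 + rh w) * (`|1 - rh w| = 1 - rh w).
Proof. by move=> r0 r1; rewrite !gtr0_norm ?subr_gt0 ?addr_gt0. Qed.

Let nnorm G (f : T -> R) : measurable_wrt G f -> nnrv G (fun w => `|f w|) :=
  @nnrv_norm _ _ _ G f.

(* The first-order condition in the primary asset. In units of the volatility
   the return is 1 + rh on evA and -(1 - rh) on evAc, so its positive and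
   negative parts are carried by the two events; dividing by f0 and
   conditioning hW at t_(k+1) leaves pA and pAc. *)
Let balance_A : {ae P, forall w, expR (- theta w) * ((1 + rh w) * pA w) =
                                 expR (theta w) * ((1 - rh w) * pAc w)}.
Proof.
(* the position whose return, multiplied by g, is rh + db1 *)
pose u w := (g w * sigC m k w * sqh)^-1.
have msig : measurable_wrt (F k) (sigC m k).
  by apply: (sigC_adapted (market_assets hm)); exact: ltnW.
have mu : measurable_wrt (F k) u.
  apply: measurable_wrtV; apply: measurable_wrtM; last exact: measurable_wrt_cst.
  exact: measurable_wrtM.
have [_ _ foc] := foc_pert hm hx optk mu (@measurable_wrt_cst _ _ _ (F k) 0).
pose up1 w := `|1 + rh w|; pose dn1 w := `|1 - rh w|.
have nup : nnrv (F k) up1.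
  by apply: nnorm; apply: measurable_wrtD => //; exact: measurable_wrt_cst.
have ndn : nnrv (F k) dn1.
  by apply: nnorm; apply: measurable_wrtB => //; exact: measurable_wrt_cst.
pose XA w := (f0 w)^-1 * (V w * Num.max (g w * pert m k u (fun=> 0) w) 0).
pose XAc w := (f0 w)^-1 * (V w * Num.max (- (g w * pert m k u (fun=> 0) w)) 0).
have mZ : measurable_wrt (F k.+1) (fun w => g w * pert m k u (fun=> 0) w).
  apply: measurable_wrtM; first exact: (measurable_wrt_filt hm (leqnSn k) kN mg).
  by apply: (pert_measurable hm optk) => //; exact: measurable_wrt_cst.
have nmaxp : nnrv measurable (fun w => V w * Num.max (g w * pert m k u (fun=> 0) w) 0).
  by apply: nnrvM => //; apply: (nnrvW sFk1); exact: nnrv_max.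
have nmaxn : nnrv measurable (fun w => V w * Num.max (- (g w * pert m k u (fun=> 0) w)) 0).
  apply: nnrvM => //; apply: (nnrvW sFk1); apply: nnrv_max; exact: measurable_wrtN.
have nif0 : nnrv (F k) (fun w => (f0 w)^-1).
  split; first by apply: measurable_wrtV; case: nf0.
  by move=> w; rewrite invr_ge0; case: nf0.
have e1 : eqint P (F k) XA XAc by exact: eqint_mul.
pose YA w := expR (- theta w) * up1 w; pose YAc w := expR (theta w) * dn1 w.
have nYA : nnrv (F k) YA.
  by apply: nnrvM => //; apply: nexp; exact: measurable_wrtN.
have nYAc : nnrv (F k) YAc by apply: nnrvM => //; exact: nexp.
have XE : {ae P, forall w, XA w = YA w * iA w * hW w /\
                           XAc w = YAc w * iAc w * hW w}.
  have ae4 : {ae P, forall w, [/\ 0 < rh w, rh w < 1 & sigC m k w != 0] /\ 0 < g w}.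
    by apply: filterS2 ae_rh ae_g => w.
  apply: filterS3 V_split (ae_up_down hm kN) ae4.
  move=> w VE ud [[r0 r1 s0] g0].
  have f0_gt0 : 0 < f0 w by rewrite mulr_gt0 ?expR_gt0.
  have sh0 := sqh_gt0 hm.
  have ZE : g w * pert m k u (fun=> 0) w = rh w + db1 m k w.
    rewrite /pert /u mul0r addr0 /retC /rh /price_of_risk.
    have hE : step m = sqh * sqh by rewrite -expr2 sqr_sqrtr// ltW// (step_gt0 hm).
    rewrite [X in muC m k w * X]hE; field; by rewrite s0 !lt0r_neq0.
  rewrite /XA /XAc ZE VE /YA /YAc /up1 /dn1 /iA /iAc.
  rewrite !(norm_rh r0 r1).
  case: ud => [Aw|Acw].
    rewrite !(indicAcA Aw) (_ : db1 m k w = 1)//.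
    rewrite max_l ?max_r; try by lra.
    by split; field; rewrite lt0r_neq0.
  rewrite !(indicAcAc Acw) (_ : db1 m k w = -1)//.
  rewrite max_r ?max_l; try by lra.
  by split; field; rewrite lt0r_neq0.
have nYAi : nnrv (F k.+1) (fun w => YA w * iA w) by apply: nnrvM => //; exact: up.
have nYAci : nnrv (F k.+1) (fun w => YAc w * iAc w) by apply: nnrvM => //; exact: up.
have e2 : eqint P (F k) (fun w => YA w * (W w * iA w)) (fun w => YAc w * (W w * iAc w)).
  have swap (Y i : T -> R) : (fun w => Y w * (W w * i w)) = (fun w => Y w * i w * W w).
    by apply/funext => w; ring.
  rewrite !swap.
  apply: eqint_trans (eqW_mul nYAci).
  apply: eqint_trans (eqint_sym (eqW_mul nYAi)) _.
  apply: (@eqint_trans _ _ _ _ _ XA).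
    apply: eqint_ae => //.
    - by apply: nnrvM => //; exact: (nnrvW sFk1 nYAi).
    - by apply: nnrvM => //; exact: (nnrvW sFk nif0).
    - by apply: filterS XE => w [-> _].
  apply: (eqint_trans e1); apply: eqint_ae => //.
  - by apply: nnrvM => //; exact: (nnrvW sFk nif0).
  - by apply: nnrvM => //; exact: (nnrvW sFk1 nYAci).
  - by apply: filterS XE => w [_ ->].
have e3 : eqint P (F k) (fun w => YA w * pA w) (fun w => YAc w * pAc w).
  apply: (@eqint_trans _ _ _ _ _ (fun w => YA w * (W w * iA w))).
    exact: (eqint_sym (eqint_mul sFk nYA nWA (nnrvW sFk npA) eq_pA)).
  exact: (eqint_trans e2 (eqint_mul sFk nYAc nWAc (nnrvW sFk npAc) eq_pAc)).
have := eqint_uniq sFk (nnrvM nYA npA) (nnrvM nYAc npAc) e3.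
apply: filterS2 ae_rh => w [r0 r1 _]; rewrite /YA /YAc /up1 /dn1.
by rewrite !(norm_rh r0 r1) !mulrA.
Qed.

(** The condition balance_A, solved for the position alpha. *)
Lemma alpha_optimal : {ae P, forall w, alpha pi k w = alpha_formula P m gp a k w}.
Proof.
have ae1 : {ae P, forall w, weightA P m gp a k w = pA w / 2^-1 /\
    weightAc P m gp a k w = pAc w / 2^-1} by apply: filterS2 weightAE weightAcE => w.
have ae2 : {ae P, forall w, 0 < pA w /\ 0 < pAc w}.
  by apply: filterS2 pA_gt0 pAc_gt0 => w.
have ae3 : {ae P, forall w, [/\ 0 < rh w, rh w < 1 & sigC m k w != 0] /\ 0 < g w}.
  by apply: filterS2 ae_rh ae_g => w.
have ae12 : {ae P, forall w, (weightA P m gp a k w = pA w / 2^-1 /\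
    weightAc P m gp a k w = pAc w / 2^-1) /\ (0 < pA w /\ 0 < pAc w)}.
  by apply: filterS2 ae1 ae2 => w.
apply: filterS3 balance_A ae12 ae3 => w bal [[EA EAc] [p0 pc0]] [[r0 r1 s0] g0].
rewrite /alpha_formula EA EAc gpk -/(rh w).
exact: (alpha_algebra g0 s0 (sqh_gt0 hm) r0 r1 p0 pc0 bal).
Qed.

Let Lam w := `|pricing_kernel1 P m gp k w|.

(* the coefficients of the kernel on the two events *)
Let KA w := `|1 - rh w| * (2 * pA w)^-1.
Let KAc w := `|1 + rh w| * (2 * pAc w)^-1.

Let nKp (p : T -> R) : nnrv (F k) p -> nnrv (F k) (fun w => (2 * p w)^-1).
Proof.
move=> [mp p0]; split; last by move=> w; rewrite invr_ge0 mulr_ge0.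
by apply: measurable_wrtV; apply: measurable_wrtM => //; exact: measurable_wrt_cst.
Qed.

Let nKA : nnrv (F k) KA.
Proof.
apply: nnrvM; last exact: nKp.
by apply: nnorm; apply: measurable_wrtB => //; exact: measurable_wrt_cst.
Qed.

Let nKAc : nnrv (F k) KAc.
Proof.
apply: nnrvM; last exact: nKp.
by apply: nnorm; apply: measurable_wrtD => //; exact: measurable_wrt_cst.
Qed.

Lemma pricing_kernel1_measurable : measurable_wrt (F k.+1) (pricing_kernel1 P m gp k).
Proof.
have mw : measurable_wrt (F k.+1) W by case: nW.
have mrh : measurable_wrt (F k.+1) rh.
  exact: (measurable_wrt_filt hm (leqnSn k) kN rh_measurable).
have m1 := @measurable_wrt_cst _ _ _ (F k.+1) (1 : R).
apply: (@measurable_fun_ifT _ _ (g_sigma_algebraType (F k.+1))).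
- apply: measurable_fun_eqr; first exact: (db1_measurable hm kN).
  exact: m1.
- apply: measurable_wrtM; first exact: measurable_wrtB.
  apply: measurable_wrtM => //; apply: measurable_wrtV.
  apply: (measurable_wrt_filt hm (leqnSn k) kN).
  exact: (weightA_measurable hm mgp ma kN).
- apply: measurable_wrtM; first exact: measurable_wrtD.
  apply: measurable_wrtM => //; apply: measurable_wrtV.
  apply: (measurable_wrt_filt hm (leqnSn k) kN).
  exact: (weightAc_measurable hm mgp ma kN).
Qed.

Let nLam : nnrv (F k.+1) Lam.
Proof. exact: (nnorm pricing_kernel1_measurable). Qed.

Let regular w := [/\ 0 < rh w, rh w < 1, 0 < pA w, 0 < pAc w &
  evA m k w \/ evAc m k w].

Let ae_regular : {ae P, forall w, regular w}.
Proof.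
have ae2 : {ae P, forall w, 0 < pA w /\ 0 < pAc w}.
  by apply: filterS2 pA_gt0 pAc_gt0 => w.
by apply: filterS3 ae_rh ae2 (ae_up_down hm kN) => w [? ? _] [? ?] ?; split.
Qed.

Let kernelE : {ae P, forall w, pricing_kernel1 P m gp k w =
  KA w * (W w * iA w) + KAc w * (W w * iAc w)}.
Proof.
apply: filterS3 ae_regular weightAE weightAcE => w [r0 r1 p0 pc0 ud] EA EAc.
rewrite /pricing_kernel1 EA EAc -/(rh w) -/W /KA /KAc /iA /iAc.
rewrite !(norm_rh r0 r1).
case: ud => [Aw|Acw].
  rewrite !(indicAcA Aw) (_ : db1 m k w = 1)// eqxx.
  by field; rewrite !lt0r_neq0.
rewrite !(indicAcAc Acw) (_ : db1 m k w = -1)// ifF; last by apply/eqP => ?; lra.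
by field; rewrite !lt0r_neq0.
Qed.

Lemma pricing_kernel1_gt0 : {ae P, forall w, 0 < pricing_kernel1 P m gp k w}.
Proof.
apply: filterS2 ae_regular kernelE => w [r0 r1 p0 pc0 ud] ->.
have KA0 : 0 < KA w.
  by rewrite mulr_gt0 ?normr_gt0 ?invr_gt0 ?mulr_gt0// subr_eq0 gt_eqF.
have KAc0 : 0 < KAc w.
  by rewrite mulr_gt0 ?normr_gt0 ?invr_gt0 ?mulr_gt0// gt_eqF// addr_gt0.
rewrite /iA /iAc; case: ud => [Aw|Acw].
  by rewrite !(indicAcA Aw) !mulr0 addr0 mulr1 mulr_gt0.
by rewrite !(indicAcAc Acw) !mulr0 add0r mulr1 mulr_gt0.
Qed.

Let LamE : {ae P, forall w, Lam w = KA w * (W w * iA w) + KAc w * (W w * iAc w)}.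
Proof. by apply: filterS2 kernelE pricing_kernel1_gt0 => w <- /gtr0_norm. Qed.

Let Lam_one : eqint P (F k) Lam (fun=> 1).
Proof.
have n2 (f Wi : T -> R) : nnrv (F k) f -> nnrv measurable Wi ->
    nnrv measurable (fun w => f w * Wi w).
  by move=> nf nWi; apply: nnrvM => //; exact: nnrvW nf.
have npm (f : T -> R) : nnrv (F k) f -> nnrv measurable f by exact: nnrvW.
apply: (@eqint_trans _ _ _ _ _ (fun w => KA w * (W w * iA w) + KAc w * (W w * iAc w))).
  apply: eqint_ae => //; [exact: nnrvW nLam|].
  by apply: nnrvD; [exact: (n2 _ _ nKA nWA)|exact: (n2 _ _ nKAc nWAc)].
apply: (@eqint_trans _ _ _ _ _ (fun w => KA w * pA w + KAc w * pAc w)).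
  have [nA nAc] := (nnrvM nKA npA, nnrvM nKAc npAc).
  apply: (eqintD sFk (n2 _ _ nKA nWA) (n2 _ _ nKAc nWAc) (npm _ nA) (npm _ nAc)).
    exact: (eqint_mul sFk nKA nWA (npm _ npA) eq_pA).
  exact: (eqint_mul sFk nKAc nWAc (npm _ npAc) eq_pAc).
apply: (eqint_ae sFk _ (n1 _)); first exact: npm (nnrvD (nnrvM nKA npA) (nnrvM nKAc npAc)).
apply: filterS ae_regular => w [r0 r1 p0 pc0 _]; rewrite /KA /KAc.
rewrite !(norm_rh r0 r1).
by field; rewrite !lt0r_neq0.
Qed.

(* balance_A says that KA / KAc is e^-theta / e^theta, the ratio of the two
   values of V / (f0 hW): the kernel and the marginal loss V are proportional
   given F k *)
Let kap w := expR (theta w) * KA w * (f0 w)^-1.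

Let nkap : nnrv (F k) kap.
Proof.
apply: nnrvM; first by apply: nnrvM => //; exact: nexp.
split; first by apply: measurable_wrtV; case: nf0.
by move=> w; rewrite invr_ge0; case: nf0.
Qed.

Let kernel_V (H : T -> R) : nnrv (F k.+1) H ->
  eqint P (F k) (fun w => Lam w * H w) (fun w => kap w * (V w * H w)).
Proof.
move=> nH.
pose K w := (KA w * iA w + KAc w * iAc w) * H w.
have nK : nnrv (F k.+1) K.
  apply: nnrvM nH; apply: nnrvD; [exact: nnrvM (up nKA) niA|].
  exact: nnrvM (up nKAc) niAc.
apply: (@eqint_trans _ _ _ _ _ (fun w => K w * W w)).
  apply: eqint_ae => //.
  - by apply: (nnrvW sFk1); exact: nnrvM.
  - by apply: (nnrvW sFk1); exact: nnrvM.
  - by apply: filterS LamE => w ->; rewrite /K; ring.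
apply: (eqint_trans (eqint_sym (eqW_mul nK))); apply: eqint_ae => //.
- by apply: nnrvM => //; exact: (nnrvW sFk1 nK).
- apply: nnrvM; first exact: (nnrvW sFk nkap).
  by apply: nnrvM => //; exact: (nnrvW sFk1 nH).
apply: filterS3 V_split ae_regular balance_A => w VE [r0 r1 p0 pc0 ud] bal.
have f0_gt0 : 0 < f0 w by rewrite mulr_gt0 ?expR_gt0.
have e0 := expR_gt0 (theta w).
have KE : expR (theta w) * KA w * expR (theta w) = KAc w.
  rewrite /KA /KAc !(norm_rh r0 r1).
  have E : (1 + rh w) * pA w = expR (theta w) * expR (theta w) * ((1 - rh w) * pAc w).
    rewrite -mulrA -bal expRN mulrA mulfV ?mul1r//; exact: lt0r_neq0.
  have -> : 1 + rh w = expR (theta w) * expR (theta w) * ((1 - rh w) * pAc w) / pA w.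
    by rewrite -E mulfK// lt0r_neq0.
  by field; rewrite !lt0r_neq0.
have KE' : expR (theta w) * KA w * expR (- theta w) = KA w.
  by rewrite mulrAC -expRD subrr expR0 mul1r.
rewrite /K VE /kap -KE -[in LHS]KE' expRN.
by field; rewrite !lt0r_neq0.
Qed.

(** Since V and the kernel have proportional conditional means (kernel_V), the
    first-order condition in the derivative is the fairness of its payoff under
    the kernel. *)
Lemma kernel_optimal : kernel_spec P m Lam k.
Proof.
have mpay : measurable_wrt (F k.+1) payoff := payoff_measurable hm optk.
(* the perturbation by 1 / g shares moves the exponent by the payoff itself *)
have [finp finn fair] := foc_pert hm hx optk (@measurable_wrt_cst _ _ _ (F k) 0)
  (measurable_wrtV mg).
set Z := pert _ _ _ _ in finp finn fair.
have ZE : {ae P, forall w, g w * Z w = payoff w}.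
  apply: filterS ae_g => w g0; rewrite /Z /pert mul0r add0r mulrA mulfV ?mul1r//.
  exact: lt0r_neq0.
have mZ : measurable_wrt (F k.+1) (fun w => g w * Z w).
  apply: measurable_wrtM; first exact: (measurable_wrt_filt hm (leqnSn k) kN mg).
  apply: (pert_measurable hm optk); first exact: measurable_wrt_cst.
  exact: measurable_wrtV.
have nmax (f : T -> R) : measurable_wrt (F k.+1) f ->
    nnrv measurable (fun w => V w * Num.max (f w) 0).
  by move=> mf; apply: nnrvM => //; apply: (nnrvW sFk1); exact: nnrv_max.
have mNZ := measurable_wrtN mZ; have mNpay := measurable_wrtN mpay.
have eqp : eqint P (F k) (fun w => V w * Num.max (g w * Z w) 0)
                         (fun w => V w * Num.max (payoff w) 0).
  by apply: eqint_ae => //; [exact: nmax|exact: nmax|apply: filterS ZE => w ->].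
have eqn : eqint P (F k) (fun w => V w * Num.max (- (g w * Z w)) 0)
                         (fun w => V w * Num.max (- payoff w) 0).
  by apply: eqint_ae => //; [exact: nmax|exact: nmax|apply: filterS ZE => w ->].
have fair' := eqint_trans (eqint_sym eqp) (eqint_trans fair eqn).
have kerp := kernel_V (nnrv_max mpay); have kern := kernel_V (nnrv_max mNpay).
split => //.
- by apply: filterS pricing_kernel1_gt0 => w ?; rewrite /Lam normr_gt0 gt_eqF.
- apply: cfin_eqint (eqint_sym kerp) _; apply: cfin_mul => //; first exact: nmax.
  exact: cfin_eqint eqp finp.
- apply: cfin_eqint (eqint_sym kern) _; apply: cfin_mul => //; first exact: nmax.
  exact: cfin_eqint eqn finn.
- apply: (eqint_trans kerp); apply: eqint_trans (eqint_sym kern).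
  by apply: eqint_mul => //; exact: nmax.
Qed.

End one_date.

(** * Change of measure *)

Section density.
Context {dsp : measure_display} {T : measurableType dsp} {R : realType}.
Variables (P : probability T R) (L : T -> R).
Hypothesis nL : nnrv measurable L.
Local Open Scope ereal_scope.

Let sT := @measurable_sub_sigma _ T.

Lemma density_exists : \int[P]_w (L w)%:E = 1 ->
  exists Q : probability T R, has_density Q P L.
Proof.
move=> intL.
pose Q0 := density_image P (@measurable_id _ T setT) (nnrvT sT nL) nL.2.
have Q1 : Q0 setT = 1 by rewrite -[RHS]intL.
pose Qm := Measure_isProbability.Build _ _ _ Q0 Q1.
pose Q : probability T R := HB.pack Q0 Qm.
by exists Q.
Qed.

Variable Q : probability T R.
Hypothesis QL : has_density Q P L.

(** The instance X = 1 of eqint_mul_gen, for the sigma-algebra of all events. *)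
Lemma density_integral A X : measurable A -> nnrv measurable X ->
  \int[Q]_(w in A) (X w)%:E = \int[P]_(w in A) (X w * L w)%:E.
Proof.
move=> mA [mX X0].
have := @eqint_mul_gen _ _ _ Q P measurable (fun=> 1%R) L X sT _ (nnrvT sT nL) _
  nL.2 mX X0 _ _ mA.
move=> <- //.
- by apply: eq_integral => w _; rewrite mulr1.
- move=> B mB; rewrite -[RHS](QL mB).
  by rewrite -[RHS]mul1e -integral_cst.
Qed.

Lemma ae_density : {ae P, forall w, (0 < L w)%R} ->
  forall E : set T, Q.-negligible E -> P.-negligible E.
Proof.
move=> L0 E [A [mA QA EA]]; apply: (negligibleS EA).
have intL0 : \int[P]_(w in A) (L w)%:E = 0 by rewrite -(QL mA).
have nA : {ae P, forall w, ~ A w}.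
  apply: filterS2 L0 (int_eq0 mA nL intL0) => w Lw h Aw.
  by move: Lw; rewrite h// ltxx.
by apply: negligibleS nA => w Aw /=; exact.
Qed.

Lemma density_ae E : P.-negligible E -> Q.-negligible E.
Proof.
move=> [A [mA PA EA]]; exists A; split => //.
rewrite (QL mA) null_set_integral//.
by apply: measurable_funTS; exact: nnrvT_ereal nL.
Qed.

End density.

Section change_of_measure.
Context {dsp : measure_display} {T : measurableType dsp} {R : realType}.
Variables (P : probability T R) (m : market T R).
Hypothesis hm : market_spec P m.
Local Notation N := (nsteps m).
Local Notation F := (filt m).
Variable Lam : nat -> T -> R.
Hypothesis hLam : forall k, (k < N)%N -> kernel_spec P m (Lam k) k.

Let sT := @measurable_sub_sigma _ T.

Let n1 (G : set (set T)) : nnrv G (fun=> 1 : R) := nnrv_cst G ler01.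

(* the density process between the dates i and j *)
Let slice i j : T -> R := fun w => \prod_(i <= l < j) Lam l w.

Let nslice i j : (j <= N)%N -> nnrv (F j) (slice i j).
Proof.
elim: j => [|j IH] jN.
  have -> : slice i 0 = (fun=> 1) by apply/funext => w; rewrite /slice big_geq.
  exact: n1.
have [ij|ji] := leqP i j; last first.
  have -> : slice i j.+1 = (fun=> 1) by apply/funext => w; rewrite /slice big_geq.
  exact: n1.
have -> : slice i j.+1 = (fun w => slice i j w * Lam j w).
  by apply/funext => w; rewrite /slice big_nat_recr.
apply: nnrvM; last exact: kernel_nnrv (hLam jN).
apply: nnrv_sub (IH (ltnW jN)); [exact: filt_sigma hm _ (ltnW jN)|
  exact: filt_sigma hm _ jN|exact: filt_incr hm _ _ (leqnSn j) jN].
Qed.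

(* tower property, backwards from the date N *)
Let slice_one k : (k <= N)%N -> eqint P (F k) (slice k N) (fun=> 1).
Proof.
move=> kN; rewrite -(subKn kN); elim: (N - k)%N (leq_subr k N) => [|i IH] iN.
  rewrite subn0; have -> // : slice N N = (fun=> 1).
  by apply/funext => w; rewrite /slice big_geq.
set l := (N - i.+1)%N.
have lN : (l < N)%N by rewrite /l ltn_subrL (leq_ltn_trans (leq0n i) iN).
have lE : (N - i)%N = l.+1 by rewrite /l subnSK.
have := IH (ltnW iN); rewrite lE => IHl.
have sl1 := filt_sigma hm lN.
have -> : slice l N = (fun w => Lam l w * slice l.+1 N w).
  by apply/funext => w; rewrite /slice big_ltn.
apply: eqint_trans (kernel_one (hLam lN)).
apply: (eqint_sub (filt_incr hm (leqnSn l) lN)).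
rewrite [X in eqint _ _ _ X](_ : _ = (fun w => Lam l w * 1)); last first.
  by apply/funext => w; rewrite mulr1.
apply: eqint_mul => //; first exact: kernel_nnrv (hLam lN).
exact: nnrvW (filt_sigma hm (leqnn N)) (nslice _ (leqnn N)).
Qed.

Let L := slice 0 N.

Let nL : nnrv measurable L := nnrvW (filt_sigma hm (leqnn N)) (nslice 0 (leqnn N)).

Lemma kernel_density_exists : exists Q : probability T R,
  has_density Q P (fun w => \prod_(k < N) Lam k w).
Proof.
have -> : (fun w => \prod_(k < N) Lam k w) = L.
  by apply/funext => w; rewrite /L /slice big_mkord.
apply: density_exists => //.
rewrite (slice_one (leq0n N) (subGT (filt_sigma hm (leq0n N)))).
by rewrite -[RHS](@probability_setT _ _ _ P) -[RHS]mul1e -integral_cst.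
Qed.

Variable Q : probability T R.
Hypothesis QL' : has_density Q P (fun w => \prod_(k < N) Lam k w).

Let QL : has_density Q P L.
Proof.
by move=> A mA; rewrite QL'//; apply: eq_integral => w _; rewrite /L /slice big_mkord.
Qed.

Let L_gt0 : {ae P, forall w, 0 < L w}.
Proof.
have : {ae P, forall w j, (j < N)%N -> 0 < Lam j w}.
  apply: ae_foralln => j; have [jN|_] := boolP (j < N)%N; last exact: aeW.
  by apply: filterS (kernel_gt0 (hLam jN)).
apply: filterS => w Lam0; rewrite /L /slice big_mkord.
by apply: prodr_gt0 => i _; exact: Lam0.
Qed.

Section one_step.
Variable k : nat.
Hypothesis kN : (k < N)%N.

Let sFk := filt_sigma hm (ltnW kN).
Let sFk1 := filt_sigma hm kN.
Let Fk_k1 := filt_incr hm (leqnSn k) kN.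
Let nLam : nnrv (F k.+1) (Lam k) := kernel_nnrv (hLam kN).

Let nhead : nnrv (F k) (slice 0 k) := nslice 0 (ltnW kN).

(** Given F k.+1 the later kernels have mean 1, so for variables of F k.+1 only
    the kernels up to the date k matter. *)
Lemma int_one_step A X : F k A -> nnrv (F k.+1) X ->
  (\int[Q]_(w in A) (X w)%:E = \int[P]_(w in A) (slice 0 k w * (Lam k w * X w))%:E)%E.
Proof.
move=> FA nX; have mA := subG_measurable sFk FA.
rewrite (density_integral nL QL mA (nnrvW sFk1 nX)).
pose f w := X w * (slice 0 k w * Lam k w).
have nf : nnrv (F k.+1) f.
  by apply: nnrvM => //; apply: nnrvM => //; exact: nnrv_sub nhead.
have LE w : X w * L w = f w * slice k.+1 N w.
  rewrite /f /L /slice (@big_cat_nat _ _ _ k)//=; last exact: ltnW.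
  by rewrite (big_ltn kN); ring.
under eq_integral do rewrite LE.
rewrite (eqint_mul sFk1 nf _ (n1 _) (slice_one kN)).
- by apply: eq_integral => w _; rewrite /f; congr EFin; ring.
- exact: nnrvW (filt_sigma hm (leqnn N)) (nslice _ (leqnn N)).
- exact: Fk_k1.
Qed.

Lemma eqint_one_step X X' : nnrv (F k.+1) X -> nnrv (F k.+1) X' ->
  eqint P (F k) (fun w => Lam k w * X w) (fun w => Lam k w * X' w) ->
  eqint Q (F k) X X'.
Proof.
move=> nX nX' XX' A FA; rewrite !int_one_step//.
by apply: (eqint_mul sFk nhead) FA => //; apply: (nnrvW sFk1); exact: nnrvM.
Qed.

Lemma cfin_one_step X : nnrv (F k.+1) X ->
  cfin P (F k) (fun w => Lam k w * X w) -> cfin Q (F k) X.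
Proof.
move=> nX finX.
have nLX : nnrv measurable (fun w => Lam k w * X w).
  by apply: (nnrvW sFk1); exact: nnrvM.
have [C [ndC GC negC] finC] := cfin_mul sFk nhead nLX finX.
exists C; first by split => //; exact: (density_ae nL QL).
by move=> n; rewrite int_one_step.
Qed.

(** The payoff of the derivative is z = D' + dividend - D, where D and D' are
    the prices at the dates k and k.+1, and D' + dividend may have no mean. The
    identity (D' + dividend)^+ + z^- + D^- = (D' + dividend)^- + z^+ + D^+ is
    conditioned under Q; the terms in z are finite and equal by fairness and
    disappear, which leaves D. *)
Lemma price_one_step : {ae P, forall w, (priceD m k w)%:E =
  cexp Q (F k) (fun v => (priceD m k.+1 v + dividend m k v)%:E) w}.
Proof.
have hD := priceD_adapted (market_assets hm).
have mD : measurable_wrt (F k) (priceD m k) by apply: hD; exact: ltnW.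
pose f w := priceD m k.+1 w + dividend m k w.
pose z w := incr (priceD m) k w + dividend m k w.
have mdiv : measurable_wrt (F k.+1) (dividend m k).
  apply: (measurable_wrt_filt hm (leqnSn k) kN).
  by apply: (dividend_measurable hm); exact: ltnW.
have mf : measurable_wrt (F k.+1) f by apply: measurable_wrtD => //; exact: hD.
have mz : measurable_wrt (F k.+1) z.
  by apply: measurable_wrtD => //; exact: (incr_measurable hm).
have nzp := nnrv_max mz; have nzn := nnrv_max (measurable_wrtN mz).
have nfp := nnrv_max mf; have nfn := nnrv_max (measurable_wrtN mf).
have ndp := nnrv_max mD; have ndn := nnrv_max (measurable_wrtN mD).
have TT (X : T -> R) : nnrv (F k.+1) X -> nnrv measurable X by exact: nnrvW.
have T0 (X : T -> R) : nnrv (F k) X -> nnrv measurable X by exact: nnrvW.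
have cfzp := cfin_one_step nzp (kernel_cfinp (hLam kN)).
have cfzn := cfin_one_step nzn (kernel_cfinn (hLam kN)).
have fair := eqint_one_step nzp nzn (kernel_fair (hLam kN)).
have fE w : f w = z w + priceD m k w by rewrite /f /z /incr; ring.
have cfp : cfin Q (F k) (fun w => Num.max (f w) 0).
  apply: (cfin_le sFk (TT _ nfp) (nnrvD (TT _ nzp) (T0 _ ndp))).
    apply: aeW => w; rewrite fE.
    by case: (leP (z w) 0); case: (leP (priceD m k w) 0);
      case: (leP (z w + priceD m k w) 0); lra.
  by apply: (cfinD sFk (TT _ nzp) (T0 _ ndp) cfzp); exact: cfin_nnrv.
have cfn : cfin Q (F k) (fun w => Num.max (- f w) 0).
  apply: (cfin_le sFk (TT _ nfn) (nnrvD (TT _ nzn) (T0 _ ndn))).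
    apply: aeW => w; rewrite fE.
    by case: (leP (- z w) 0); case: (leP (- priceD m k w) 0);
      case: (leP (- (z w + priceD m k w)) 0); lra.
  by apply: (cfinD sFk (TT _ nzn) (T0 _ ndn) cfzn); exact: cfin_nnrv.
pose p := cexpv Q (F k) (fun w => Num.max (f w) 0).
pose r := cexpv Q (F k) (fun w => Num.max (- f w) 0).
pose y := cexpv Q (F k) (fun w => Num.max (z w) 0).
have np : nnrv (F k) p by apply: nnrv_cexpv => //; exact: TT.
have nr : nnrv (F k) r by apply: nnrv_cexpv => //; exact: TT.
have ny : nnrv (F k) y by apply: nnrv_cexpv => //; exact: TT.
have ep : eqint Q (F k) _ p := eqint_cexpv sFk (TT _ nfp) cfp.
have er : eqint Q (F k) _ r := eqint_cexpv sFk (TT _ nfn) cfn.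
have eyp : eqint Q (F k) _ y := eqint_cexpv sFk (TT _ nzp) cfzp.
have eyn : eqint Q (F k) (fun w => Num.max (- z w) 0) y.
  exact: eqint_trans (eqint_sym fair) eyp.
have bal : eqint Q (F k) (fun w => p w + (y w + Num.max (- priceD m k w) 0))
                         (fun w => r w + (y w + Num.max (priceD m k w) 0)).
  have sum_eq (X X' d : T -> R) (X'' : T -> R) : nnrv (F k.+1) X -> nnrv (F k) X' ->
      nnrv (F k) d -> nnrv (F k.+1) X'' -> eqint Q (F k) X X' -> eqint Q (F k) X'' y ->
      eqint Q (F k) (fun w => X w + (X'' w + d w)) (fun w => X' w + (y w + d w)).
    move=> nX nX' nd nX'' e1 e2.
    apply: (eqintD sFk (TT _ nX)) => //; [|exact: T0| |].
    - by apply: nnrvD; [exact: TT|exact: T0].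
    - by apply: nnrvD; exact: T0.
    - exact: (eqintD sFk (TT _ nX'') (T0 _ nd) (T0 _ ny) (T0 _ nd)).
  apply: eqint_trans (eqint_sym (sum_eq _ _ _ _ nfp np ndn nzn ep eyn)) _.
  apply: eqint_trans (sum_eq _ _ _ _ nfn nr ndp nzp er eyp) => A FA.
  apply: eq_integral => w _; congr EFin; rewrite fE.
  have := maxr_posneg (z w); have := maxr_posneg (priceD m k w).
  have := maxr_posneg (z w + priceD m k w); lra.
have balQ := eqint_uniq sFk (nnrvD np (nnrvD ny ndn)) (nnrvD nr (nnrvD ny ndp)) bal.
have cexpQ := cexp_ae sFk (measurable_wrtT sFk1 mf) np nr ep er.
apply: (ae_density nL QL L_gt0); apply: filterS2 balQ cexpQ => w balw Ew.
rewrite [RHS]Ew; congr EFin.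
have := maxr_posneg (priceD m k w); lra.
Qed.

End one_step.
End change_of_measure.

(** * Both equilibria *)

Section equilibrium.
Context {dsp : measure_display} {T : measurableType dsp} {R : realType}.
Variables (P : probability T R) (m : market T R).
Hypothesis hm : market_spec P m.
Local Notation N := (nsteps m).
Local Notation F := (filt m).
Variables (x : nat -> T -> R) (pi : @strategy _ T R).
Hypothesis hx : adapted m x.
Variables (start : nat -> nat) (gp : nat -> T -> R).
Hypothesis opt : forall k, (k < N)%N -> one_date_optimal P m x pi (start k) k.
Hypothesis gpE : forall k, (k < N)%N -> gp k = gamma m (start k).

Let mgp k : (k < N)%N -> measurable_wrt (F k) (gp k).
Proof. by move=> kN; rewrite gpE//; exact: (gamma_k_measurable hm (opt kN)). Qed.

(** Backwards in time: the formula at the date k only involves the positions at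
    the later dates. *)
Lemma alpha_equilibrium k : (k < N)%N ->
  {ae P, forall w, alpha pi k w = alpha_sol P m gp k w}.
Proof.
have [n] := ubnP (N - k)%N; elim: n k => // n IH k kn kN.
rewrite (alpha_solE P gp kN).
apply: (alpha_optimal hm hx (opt kN) (gpE kN) mgp) => j kj jN.
by apply: IH => //; rewrite -ltnS (leq_trans _ kn)// ltnS ltn_sub2l.
Qed.

Let later k j : (k < j)%N -> (j < N)%N ->
  {ae P, forall w, alpha pi j w = alpha_sol P m gp j w}.
Proof. by move=> _; exact: alpha_equilibrium. Qed.

(* the kernels are almost surely positive; the absolute value makes them
   nonnegative everywhere *)
Let Lam k w := `|pricing_kernel1 P m gp k w|.

Let Lam_spec k (kN : (k < N)%N) : kernel_spec P m (Lam k) k :=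
  kernel_optimal hm hx (opt kN) (gpE kN) mgp (@later k).

Lemma price_equilibrium : exists2 Q : probability T R,
  has_density Q P (pricing_kernel P m gp) &
  forall n, (1 <= n <= N)%N ->
    {ae P, forall w, (priceD m (N - n) w)%:E =
      cexp Q (F (N - n)) (fun v =>
        (priceD m (N - n + 1) v + dividend m (N - n) v)%:E) w}.
Proof.
have [Q QL] := kernel_density_exists hm Lam_spec.
exists Q => [A mA|n /andP[n1 nN]]; last first.
  by rewrite addn1; apply: (price_one_step hm Lam_spec QL);
    rewrite ltn_subrL n1 (leq_trans n1).
have mprod (Z : nat -> T -> R) : (forall j, (j < N)%N -> measurable_fun setT (Z j)) ->
    measurable_fun A (fun w => (\prod_(j < N) Z j w)%:E).
  move=> mZ; apply/measurable_EFinP/measurable_funTS.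
  by apply: measurable_prod => j _; exact: mZ.
have mker j : (j < N)%N -> measurable_fun setT (pricing_kernel1 P m gp j).
  move=> jN; apply: (measurable_wrtT (filt_sigma hm jN)).
  exact: (pricing_kernel1_measurable hm (opt jN) mgp).
rewrite (QL A mA); apply: ae_eq_integral => //.
- by apply: mprod => j jN; apply: measurableT_comp => //; exact: mker.
- exact: mprod.
- have : {ae P, forall w j, (j < N)%N -> Lam j w = pricing_kernel1 P m gp j w}.
    apply: ae_foralln => j; have [jN|_] := boolP (j < N)%N; last exact: aeW.
    have := pricing_kernel1_gt0 hm hx (opt jN) (gpE jN) mgp (@later j).
    by apply: filterS => w /gtr0_norm.
  apply: filterS => w LamE _; congr EFin; apply: eq_bigr => j _.
  exact: LamE.
Qed.

End equilibrium.

Theorem theorem3p2 (R : realType) (dsp : measure_display)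
  (T : measurableType dsp) (P : probability T R) (m : market T R)
  (hm : market_spec P m)
  (x : nat -> T -> R) (hx : adapted m x) :
  (forall pi : strategy, tc_equilibrium P m x pi -> tc_finite P m x pi ->
    (exists2 Q : probability T R,
       has_density Q P (pricing_kernel P m (gamma m)) &
       forall n, (1 <= n <= nsteps m)%N ->
         {ae P, forall w, (priceD m (nsteps m - n) w)%:E =
           cexp Q (filt m (nsteps m - n)) (fun v =>
             (priceD m (nsteps m - n + 1) v +
              dividend m (nsteps m - n) v)%:E) w}) /\
    (forall k, (k < nsteps m)%N ->
       {ae P, forall w,
         alpha pi k w = alpha_sol P m (gamma m) k w})) /\
  (forall pi : strategy, ti_equilibrium P m x pi -> ti_finite P m x pi ->
    (exists2 Q : probability T R,
       has_density Q P (pricing_kernel P m (fun _ => gamma m 0%N)) &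
       forall n, (1 <= n <= nsteps m)%N ->
         {ae P, forall w, (priceD m (nsteps m - n) w)%:E =
           cexp Q (filt m (nsteps m - n)) (fun v =>
             (priceD m (nsteps m - n + 1) v +
              dividend m (nsteps m - n) v)%:E) w}) /\
    (forall k, (k < nsteps m)%N ->
       {ae P, forall w,
         alpha pi k w = alpha_sol P m (fun _ => gamma m 0%N) k w})).
Proof.
split=> pi [opt clear] fin.
- have opt1 k : (k < nsteps m)%N -> one_date_optimal P m x pi k k.
    move=> kN; have [adm best] := opt k kN.
    have comp pi' : admissible P m x k pi' -> only_at m pi k k pi' ->
        tc_competitor P m x pi k pi'.
      move=> adm' only; split=> // j /andP[kj jN].
      by apply: only => //; [exact: ltnW|move=> jk; rewrite jk ltnn in kj].
    split => // [pi' adm' only||pi' adm' only].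
    + by apply: (fin k kN); exact: comp.
    + by apply: (fin k kN); exact: comp.
    + by apply: best; exact: comp.
  split; first exact: (price_equilibrium hm hx opt1).
  by move=> k kN; apply: (alpha_equilibrium hm hx opt1).
- have [adm best] := opt.
  have N0 := nsteps_gt0 hm.
  have opt1 k : (k < nsteps m)%N -> one_date_optimal P m x pi 0 k.
    move=> kN; split => // [pi' adm' only||pi' adm' only].
    + apply: (fin k kN) => // j jN jk; exact: only.
    + exact: (fin 0%N N0).
    + exact: best.
  split; first exact: (price_equilibrium hm hx opt1).
  by move=> k kN; apply: (alpha_equilibrium hm hx opt1).
Qed.
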